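(* Let $c:\mathcal X\to\mathbb R$ be a bounded cost function, let $\pi^*_\varepsilon$ be the unique minimizer defining $S_\varepsilon(\nu_1,\dots,\nu_m)$ and $\hat\pi^N_\varepsilon$ the unique minimizer defining $S_\varepsilon(\hat\nu^N_1,\dots,\hat\nu^N_m)$. Then there exists a constant $C:=C(m,\varepsilon,\|c\|_\infty)>0$ such that for any $g\in L^\infty(\otimes_{j=1}^m\nu_j)$ and all $t>0$, with probability at least $1-(2m^2-2m+2)e^{-t}$, $$|(\pi^*_\varepsilon-\hat\pi^N_\varepsilon)(g)|\le C\|g\|_\infty\sqrt{\frac tN}.$$
   Context: Fix integers $m\ge 2$, $d\ge 1$ and $\varepsilon>0$; $[m]:=\{1,\dots,m\}$. For $j\in[m]$, $\mathcal X_j\subset[-1,1]^d$ is compact with non-empty interior, $\nu_j$ is a Borel probability measure on $\mathcal X_j$, and $\mathcal X=\prod_{j=1}^m\mathcal X_j$. $\Pi(\mu_1,\dots,\mu_m)$ is the set of probability measures on $\mathcal X$ with marginals $\mu_1,\dots,\mu_m$, and $\mathrm{KL}(P\|Q)=\int\log\frac{dP}{dQ}\,dP$ if $P\ll Q$, $+\infty$ otherwise. The entropic multimarginal optimal transport problem is $$S_\varepsilon(\mu_1,\dots,\mu_m)=\inf_{\pi\in\Pi(\mu_1,\dots,\mu_m)}\int_{\mathcal X}c\,d\pi+\varepsilon\,\mathrm{KL}(\pi\|\otimes_{k=1}^m\mu_k);$$ its unique minimizer is called the (multimarginal) Schrödinger coupling. Sampling model: for each $j$, $X^{(j)}_1,\dots,X^{(j)}_N$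 are i.i.d. from $\nu_j$, the $m$ samples are independent, and $\hat\nu_j^N=\frac1N\sum_{k=1}^N\delta_{X_k^{(j)}}$. For a (signed) measure $\mu$, $\mu(g)=\int g\,d\mu$. *)

(* Defs.v *)
From HB Require Import structures.
From mathcomp Require Import all_boot all_order all_algebra.
From mathcomp Require Import all_classical all_reals all_analysis.

Set Implicit Arguments.
Unset Strict Implicit.
Unset Printing Implicit Defensive.

Import Order.TTheory GRing.Theory Num.Theory.
Import numFieldNormedType.Exports.

Local Open Scope classical_set_scope.
Local Open Scope ring_scope.

(* R^d with its Borel sigma-algebra; the carrier is 'rV[R]_d itself. *)
Notation borel_rV R d := (g_sigma_algebraType (@open 'rV[R]_d)).

Section product_probability.
Context (dT : measure_display) (T : measurableType dT) (R : realType).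

Definition pair_cons (n : nat) (p : T * n.-tuple T) : n.+1.-tuple T :=
  [the n.+1.-tuple T of p.1 :: p.2].

Lemma measurable_pair_cons (n : nat) :
  measurable_fun [set: T * n.-tuple T] (@pair_cons n).
Proof. exact: measurable_cons. Qed.

HB.instance Definition _ (n : nat) :=
  isMeasurableFun.Build _ _ _ _ (@pair_cons n) (@measurable_pair_cons n).

(* The product measure mu_0 (x) ... (x) mu_(n-1) on n-tuples, obtained by
   transporting mu_0 \x (mu_1 (x) ... (x) mu_(n-1)) along (x, s) |-> x :: s. *)
Fixpoint tuple_prod (n : nat) :
    ('I_n -> probability T R) -> probability (n.-tuple T) R :=
  match n with
  | 0 => fun _ => \d_([tuple])
  | n'.+1 => fun mu =>
      distribution (mu ord0 \x tuple_prod (mu \o lift ord0))%E (@pair_cons n')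
  end.

Lemma tuple_prod_box (n : nat) (mu : 'I_n -> probability T R)
    (A : 'I_n -> set T) : (forall j, measurable (A j)) ->
  tuple_prod mu [set x | forall j, A j (tnth x j)] =
  (\prod_(j < n) mu j (A j))%E.
Proof.
elim: n => [|n IHn] in mu A * => mA.
  by rewrite big_ord0 /= diracE mem_set//= => -[].
have mB : measurable
    [set x : n.-tuple T | forall j, A (lift ord0 j) (tnth x j)].
  rewrite (_ : [set x | _] =
    \bigcap_(j in [set: 'I_n]) ((@tnth n T ^~ j) @^-1` A (lift ord0 j))).
    apply: fin_bigcap_measurable => // j _; rewrite -[X in measurable X]setTI.
    exact: measurable_tnth.
  by apply/seteqP; split=> [x xA j _|x xA j]; exact: xA.
rewrite big_ord_recl /= -IHn; last by move=> j; exact: mA.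
rewrite -product_measure1E// /distribution /pushforward/=; congr (_ _).
apply/seteqP; split=> -[a s]/=.
  move=> h; split; first exact: (h ord0).
  by move=> j; have := h (lift ord0 j); rewrite /pair_cons tnthS.
move=> [Aa As] j; case: (unliftP ord0 j) => [k ->|-> //].
by rewrite /pair_cons tnthS; exact: As.
Qed.

End product_probability.

Section entropic_transport.
Context (dT : measure_display) (T : measurableType dT) (R : realType).

Definition KL (dU : measure_display) (U : measurableType dU)
    (P Q : probability U R) : \bar R :=
  if `[< P `<< Q >] then
    (\int[P]_x lne (Radon_Nikodym (charge_of_finite_measure P) Q x))%E
  else +oo%E.

Definition couplings (m : nat) (mu : 'I_m -> probability T R) :
    set (probability (m.-tuple T) R) :=
  [set pi | forall j (A : set T), measurable A ->
    pushforward pi (fun x => tnth x j) A = mu j A].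

(* A measure on a subset D of the ambient space is represented by an ambient
   measure concentrated on D; the cost is only integrated over D. *)
Definition transport_cost (m : nat) (eps : R) (D : set (m.-tuple T))
    (c : m.-tuple T -> R) (mu : 'I_m -> probability T R)
    (pi : probability (m.-tuple T) R) : \bar R :=
  (\int[pi]_(x in D) (c x)%:E + eps%:E * KL pi (tuple_prod mu))%E.

Definition S_eps (m : nat) (eps : R) (D : set (m.-tuple T))
    (c : m.-tuple T -> R) (mu : 'I_m -> probability T R) : \bar R :=
  ereal_inf [set transport_cost eps D c mu pi | pi in couplings mu].

(* Minimizers are unique up to equality on measurable sets, KL(. || Q) being
   strictly convex where it is finite. *)
Definition schrodinger_coupling (m : nat) (eps : R) (D : set (m.-tuple T))
    (c : m.-tuple T -> R) (mu : 'I_m -> probability T R)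
    (pi : probability (m.-tuple T) R) : Prop :=
  couplings mu pi /\ transport_cost eps D c mu pi = S_eps eps D c mu.

End entropic_transport.

Section empirical.
Context (dT : measure_display) (T : measurableType dT) (R : realType).
Context (n : nat) (x : 'I_n.+1 -> T).

(* Sample size n.+1, so that the empirical measure is a probability. *)
Definition empirical (A : set T) : \bar R :=
  ((n.+1%:R^-1)%:E * \sum_(k < n.+1) \d_(x k) A)%E.

Let empirical0 : empirical set0 = 0%E.
Proof. by rewrite /empirical big1 ?mule0// => k _; exact: measure0. Qed.

Let empirical_ge0 A : (0 <= empirical A)%E.
Proof. by rewrite mule_ge0// sume_ge0. Qed.

Let empirical_sigma_additive : semi_sigma_additive empirical.
Proof.
pose f (k : nat) : {measure set T -> \bar R} := \d_(x (inord k)).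
have r0 : 0 <= n.+1%:R^-1 :> R by rewrite invr_ge0.
pose mu := mscale (NngNum r0) (msum f n.+1).
rewrite (_ : empirical = mu); first exact: measure_semi_sigma_additive.
apply/funext => A; rewrite /empirical /mu /mscale /msum /=; congr (_ * _)%E.
by apply: eq_bigr => k _; rewrite /f inord_val.
Qed.

HB.instance Definition _ := isMeasure.Build _ _ _ empirical
  empirical0 empirical_ge0 empirical_sigma_additive.

Let empirical_setT : empirical setT = 1%E.
Proof.
rewrite /empirical (eq_bigr (fun=> 1%E)) => [|k _]; last by rewrite diracT.
rewrite sumEFin -EFinM sumr_const card_ord.
by rewrite mulVf// pnatr_eq0.
Qed.

HB.instance Definition _ :=
  Measure_isProbability.Build _ _ _ empirical empirical_setT.

End empirical.

Section sampling.
Context (dO : measure_display) (Omega : measurableType dO).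
Context (dT : measure_display) (T : measurableType dT) (R : realType).
Context (P : probability Omega R).

Definition mutually_independent (I : finType) (X : I -> {RV P >-> T}) : Prop :=
  forall (J : {set I}) (A : I -> set T), (forall i, measurable (A i)) ->
  P (\bigcap_(i in [set` J]) X i @^-1` A i) =
  (\prod_(i in J) P (X i @^-1` A i))%E.

(* m mutually independent samples of size N, the j-th one i.i.d. from nu j. *)
Definition independent_samples (m N : nat) (nu : 'I_m -> probability T R)
    (X : 'I_m -> 'I_N -> {RV P >-> T}) : Prop :=
  (forall j k (A : set T), measurable A -> distribution P (X j k) A = nu j A) /\
  mutually_independent (fun jk : 'I_m * 'I_N => X jk.1 jk.2).

End sampling.

Definition sup_norm (T : Type) (R : realType) (D : set T) (f : T -> R) : R :=
  sup [set `|f x| | x in D].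

(* Main.v *)
From HB Require Import structures.
Require Import Defs.
From mathcomp Require Import all_boot all_order all_algebra.
From mathcomp Require Import all_classical all_reals all_analysis.
From mathcomp Require Import measurable_realfun ess_sup_inf.
From mathcomp Require Import ring lra zify.
Import Order.TTheory GRing.Theory Num.Theory.
Import numFieldNormedType.Exports.
Local Open Scope classical_set_scope.
Local Open Scope ring_scope.
Set Implicit Arguments.
Unset Strict Implicit.
Unset Printing Implicit Defensive.

(** Write mu for the product of the marginals nu_j and M for the sup norm of
    the cost c. The argument compares the two couplings through the density of
    the population one, which turns out to be explicit enough to be transplanted
    onto the empirical marginals.

    The population coupling has a density p with respect to mu. Exchanging the
    j-th coordinates of two points x and y moves mass without changing any
    marginal, so optimality of p forces ln p + c / eps to have the same total
    over the two points before and after the exchange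
    ([first_order_condition], [swap_inequality]). Hence p(x) p(y) and
    p(x') p(y') agree up to the factor exp (4 M / eps), and integrating out y
    coordinate by coordinate confines p between two constants depending only on
    m, eps and M ([minimizer_bounds]). With p bounded away from zero, optimality
    may be tested against the remainder of the additive (ANOVA) approximation of
    ln p + c / eps, which must therefore vanish: p is almost everywhere the Gibbs
    density rho = exp (f_1(x_1) + ... + f_m(x_m) - c / eps), with bounded f_j
    ([schrodinger_potentials]).

    This formula makes sense at every point, so rho can be integrated against the
    product muh of the empirical measures. For couplings of the empirical
    measures, the transport cost differs by a constant from eps times the
    relative entropy with respect to rho, since the f_j only see the marginals
    ([energy_kl]). So the empirical coupling, of density ph, minimizes this
    entropy, and is at least as close to rho as any other coupling. The marginals
    of rho under muh are 1 up to a small error in L^2; correcting that error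
    produces a coupling whose entropy is at most a multiple of its square, and a
    Pinsker-type inequality turns this into an L^1 bound on ph - rho
    ([coupling_stability]). No potentials for the empirical problem are needed.

    What remains is to control the marginal errors of rho and the difference of
    the integrals of g rho against mu and muh. Integrals against muh are averages
    over the N^m ways of picking one observation per sample; replacing one
    observation changes them by O(1 / N), so their fluctuations are sub-Gaussian
    at scale 1 / sqrt N ([mcdiarmid_mgf], [vstat_mgf]). For the marginal errors,
    which are L^2 norms, one fixes the observation at which the error is
    evaluated and averages q-th powers, with q close to t
    ([deviation_moment]). Markov's inequality gives m + 1 exceptional events of
    probability at most 2 exp (- t), and 2 (m + 1) is at most 2 m^2 - 2 m + 2 as
    soon as m is at least 2. *)

(** * Bounded measurable functions and their integrals *)

(** The class in which almost all computations take place: it is stable under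
    algebraic operations, composition and partial integration, and all its members
    are integrable for every probability. *)
Definition bounded_mfun d (U : measurableType d) (R : realType) (f : U -> R) :=
  measurable_fun setT f /\ exists M, forall x, `|f x| <= M.

Definition Rintegrable d (U : measurableType d) (R : realType) (P : probability U R)
    (f : U -> R) := measurable_fun setT f /\ P.-integrable setT (EFin \o f).

Section bounded_mfun.
Context d (U : measurableType d) (R : realType).
Implicit Types f g : U -> R.

Lemma bmf_cst (r : R) : bounded_mfun (fun _ : U => r).
Proof. by split; [exact: measurable_cst|exists `|r|]. Qed.

Lemma bmfD f g : bounded_mfun f -> bounded_mfun g -> bounded_mfun (fun x => f x + g x).
Proof.
move=> [mf [M fM]] [mg [N gN]]; split; first exact: measurable_funD.
by exists (M + N) => x; rewrite (le_trans (ler_normD _ _))// lerD.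
Qed.

Lemma bmfN f : bounded_mfun f -> bounded_mfun (fun x => - f x).
Proof.
move=> [mf [M fM]]; split; first exact: measurableT_comp.
by exists M => x; rewrite normrN.
Qed.

Lemma bmfB f g : bounded_mfun f -> bounded_mfun g -> bounded_mfun (fun x => f x - g x).
Proof. by move=> bf bg; apply: bmfD => //; exact: bmfN. Qed.

Lemma bmfM f g : bounded_mfun f -> bounded_mfun g -> bounded_mfun (fun x => f x * g x).
Proof.
move=> [mf [M fM]] [mg [N gN]]; split; first exact: measurable_funM.
by exists (M * N) => x; rewrite normrM ler_pM.
Qed.

Lemma bmfZ (r : R) f : bounded_mfun f -> bounded_mfun (fun x => r * f x).
Proof. by move=> bf; apply: bmfM => //; exact: bmf_cst. Qed.

Lemma bmf_norm f : bounded_mfun f -> bounded_mfun (fun x => `|f x|).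
Proof.
move=> [mf [M fM]]; split; first exact: measurableT_comp.
by exists M => x; rewrite normr_id.
Qed.

Lemma bmf_sum (I : Type) (s : seq I) (F : I -> U -> R) :
  (forall i, bounded_mfun (F i)) -> bounded_mfun (fun x => \sum_(i <- s) F i x).
Proof.
move=> bF; elim: s => [|i s IH].
  rewrite (_ : (fun x => _) = fun=> 0); first exact: bmf_cst.
  by apply/funext => x; rewrite big_nil.
rewrite (_ : (fun x => _) = fun x => F i x + \sum_(j <- s) F j x).
  exact: bmfD.
by apply/funext => x; rewrite big_cons.
Qed.

Lemma bmf_prod (I : Type) (s : seq I) (F : I -> U -> R) :
  (forall i, bounded_mfun (F i)) -> bounded_mfun (fun x => \prod_(i <- s) F i x).
Proof.
move=> bF; elim: s => [|i s IH].
  rewrite (_ : (fun x => _) = fun=> 1); first exact: bmf_cst.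
  by apply/funext => x; rewrite big_nil.
rewrite (_ : (fun x => _) = fun x => F i x * \prod_(j <- s) F j x).
  exact: bmfM.
by apply/funext => x; rewrite big_cons.
Qed.

Lemma bmf_exp (f : U -> R) n : bounded_mfun f -> bounded_mfun (fun x => f x ^+ n).
Proof.
move=> bf; elim: n => [|n IH].
  exact: bmf_cst.
rewrite (_ : (fun x => _) = fun x => f x * f x ^+ n).
  exact: bmfM.
by apply/funext => x; rewrite exprS.
Qed.

Lemma bmf_indic (A : set U) : measurable A -> bounded_mfun (\1_A : U -> R).
Proof.
move=> mA; split; first exact: measurable_indic.
by exists 1 => x; rewrite indicE; case: (_ \in _); rewrite ?normr1 ?normr0.
Qed.

Lemma bmf_patch (A : set U) (f : U -> R) : measurable A -> measurable_fun A f ->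
  (exists M, forall x, A x -> `|f x| <= M) -> bounded_mfun (f \_ A).
Proof.
move=> mA mf [M fM]; split; first by apply/measurable_restrict => //; rewrite setIidr.
exists (Num.max M 0) => x; rewrite patchE; case: ifPn => xA; rewrite le_max.
  by rewrite fM// -in_setE.
by rewrite normr0 lexx orbT.
Qed.

Lemma bmf_expR f : bounded_mfun f -> bounded_mfun (fun x => expR (f x)).
Proof.
move=> [mf [M fM]]; split; first exact: measurableT_comp.
exists (expR M) => x; rewrite ger0_norm ?expR_ge0// ler_expR.
exact: le_trans (ler_norm _) (fM x).
Qed.

Lemma bmf_comp d' (V : measurableType d') (h : V -> U) f :
  measurable_fun setT h -> bounded_mfun f -> bounded_mfun (fun x => f (h x)).
Proof.
move=> mh [mf [M fM]]; split; first exact: measurableT_comp.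
by exists M.
Qed.

End bounded_mfun.

Section Rintegrable.
Context d (U : measurableType d) (R : realType) (P : probability U R).
Implicit Types f g : U -> R.

Lemma bmf_rint f : bounded_mfun f -> Rintegrable P f.
Proof.
move=> [mf [M fM]]; split=> //.
apply: measurable_bounded_integrable => //=.
  by rewrite [X in (X < _)%E]probability_setT ltry.
by exists M; split; [exact: num_real|move=> y My x _ /=; rewrite (le_trans (fM x))// ltW].
Qed.

Lemma rintD f g : Rintegrable P f -> Rintegrable P g -> Rintegrable P (fun x => f x + g x).
Proof.
move=> [mf rf] [mg rg]; split; first exact: measurable_funD.
exact: (integrableD measurableT rf rg).
Qed.

Lemma rintM f g : Rintegrable P f -> bounded_mfun g -> Rintegrable P (fun x => f x * g x).
Proof.
move=> [mf /integrableP[_ rf]] [mg [M gM]]; split; first exact: measurable_funM.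
apply/integrableP; split; first by apply/measurable_EFinP; exact: measurable_funM.
apply: (@le_lt_trans _ _ (\int[P]_x (`|M|%:E * `|(f x)%:E|))%E).
  apply: ge0_le_integral => //.
  - apply/measurable_EFinP; apply: measurableT_comp => //.
    exact: measurable_funM.
  - apply: emeasurable_funM; first exact: measurable_cst.
    by apply/measurable_EFinP; exact: measurableT_comp.
  - move=> x _; rewrite -EFinM lee_fin/= normrM mulrC ler_wpM2r//.
    exact: le_trans (gM x) (ler_norm _).
rewrite ge0_integralZl//; first by rewrite lte_mul_pinfty.
by apply/measurable_EFinP; exact: measurableT_comp.
Qed.

Lemma rintZ r f : Rintegrable P f -> Rintegrable P (fun x => r * f x).
Proof.
move=> rf; have := rintM rf (bmf_cst U r).
by congr (Rintegrable P _); apply/funext => x; rewrite mulrC.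
Qed.

Lemma rintN f : Rintegrable P f -> Rintegrable P (fun x => - f x).
Proof.
move=> rf; have := rintZ (-1) rf.
by rewrite (_ : (fun x => -1 * f x) = fun x => - f x)//; apply/funext => x; rewrite mulN1r.
Qed.

Lemma rintB f g : Rintegrable P f -> Rintegrable P g -> Rintegrable P (fun x => f x - g x).
Proof. by move=> rf rg; apply: rintD => //; exact: rintN. Qed.

Lemma rint_norm f : Rintegrable P f -> Rintegrable P (fun x => `|f x|).
Proof.
move=> [mf rf]; split; first exact: measurableT_comp.
exact: (integrable_abse rf).
Qed.

Lemma rint_le f g : measurable_fun setT f -> Rintegrable P g ->
  (forall x, `|f x| <= g x) -> Rintegrable P f.
Proof.
move=> mf [mg rg] fg; split=> //; apply: (le_integrable _ _ _ rg) => //.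
  exact/measurable_EFinP.
by move=> x _ /=; rewrite lee_fin (le_trans (fg x))// ler_norm.
Qed.

Lemma RintD f g : Rintegrable P f -> Rintegrable P g ->
  \int[P]_x (f x + g x) = \int[P]_x f x + \int[P]_x g x.
Proof. by move=> [_ rf] [_ rg]; exact: RintegralD. Qed.

Lemma RintB f g : Rintegrable P f -> Rintegrable P g ->
  \int[P]_x (f x - g x) = \int[P]_x f x - \int[P]_x g x.
Proof. by move=> [_ rf] [_ rg]; exact: RintegralB. Qed.

Lemma RintZ r f : Rintegrable P f ->
  \int[P]_x (r * f x) = r * \int[P]_x f x.
Proof. by move=> [_ rf]; exact: RintegralZl. Qed.

Lemma Rint_cst (r : R) : \int[P]_x r = r.
Proof. by rewrite Rintegral_cst// [X in fine X]probability_setT mulr1. Qed.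

Lemma Rint_sum (I : Type) (s : seq I) (F : I -> U -> R) :
  (forall i, bounded_mfun (F i)) ->
  \int[P]_x (\sum_(i <- s) F i x) = \sum_(i <- s) \int[P]_x F i x.
Proof.
move=> bF; elim: s => [|i s IH].
  rewrite big_nil -[RHS](Rint_cst 0); apply: eq_Rintegral => x _.
  by rewrite big_nil.
rewrite big_cons -IH -RintD; [|exact: bmf_rint|exact/bmf_rint/bmf_sum].
by apply: eq_Rintegral => x _; rewrite big_cons.
Qed.

Lemma le_Rint f g : Rintegrable P f -> Rintegrable P g -> (forall x, f x <= g x) ->
  \int[P]_x f x <= \int[P]_x g x.
Proof. by move=> [_ rf] [_ rg] fg; apply: le_Rintegral. Qed.

Lemma Rint_ge0 f : (forall x, 0 <= f x) -> 0 <= \int[P]_x f x.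
Proof. by move=> f0; apply: Rintegral_ge0. Qed.

Lemma Rint_norm_le f : Rintegrable P f -> `|\int[P]_x f x| <= \int[P]_x `|f x|.
Proof. by move=> [_ rf]; apply: le_normr_Rintegral. Qed.

Lemma Rint_bound f M : bounded_mfun f -> (forall x, `|f x| <= M) -> `|\int[P]_x f x| <= M.
Proof.
move=> bf fM; rewrite (le_trans (Rint_norm_le (bmf_rint bf)))//.
rewrite -[leRHS]Rint_cst; apply: le_Rint => //.
  exact/rint_norm/bmf_rint.
exact/bmf_rint/bmf_cst.
Qed.

Lemma EFin_Rint f : Rintegrable P f -> ((\int[P]_x f x)%:E = \int[P]_x (f x)%:E)%E.
Proof. by move=> [_ rf]; rewrite fineK//; exact: integrable_fin_num. Qed.

Lemma Rint_ae f g : measurable_fun setT f -> measurable_fun setT g ->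
  {ae P, forall x, f x = g x} -> \int[P]_x f x = \int[P]_x g x.
Proof.
move=> mf mg fg; congr fine; apply: ae_eq_integral => //; first exact/measurable_EFinP.
  exact/measurable_EFinP.
by apply: filterS fg => x /= fg _; rewrite fg.
Qed.

(** The tool that converts optimality conditions, which are integral identities,
    into pointwise ones. *)
Lemma Rint0_ae f : Rintegrable P f -> (forall x, 0 <= f x) -> \int[P]_x f x = 0 ->
  {ae P, forall x, f x = 0}.
Proof.
move=> rf f0 If; have mf : measurable_fun setT (EFin \o f) by apply/measurable_EFinP; case: rf.
have : ae_eq P setT (EFin \o f) (cst 0%E).
  apply/ae_eq_integral_abs => //.
  transitivity (\int[P]_x (f x)%:E)%E; last by rewrite -EFin_Rint// If.
  by apply: eq_integral => x _ /=; rewrite ger0_norm.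
by apply: filterS => x /= /(_ I)[].
Qed.

Lemma ae_forall_fin (I : finType) (Q : I -> U -> Prop) :
  (forall i, {ae P, forall x, Q i x}) -> {ae P, forall x, forall i, Q i x}.
Proof.
move=> aeQ.
suff : {ae P, forall x, forall i, i \in enum I -> Q i x}.
  by apply: filterS => x h i; apply: h; rewrite mem_enum.
elim: (enum I) => [|i s IH]; first exact: nearW.
apply: filterS2 (aeQ i) IH => x Qi Qs k; rewrite inE => /orP[/eqP->//|].
exact: Qs.
Qed.

End Rintegrable.

Definition law d d' (U : measurableType d) (V : measurableType d') (R : realType)
    (P : probability U R) (h : U -> V) (Q : probability V R) :=
  measurable_fun setT h /\ forall A, measurable A -> Q A = P (h @^-1` A).

Section pushforward.
Context d d' (U : measurableType d) (V : measurableType d') (R : realType).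
Variables (P : probability U R) (Q : probability V R) (h : U -> V).
Hypothesis hl : law P h Q.
Let mh : measurable_fun setT h := hl.1.
Let hPQ : forall A, measurable A -> Q A = P (h @^-1` A) := hl.2.

Lemma law_ge0_integral (f : V -> \bar R) : measurable_fun setT f ->
  (forall x, 0 <= f x)%E -> (\int[Q]_y f y = \int[P]_x f (h x))%E.
Proof.
move=> mf f0; rewrite (eq_measure_integral (pushforward P h)); last first.
  by move=> A mA _; exact: hPQ.
by rewrite ge0_integral_pushforward.
Qed.

Lemma law_rint f : Rintegrable Q f -> Rintegrable P (fun x => f (h x)).
Proof.
move=> [mf /integrableP[_ rf]]; split; first exact: measurableT_comp.
apply/integrableP; split.
  by apply/measurable_EFinP; exact: measurableT_comp.
rewrite law_ge0_integral// in rf.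
by apply/measurable_EFinP; exact: measurableT_comp.
Qed.

Lemma law_Rint f : Rintegrable Q f -> \int[Q]_y f y = \int[P]_x f (h x).
Proof.
move=> rf; rewrite /Rintegral; congr fine.
rewrite (eq_measure_integral (pushforward P h)); last first.
  by move=> A mA _; exact: hPQ.
rewrite integral_pushforward//; last by have [] := law_rint rf.
by apply/measurable_EFinP; case: rf.
Qed.

Lemma law_ae (S : V -> Prop) : {ae Q, forall y, S y} -> {ae P, forall x, S (h x)}.
Proof.
move=> [N [mN QN SN]]; exists (h @^-1` N); split.
- by rewrite -[_ @^-1` _]setTI; exact: mh.
- by rewrite -hPQ.
- by move=> x /= Sx; apply: SN.
Qed.

End pushforward.

Section fubini.
Context d d' (U : measurableType d) (V : measurableType d') (R : realType).
Variables (P : probability U R) (Q : probability V R).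

Lemma bmf_pair1 (f : U * V -> R) x : bounded_mfun f -> bounded_mfun (fun y => f (x, y)).
Proof. by apply: (@bmf_comp _ _ _ _ _ (fun y => (x, y))); exact: measurable_pair1. Qed.

Lemma bmf_pair2 (f : U * V -> R) y : bounded_mfun f -> bounded_mfun (fun x => f (x, y)).
Proof. by apply: (@bmf_comp _ _ _ _ _ (fun x => (x, y))); exact: pair2_measurable. Qed.

Lemma bmf_fubini1 (f : U * V -> R) : bounded_mfun f -> bounded_mfun (fun x => \int[Q]_y f (x, y)).
Proof.
move=> bf; have [_ rf] := bmf_rint (P \x Q)%E bf; split.
  have := measurable_fubini_F rf.
  by move=> /(measurableT_comp (fine_measurable measurableT)).
have [_ [M fM]] := bf; exists M => x.
by apply: Rint_bound => //; exact: bmf_pair1.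
Qed.

Lemma bmf_fubini2 (f : U * V -> R) : bounded_mfun f -> bounded_mfun (fun y => \int[P]_x f (x, y)).
Proof.
move=> bf; have [_ rf] := bmf_rint (P \x Q)%E bf; split.
  have := measurable_fubini_G rf.
  by move=> /(measurableT_comp (fine_measurable measurableT)).
have [_ [M fM]] := bf; exists M => x.
by apply: Rint_bound => //; exact: bmf_pair2.
Qed.

Lemma Rint_prod1 (f : U * V -> R) : bounded_mfun f ->
  \int[(P \x Q)%E]_z f z = \int[P]_x \int[Q]_y f (x, y).
Proof.
move=> bf; have [_ rf] := bmf_rint (P \x Q)%E bf.
rewrite /Rintegral -(integral12_prod_meas1 rf); congr fine.
by apply: eq_integral => x _; exact: esym (EFin_Rint (bmf_rint Q (bmf_pair1 x bf))).
Qed.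

Lemma Rint_prod2 (f : U * V -> R) : bounded_mfun f ->
  \int[(P \x Q)%E]_z f z = \int[Q]_y \int[P]_x f (x, y).
Proof.
move=> bf; have [_ rf] := bmf_rint (P \x Q)%E bf.
rewrite /Rintegral -(integral21_prod_meas1 rf); congr fine.
by apply: eq_integral => y _; exact: esym (EFin_Rint (bmf_rint P (bmf_pair2 y bf))).
Qed.

Lemma ae_prod1 (S : U * V -> Prop) : {ae (P \x Q)%E, forall z, S z} ->
  {ae P, forall x, {ae Q, forall y, S (x, y)}}.
Proof.
move=> [N [mN PN SN]].
have mF : measurable_fun setT (fun x => Q (xsection N x)).
  exact: measurable_fun_xsection.
have : ae_eq P setT (fun x => Q (xsection N x)) (cst 0%E).
  apply/ae_eq_integral_abs => //; rewrite -[RHS]PN.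
  by apply: eq_integral => x _; rewrite gee0_abs.
apply: filterS => x /= /(_ I) QN; exists (xsection N x); split => //.
  exact: measurable_xsection.
by move=> y /= Sxy; rewrite /xsection/= inE; exact: SN.
Qed.

End fubini.

(** * Product measures on tuples: resampling and swapping coordinates *)

Section upd.
Context (T : Type).

Definition upd n (j : 'I_n) (x : n.-tuple T) (a : T) : n.-tuple T :=
  [tuple if i == j then a else tnth x i | i < n].

Lemma tnth_upd n (j : 'I_n) x a i :
  tnth (upd j x a) i = if i == j then a else tnth x i.
Proof. by rewrite tnth_mktuple. Qed.

Lemma tnth_updE n (j : 'I_n) x a : tnth (upd j x a) j = a.
Proof. by rewrite tnth_upd eqxx. Qed.

Lemma upd_upd n (j : 'I_n) x a b : upd j (upd j x a) b = upd j x b.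
Proof. by apply: eq_from_tnth => i; rewrite !tnth_upd; case: eqP. Qed.

Lemma updC n (i j : 'I_n) x a b : i != j ->
  upd i (upd j x a) b = upd j (upd i x b) a.
Proof.
move=> ij; apply: eq_from_tnth => k; rewrite !tnth_upd.
by case: eqP => [->|//]; rewrite (negbTE ij).
Qed.

Lemma upd_tnth n (j : 'I_n) x : upd j x (tnth x j) = x.
Proof. by apply: eq_from_tnth => i; rewrite tnth_upd; case: eqP => [->|]. Qed.

End upd.

Section tuples.
Context (dT : measure_display) (T : measurableType dT) (R : realType).

Definition box n (A : 'I_n -> set T) : set (n.-tuple T) :=
  [set x | forall j, A j (tnth x j)].

Lemma measurable_box n (A : 'I_n -> set T) :
  (forall j, measurable (A j)) -> measurable (box A).
Proof.
move=> mA; rewrite (_ : box A = \bigcap_(j in [set: 'I_n]) ((@tnth n T ^~ j) @^-1` A j)).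
  apply: fin_bigcap_measurable => // j _; rewrite -[X in measurable X]setTI.
  exact: measurable_tnth.
by apply/seteqP; split=> [x xA j _|x xA j]; exact: xA.
Qed.

(** Boxes are stable under intersection and generate the product sigma-algebra. *)
Lemma tuple_measurable_unique n (m1 m2 : probability (n.-tuple T) R) :
  (forall A, (forall j, measurable (A j)) -> m1 (box A) = m2 (box A)) ->
  forall B, measurable B -> m1 B = m2 B.
Proof.
move=> m12 B mB.
pose G := [set box A | A in [set A : 'I_n -> set T | forall j, measurable (A j)]].
have boxT : box (fun=> setT) = setT :> set (n.-tuple T) by apply/seteqP; split.
apply: (measure_unique G (fun=> setT)) => //.
- apply/seteqP; split.
    apply: smallest_sub; first exact: smallest_sigma_algebra.
    rewrite -bigcup_seq => X [i _ [A mA <-]]; apply: sub_sigma_algebra.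
    exists (fun j => if j == i then A else setT).
      by move=> j; case: eqP.
    rewrite setTI; apply/seteqP; split => x /=.
      by move=> /(_ i); rewrite eqxx.
    by move=> Axi j; case: eqP => [->|].
  apply: smallest_sub; first exact: sigma_algebra_measurable.
  by move=> _ [A mA <-]; exact: measurable_box.
- move=> _ _ [A mA <-] [B' mB' <-]; exists (fun j => A j `&` B' j).
    by move=> j; apply: measurableI.
  apply/seteqP; split => x /=.
    by move=> AB; split => j; case: (AB j).
  by move=> [xA xB] j; split.
- by move=> _; exists (fun=> setT).
- by rewrite bigcup_const.
- by move=> _ [A mA <-]; exact: m12.
- by move=> _; rewrite [X in (X < _)%E]probability_setT ltry.
Qed.

Lemma law_tuple_prod d (U : measurableType d) (P : probability U R) n
    (h : U -> n.-tuple T) (mu : 'I_n -> probability T R) :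
  measurable_fun setT h ->
  (forall A, (forall j, measurable (A j)) ->
     P [set u | forall j, A j (tnth (h u) j)] = (\prod_(j < n) mu j (A j))%E) ->
  law P h (tuple_prod mu).
Proof.
move=> mh hA; split => // B mB.
pose hm : {mfun U >-> n.-tuple T} := HB.pack h (isMeasurableFun.Build _ _ _ _ _ mh).
rewrite -[RHS]/(distribution P hm B).
apply: tuple_measurable_unique => // A mA.
by rewrite tuple_prod_box// -hA.
Qed.

Lemma measurable_upd d (U : measurableType d) n (j : 'I_n) (f : U -> n.-tuple T) (g : U -> T) :
  measurable_fun setT f -> measurable_fun setT g ->
  measurable_fun setT (fun u => upd j (f u) (g u)).
Proof.
move=> mf mg; apply/measurable_fun_tnthP => i.
have [->|ij] := eqVneq i j.
  by rewrite (_ : _ \o _ = g)//; apply/funext => u /=; exact: tnth_updE.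
rewrite (_ : _ \o _ = fun u => tnth (f u) i).
  exact: (measurableT_comp (measurable_tnth i) mf).
by apply/funext => u /=; rewrite tnth_upd (negbTE ij).
Qed.

Section laws.
Context (n : nat) (mu : 'I_n -> probability T R).
Local Notation U := (n.-tuple T).
Local Notation PP := (tuple_prod mu).

Lemma law_tnth j : law PP (@tnth n T ^~ j) (mu j).
Proof.
split; first exact: measurable_tnth.
move=> A mA; pose B i := if i == j then A else setT.
have mB i : measurable (B i) by rewrite /B; case: eqP.
have -> : (@tnth n T ^~ j) @^-1` A = box B.
  apply/seteqP; split => x /=; rewrite /B.
    by move=> Axi k; case: eqP => [->|].
  by move=> /(_ j); rewrite eqxx.
rewrite tuple_prod_box// (bigD1 j)//= {1}/B eqxx big1 ?mule1// => i ij.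
by rewrite /B (negbTE ij) probability_setT.
Qed.

(** Resampling invariance: replacing one coordinate of a product-distributed tuple
    by an independent copy leaves its law unchanged. All Fubini-type arguments on
    tuples go through this single fact, whatever the position of the coordinate. *)
Lemma law_upd j : law (PP \x mu j)%E (fun z => upd j z.1 z.2) PP.
Proof.
apply: law_tuple_prod; first exact: measurable_upd.
move=> A mA; pose B i := if i == j then setT else A i.
have mB i : measurable (B i) by rewrite /B; case: eqP.
rewrite (_ : [set u | _] = box B `*` A j).
  rewrite [LHS]product_measure1E//; last exact: measurable_box.
  rewrite [X in (X * _)%E]tuple_prod_box// (bigD1 j)//= [RHS](bigD1 j)//=.
  rewrite {1}/B eqxx probability_setT mul1e muleC; congr (_ * _)%E.
  by apply: eq_bigr => i ij; rewrite /B (negbTE ij).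
apply/seteqP; split => -[x a]/=; rewrite /B.
  move=> xA; split => [i|]; last by have := xA j; rewrite tnth_updE.
  by have := xA i; rewrite tnth_upd; case: eqP.
move=> [xB Aa] i; rewrite tnth_upd; case: eqP => [->//|/eqP ij].
by have := xB i; rewrite /= (negbTE ij).
Qed.

Lemma law_fst d1 d2 (V : measurableType d1) (W : measurableType d2)
   (P : probability V R) (Q : probability W R) : law (P \x Q)%E fst P.
Proof.
split => // A mA; rewrite (_ : _ @^-1` _ = A `*` setT).
  by rewrite [RHS]product_measure1E// [X in (_ * X)%E]probability_setT mule1.
by apply/seteqP; split => -[x y]//= [].
Qed.

Lemma law_snd d1 d2 (V : measurableType d1) (W : measurableType d2)
   (P : probability V R) (Q : probability W R) : law (P \x Q)%E snd Q.
Proof.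
split => // A mA; rewrite (_ : _ @^-1` _ = setT `*` A).
  by rewrite [RHS]product_measure1E// [X in (X * _)%E]probability_setT mul1e.
by apply/seteqP; split => -[x y]//= [].
Qed.

Lemma bmf_upd j (F : U -> R) x : bounded_mfun F -> bounded_mfun (fun a => F (upd j x a)).
Proof. by apply: (@bmf_comp _ _ _ _ _ (fun a => upd j x a)); exact: measurable_upd. Qed.

Lemma bmf_upd2 j (F : U -> R) a : bounded_mfun F -> bounded_mfun (fun x => F (upd j x a)).
Proof. by apply: (@bmf_comp _ _ _ _ _ (fun x => upd j x a)); exact: measurable_upd. Qed.

Lemma bmf_updz j (F : U -> R) : bounded_mfun F -> bounded_mfun (fun z : U * T => F (upd j z.1 z.2)).
Proof. by apply: (@bmf_comp _ _ _ _ _ (fun z : U * T => upd j z.1 z.2)); exact: measurable_upd. Qed.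

Lemma bmf_tnth j (f : T -> R) : bounded_mfun f -> bounded_mfun (fun x : U => f (tnth x j)).
Proof. by apply: (@bmf_comp _ _ _ _ _ (fun x : U => tnth x j)); exact: measurable_tnth. Qed.

Definition resample j (F : U -> R) (x : U) := \int[mu j]_a F (upd j x a).
(** The conditional expectation of [F] given that the [j]-th coordinate is [a]. For a
    density it is the density of the [j]-th marginal. *)
Definition cond_exp j (F : U -> R) (a : T) := \int[PP]_x F (upd j x a).

Lemma bmf_resample j F : bounded_mfun F -> bounded_mfun (resample j F).
Proof. by move=> bF; exact: (bmf_fubini1 PP (mu j) (bmf_updz j bF)). Qed.

Lemma bmf_cond j F : bounded_mfun F -> bounded_mfun (cond_exp j F).
Proof. by move=> bF; exact: (bmf_fubini2 PP (mu j) (bmf_updz j bF)). Qed.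

Lemma Rint_resample j F : bounded_mfun F -> \int[PP]_x F x = \int[PP]_x resample j F x.
Proof.
move=> bF; rewrite (law_Rint (law_upd j) (bmf_rint _ bF)).
by rewrite (Rint_prod1 _ _ (bmf_updz j bF)).
Qed.

Lemma Rint_cond j F : bounded_mfun F -> \int[PP]_x F x = \int[mu j]_a cond_exp j F a.
Proof.
move=> bF; rewrite (law_Rint (law_upd j) (bmf_rint _ bF)).
by rewrite (Rint_prod2 _ _ (bmf_updz j bF)).
Qed.

Lemma Rint_tnth j f : Rintegrable (mu j) f -> \int[PP]_x f (tnth x j) = \int[mu j]_a f a.
Proof. by move=> rf; rewrite (law_Rint (law_tnth j) rf). Qed.

Lemma cond_tnth j F f : bounded_mfun F -> bounded_mfun f ->
  \int[PP]_x (F x * f (tnth x j)) = \int[mu j]_a (cond_exp j F a * f a).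
Proof.
move=> bF bf; rewrite (@Rint_cond j); last exact: bmfM (bmf_tnth _ bf).
apply: eq_Rintegral => a _; rewrite /cond_exp.
rewrite mulrC -RintZ; last exact/bmf_rint/bmf_upd2.
by apply: eq_Rintegral => x _; rewrite tnth_updE mulrC.
Qed.

End laws.

Lemma Rint_indic d (V : measurableType d) (P : probability V R) A : measurable A ->
  P A = (\int[P]_x \1_A x)%:E.
Proof.
move=> mA; rewrite EFin_Rint; last exact/bmf_rint/bmf_indic.
by rewrite integral_indic// setIT.
Qed.

Section swap.
Context (n : nat) (mu : 'I_n -> probability T R).
Local Notation U := (n.-tuple T).
Local Notation PP := (tuple_prod mu).

(** Two points exchange their [j]-th coordinates; this changes neither the empirical
    distribution of any coordinate of the pair nor, by [law_swap_coord], the law of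
    an independent pair. *)
Definition swap_coord j (z : U * U) : U * U :=
  (upd j z.1 (tnth z.2 j), upd j z.2 (tnth z.1 j)).

Lemma swap_coordK j : involutive (swap_coord j).
Proof.
move=> [x y]; congr pair; rewrite /= upd_upd tnth_updE; exact: upd_tnth.
Qed.

Lemma measurable_fun_upd_tnth j d (V : measurableType d) (f g : V -> U) :
  measurable_fun setT f -> measurable_fun setT g ->
  measurable_fun setT (fun v => upd j (f v) (tnth (g v) j)).
Proof.
move=> mf mg; apply: measurable_upd => //.
exact: (measurableT_comp (measurable_tnth j) mg).
Qed.

Lemma measurable_swap_coord j : measurable_fun setT (swap_coord j).
Proof.
by apply/measurable_fun_pairP; split; exact: measurable_fun_upd_tnth.
Qed.

Lemma resample_upd j F x a : resample mu j F (upd j x a) = resample mu j F x.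
Proof. by apply: eq_Rintegral => b _; rewrite upd_upd. Qed.

Lemma cond_resample j F a : bounded_mfun F ->
  cond_exp mu j (resample mu j F) a = \int[PP]_x F x.
Proof.
move=> bF; rewrite (Rint_resample mu j bF).
by apply: eq_Rintegral => x _; rewrite resample_upd.
Qed.

Lemma Rint_swap_pair j (a b : U -> R) x : bounded_mfun a -> bounded_mfun b ->
  \int[PP]_y (a (upd j x (tnth y j)) * b (upd j y (tnth x j))) =
  resample mu j a x * cond_exp mu j b (tnth x j).
Proof.
move=> ba bb.
transitivity (\int[PP]_y (b (upd j y (tnth x j)) * a (upd j x (tnth y j)))).
  by apply: eq_Rintegral => y _; rewrite mulrC.
rewrite (@cond_tnth _ mu j (fun y => b (upd j y (tnth x j))) (fun t => a (upd j x t))).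
- rewrite mulrC -RintZ; last exact/bmf_rint/bmf_upd.
  apply: eq_Rintegral => t _; congr (_ * _).
  by apply: eq_Rintegral => y _; rewrite upd_upd.
- exact: bmf_upd2.
- exact: bmf_upd.
Qed.

(** On a rectangle, the integral over the second point splits by [Rint_swap_pair]
    into a function of the untouched coordinates and a function of the [j]-th one,
    which are independent. *)
Lemma law_swap_coord j : law (PP \x PP)%E (swap_coord j) (PP \x PP)%E.
Proof.
have msw := measurable_swap_coord j; split=> // X mX.
pose sw : {mfun (U * U)%type >-> (U * U)%type} := HB.pack (swap_coord j) (isMeasurableFun.Build _ _ _ _ _ msw).
rewrite -[RHS]/(distribution (PP \x PP)%E sw X).
apply: product_measure_unique => // A B mA mB /=.
rewrite /distribution/pushforward/=.
pose a : U -> R := \1_A; pose b : U -> R := \1_B.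
have ba : bounded_mfun a by exact: bmf_indic.
have bb : bounded_mfun b by exact: bmf_indic.
pose H (z : U * U) := a (upd j z.1 (tnth z.2 j)) * b (upd j z.2 (tnth z.1 j)).
have bH : bounded_mfun H.
  by apply: bmfM; [apply: bmf_comp ba|apply: bmf_comp bb]; exact: measurable_fun_upd_tnth.
have mSAB : measurable (swap_coord j @^-1` (A `*` B)).
  by rewrite -[_ @^-1` _]setTI; apply: (measurable_swap_coord j) => //; exact: measurableX.
rewrite -[LHS]/((PP \x PP)%E (swap_coord j @^-1` (A `*` B))).
transitivity ((\int[PP]_x a x) * (\int[PP]_x b x))%:E; last first.
  by rewrite EFinM; congr (_ * _)%E; apply/esym; exact: Rint_indic.
rewrite [LHS]Rint_indic//; apply: (congr1 EFin).
transitivity (\int[(PP \x PP)%E]_z H z).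
  apply: eq_Rintegral => z _; rewrite /H /a /b !indicE -natrM mulnb; congr (_%:R).
  congr nat_of_bool; apply/idP/andP; rewrite !inE//.
rewrite Rint_prod1//.
transitivity (\int[PP]_x (resample mu j a x * cond_exp mu j b (tnth x j))).
  by apply: eq_Rintegral => x _; exact: Rint_swap_pair.
rewrite cond_tnth; [|exact: bmf_resample|exact: bmf_cond].
under eq_Rintegral do rewrite cond_resample//.
rewrite RintZ; last exact/bmf_rint/bmf_cond.
by rewrite -(Rint_cond mu j bb).
Qed.

End swap.
End tuples.

(** * The entropic problem in terms of densities *)

Section density.
Context d (U : measurableType d) (R : realType) (P : probability U R).

Definition xlnx (u : R) := u * ln u.

Lemma measurable_xlnx (q : U -> R) : measurable_fun setT q ->
  measurable_fun setT (fun x => xlnx (q x)).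
Proof.
move=> mq; apply: measurable_funM => //.
exact: measurableT_comp (@measurable_ln R) mq.
Qed.

(** The entropy integrand is bounded below, so a finite entropy forces
    integrability. *)
Lemma xlnx_ge (u : R) : 0 <= u -> u - 1 <= xlnx u.
Proof.
rewrite le_eqVlt => /predU1P[<-|u0]; first by rewrite /xlnx mul0r subr_le0 ler01.
rewrite /xlnx -[ln u]opprK -lnV ?posrE//.
have : ln u^-1 <= u^-1 - 1.
  rewrite -[X in ln X](subrK 1) addrC le_ln1Dx//.
  by rewrite ltrBrDr addNr invr_gt0.
move=> /(ler_wpM2l (ltW u0)); rewrite mulrBr mulr1 mulfV ?gt_eqF//.
by rewrite mulrN; lra.
Qed.

Definition has_density (Q : probability U R) (q : U -> R) :=
  [/\ Rintegrable P q, forall x, 0 <= q x &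
      forall A, measurable A -> Q A = (\int[P]_(x in A) (q x)%:E)%E].

Section exists_density.
Variable q : U -> R.
Hypotheses (rq : Rintegrable P q) (q0 : forall x, 0 <= q x) (q1 : \int[P]_x q x = 1).

Definition density_measure (A : set U) := (\int[P]_(x in A) (q x)%:E)%E.

Let dens0 : density_measure set0 = 0%E.
Proof. exact: integral_set0. Qed.

Let dens_ge0 A : (0 <= density_measure A)%E.
Proof. by apply: integral_ge0 => x _; rewrite lee_fin. Qed.

Let dens_sigma_additive : semi_sigma_additive density_measure.
Proof.
apply: semi_sigma_additive_nng_induced; last by move=> x; rewrite lee_fin.
by apply/measurable_EFinP; case: rq.
Qed.

HB.instance Definition _ := isMeasure.Build _ _ _ density_measure
  dens0 dens_ge0 dens_sigma_additive.

Let densT : density_measure setT = 1%E.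
Proof. by rewrite /density_measure -EFin_Rint// q1. Qed.

HB.instance Definition _ :=
  Measure_isProbability.Build _ _ _ density_measure densT.

Lemma exists_density : exists Q, has_density Q q.
Proof. by exists density_measure; split. Qed.

End exists_density.

Section change.
Variables (Q : probability U R) (q : U -> R).
Hypothesis hq : has_density Q q.

Lemma density_dominates : Q `<< P.
Proof.
apply/null_content_dominatesP => A mA PA0; have [[mq _] q0 qA] := hq.
rewrite [LHS]qA//; apply: null_set_integral => //.
  by apply/measurable_EFinP; exact: measurable_funTS.
Qed.

Lemma density_ae (S : U -> Prop) : {ae P, forall x, S x} -> {ae Q, forall x, S x}.
Proof.
move=> [N [mN PN SN]]; exists N; split => //.
by have /null_content_dominatesP := density_dominates; apply.
Qed.

Lemma density_ge0_integral f : measurable_fun setT f -> (forall x, 0 <= f x)%E ->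
  (\int[Q]_x f x = \int[P]_x (f x * (q x)%:E))%E.
Proof.
move=> mf f0; have [[mq rq] q0 qA] := hq.
rewrite -(Radon_Nikodym_SigmaFinite.change_of_variables density_dominates f0)//.
pose rn := Radon_Nikodym_SigmaFinite.f Q P.
have irn : P.-integrable setT rn.
  exact: (Radon_Nikodym_SigmaFinite.f_integrable density_dominates).
have mrn : measurable_fun setT rn by exact: (measurable_int _ irn).
apply: ge0_ae_eq_integral => //.
- exact: emeasurable_funM.
- by apply: emeasurable_funM => //; exact/measurable_EFinP.
- by move=> x _; rewrite mule_ge0// Radon_Nikodym_SigmaFinite.f_ge0//; exact: density_dominates.
- by move=> x _; rewrite mule_ge0// lee_fin.
apply: ae_eqe_mul2l; apply: integral_ae_eq => //; first exact/measurable_EFinP.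
move=> E _ mE; rewrite -qA// -Radon_Nikodym_SigmaFinite.f_integral//.
exact: density_dominates.
Qed.

Lemma density_rint (f : U -> R) : measurable_fun setT f -> Rintegrable P (fun x => f x * q x) -> Rintegrable Q f.
Proof.
move=> mf [_ /integrableP[_ rfq]]; split => //; apply/integrableP; split.
  exact/measurable_EFinP.
rewrite density_ge0_integral//; last by apply: measurableT_comp => //; exact/measurable_EFinP.
move: rfq; congr (_ < _)%E; apply: eq_integral => x _ /=.
by have [_ q0 _] := hq; rewrite normrM (ger0_norm (q0 x)).
Qed.

Lemma density_RN :
  ae_eq P setT (Radon_Nikodym (charge_of_finite_measure Q) P) (EFin \o q).
Proof.
have [[mq rq] q0 qA] := hq.
have dom : charge_of_finite_measure Q `<< P by exact: density_dominates.
apply: integral_ae_eq => //.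
- exact: Radon_Nikodym_integrable.
- exact/measurable_EFinP.
- by move=> E _ mE; rewrite -qA// -Radon_Nikodym_integral.
Qed.

Lemma density_Rint (f : U -> R) : measurable_fun setT f -> Rintegrable P (fun x => f x * q x) ->
  \int[Q]_x f x = \int[P]_x (f x * q x).
Proof.
move=> mf rfq; have rQ := density_rint mf rfq; have [[mq rq] q0 qA] := hq.
congr fine; rewrite -(Radon_Nikodym_change_of_variables density_dominates measurableT rQ.2).
have mrn : measurable_fun setT (Radon_Nikodym (charge_of_finite_measure Q) P).
  by apply: (measurable_int P); apply: Radon_Nikodym_integrable; exact: density_dominates.
apply: ae_eq_integral => //.
- by apply: emeasurable_funM => //; exact/measurable_EFinP.
- by apply/measurable_EFinP; exact: measurable_funM.
apply: filterS density_RN => x /= /(_ I) -> _.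
by rewrite -EFinM.
Qed.

Lemma density_pos : {ae Q, forall x, 0 < q x}.
Proof.
have [[mq rq] q0 qA] := hq.
have mN : measurable [set x | q x <= 0].
  rewrite -[X in measurable X]setTI.
  by apply: measurable_fun_le => //; exact: measurable_cst.
exists [set x | q x <= 0]; split => //.
  rewrite qA// (@eq_integral _ _ _ _ _ (cst 0%E)).
    by rewrite integral0.
  move=> x; rewrite inE/= => qx; congr EFin; apply/eqP; rewrite eq_le qx; exact: q0.
by move=> x /=; rewrite leNgt => /negP.
Qed.

Lemma density_KLE : (KL Q P = \int[Q]_x (ln (q x))%:E)%E.
Proof.
have [[mq rq] q0 qA] := hq.
rewrite /KL asboolT; last exact: density_dominates.
apply: ae_eq_integral => //.
- pose rn := Radon_Nikodym (charge_of_finite_measure Q) P.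
  have dom : charge_of_finite_measure Q `<< P by exact: density_dominates.
  have mrn : measurable_fun setT (fun x => fine (rn x)).
    by apply: measurableT_comp => //; apply: (measurable_int P); exact: Radon_Nikodym_integrable.
  rewrite -/rn (_ : (fun x => lne (rn x)) =
      fun x => if fine (rn x) <= 0 then -oo%E else (ln (fine (rn x)))%:E).
    apply: measurable_fun_ifT.
    + by apply: measurable_fun_ler => //; exact: measurable_cst.
    + exact: measurable_cst.
    + apply/measurable_EFinP; exact: measurableT_comp (@measurable_ln R) mrn.
  by apply/funext => x; have : rn x \is a fin_num := Radon_Nikodym_fin_num x dom; case: (rn x).
- apply/measurable_EFinP; exact: measurableT_comp (@measurable_ln R) mq.
apply: filterS2 density_pos (density_ae density_RN) => x qx /(_ I) -> _ /=.
by rewrite leNgt qx.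
Qed.

Lemma density_KL : Rintegrable P (fun x => xlnx (q x)) ->
  (KL Q P = (\int[P]_x xlnx (q x))%:E)%E.
Proof.
have [[mq rq] q0 qA] := hq; move=> rx.
have ml : measurable_fun setT (fun x => ln (q x)).
  exact: measurableT_comp (@measurable_ln R) mq.
have E : (fun x => xlnx (q x)) = (fun x => ln (q x) * q x).
  by apply/funext => x; rewrite /xlnx mulrC.
rewrite density_KLE E -density_Rint//; last by rewrite -E.
by rewrite EFin_Rint//; apply: density_rint => //; rewrite -E.
Qed.

(** The negative part of [ln q] integrates to at most 1 under [Q] because u ln u is
    at least - 1; so finiteness of the integral controls the positive part. *)
Lemma density_KL_fin : (KL Q P < +oo)%E -> Rintegrable P (fun x => xlnx (q x)).
Proof.
have [[mq rq] q0 qA] := hq.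
have ml : measurable_fun setT (fun x => ln (q x)).
  exact: measurableT_comp (@measurable_ln R) mq.
have mel : measurable_fun setT (fun x => (ln (q x))%:E) by exact/measurable_EFinP.
rewrite density_KLE => Kfin; split; first exact: measurable_xlnx.
pose lq x := (ln (q x))%:E.
have negfin : (\int[Q]_x lq^\- x <= 1)%E.
  rewrite density_ge0_integral//; last exact: measurable_funeneg.
  apply: (@le_trans _ _ (\int[P]_x (cst 1%E x))%E); last first.
    by rewrite integral_cst// mul1e probability_le1.
  apply: ge0_le_integral => //.
  - by move=> x _; rewrite mule_ge0// lee_fin.
  - by apply: emeasurable_funM; [exact: measurable_funeneg|exact/measurable_EFinP].
  - move=> x _; rewrite funenegE (_ : (- lq x)%E = (- ln (q x))%:E)// -(EFin_max (- ln (q x)) 0) -EFinM lee_fin.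
    have := xlnx_ge (q0 x); rewrite /xlnx => h; have := q0 x => qx0.
    rewrite maxr_pMl// mul0r ge_max ler01 andbT mulNr mulrC; lra.
have posfin : (\int[Q]_x lq^\+ x < +oo)%E.
  move: Kfin; rewrite integralE -/lq.
  have : (0 <= \int[Q]_x lq^\+ x)%E by apply: integral_ge0.
  have : (0 <= \int[Q]_x lq^\- x)%E by apply: integral_ge0.
  move: negfin; case: (\int[Q]_x lq^\- x)%E => // r _ _.
  by case: (\int[Q]_x lq^\+ x)%E => [s||]; rewrite ?ltry.
have : Q.-integrable setT lq.
  apply/integrableP; split => //; rewrite (eq_integral (lq^\+ \+ lq^\-)%E); last first.
    by move=> x _; rewrite -/((abse \o lq) x) fune_abse.
  rewrite ge0_integralD//; [|exact: measurable_funepos|exact: measurable_funeneg].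
  by rewrite lte_add_pinfty// (le_lt_trans negfin)// ltry.
move=> /integrableP[_]; rewrite density_ge0_integral//; last exact: measurableT_comp.
move=> h; apply/integrableP; split.
  by apply/measurable_EFinP; exact: measurable_xlnx.
move: h; congr (_ < _)%E; apply: eq_integral => x _ /=.
by rewrite -EFinM /xlnx normrM (ger0_norm (q0 x)) mulrC.
Qed.

End change.

Lemma dominates_density (Q : probability U R) : Q `<< P -> exists q, has_density Q q.
Proof.
move=> QP; pose f := Radon_Nikodym_SigmaFinite.f Q P.
have f0 x : (0 <= f x)%E by exact: Radon_Nikodym_SigmaFinite.f_ge0.
have ff x : f x \is a fin_num by exact: Radon_Nikodym_SigmaFinite.f_fin_num.
have fi : P.-integrable setT f by exact: Radon_Nikodym_SigmaFinite.f_integrable.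
have fE : f = EFin \o (fine \o f) by apply/funext => x /=; rewrite fineK.
exists (fine \o f); split.
- split; last by rewrite -fE.
  by apply/measurable_EFinP; rewrite -fE; exact: (measurable_int P).
- by move=> x; rewrite fine_ge0.
- move=> A mA; rewrite (Radon_Nikodym_SigmaFinite.f_integral QP mA).
  by apply: eq_integral => x _; rewrite -[LHS]fineK//.
Qed.

End density.

Section interface.
Context (dT : measure_display) (T : measurableType dT) (R : realType).
Context (m : nat) (mu : 'I_m -> probability T R).
Local Notation U := (m.-tuple T).
Local Notation PP := (tuple_prod mu).

Definition unit_marginals (q : U -> R) := forall j A, measurable A ->
  \int[PP]_x (q x * \1_A (tnth x j)) = \int[mu j]_a \1_A a.

(** Densities of the couplings of finite entropy: by [density_couplings] and
    [density_KL] the entropic problem may be posed over them. *)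
Definition coupling_density (q : U -> R) :=
  [/\ Rintegrable PP q, forall x, 0 <= q x, unit_marginals q & Rintegrable PP (fun x => xlnx (q x))].

Lemma density_couplings (Q : probability U R) q : has_density PP Q q ->
  couplings mu Q <-> unit_marginals q.
Proof.
move=> hq; have [rq q0 qA] := hq.
have E j (A : set T) : measurable A ->
    pushforward Q (fun x => tnth x j) A = (\int[PP]_x (q x * \1_A (tnth x j)))%:E.
  move=> mA; have mA' : measurable [set x : U | A (tnth x j)].
    by rewrite -[X in measurable X]setTI; exact: (measurable_tnth j).
  rewrite /pushforward -[LHS]/(Q [set x : U | A (tnth x j)]) Rint_indic//.
  apply: (congr1 EFin).
  have mi : measurable_fun setT (\1_[set x : U | A (tnth x j)] : U -> R) by exact: measurable_indic.
  have iE : (fun x : U => \1_[set x : U | A (tnth x j)] x * q x) = (fun x => q x * \1_A (tnth x j)) :> (U -> R).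
    by apply/funext => x; rewrite mulrC.
  rewrite (density_Rint hq mi) iE//; apply: rintM => //.
  exact: (bmf_tnth j (bmf_indic _ mA)).
split=> [cQ j A mA|uq j A mA].
  by have := cQ j A mA; rewrite E// => h; apply/EFin_inj; rewrite h Rint_indic.
by rewrite E// uq// -Rint_indic.
Qed.

Definition energy (eps : R) (k q : U -> R) :=
  \int[PP]_x (q x * k x) + eps * \int[PP]_x xlnx (q x).

Definition energy_minimizer (eps : R) (k p : U -> R) := coupling_density p /\
  forall q, coupling_density q -> energy eps k p <= energy eps k q.

Variables (eps : R) (D : set U) (c : U -> R) (M : R).
Hypotheses (eps0 : 0 < eps) (mD : measurable D) (mc : measurable_fun D c).
Hypothesis cM : forall x, D x -> `|c x| <= M.

Local Notation ct := (c \_ D).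

Lemma bmf_ct : bounded_mfun ct.
Proof. by apply: bmf_patch => //; exists M. Qed.

Lemma cost_ct (Q : probability U R) : (\int[Q]_(x in D) (c x)%:E = (\int[Q]_x ct x)%:E)%E.
Proof.
rewrite integral_mkcond restrict_EFin EFin_Rint//.
exact/bmf_rint/bmf_ct.
Qed.

Lemma transport_cost_density (Q : probability U R) q : has_density PP Q q ->
  Rintegrable PP (fun x => xlnx (q x)) ->
  transport_cost eps D c mu Q = (energy eps ct q)%:E.
Proof.
move=> hq rx; have [rq q0 _] := hq.
rewrite /transport_cost cost_ct (density_KL hq rx) -EFinM -EFinD; congr (_ + _)%:E.
have E : (fun x => ct x * q x) = (fun x => q x * ct x) by apply/funext => x; rewrite mulrC.
by rewrite (density_Rint hq) ?E//; [case: bmf_ct|apply: rintM => //; exact: bmf_ct].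
Qed.

Hypothesis m0 : (0 < m)%N.

Lemma coupling_density_mass q : unit_marginals q -> \int[PP]_x q x = 1.
Proof.
move=> uq; have := uq (Ordinal m0) _ measurableT.
rewrite indicT Rint_cst => <-; apply: eq_Rintegral => x _.
by rewrite mulr1.
Qed.

Lemma coupling_density1 : coupling_density (fun=> 1).
Proof.
have x1 : xlnx (1 : R) = 0 by rewrite /xlnx ln1 mulr0.
split.
- exact/bmf_rint/bmf_cst.
- by move=> _; exact: ler01.
- move=> j A mA; rewrite -(@Rint_tnth _ _ _ _ mu j); last exact/bmf_rint/bmf_indic.
  by apply: eq_Rintegral => x _; rewrite mul1r.
- by rewrite x1; exact/bmf_rint/bmf_cst.
Qed.

(** The product measure itself has finite cost, so an optimal coupling has finite
    entropy, hence a density, and this density minimizes [energy]. *)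
Lemma schrodinger_density pi : schrodinger_coupling eps D c mu pi ->
  exists2 p, has_density PP pi p & energy_minimizer eps ct p.
Proof.
move=> [cpi piS].
have leS q : coupling_density q -> (transport_cost eps D c mu pi <= (energy eps ct q)%:E)%E.
  move=> [rq q0 uq xq]; have [Q hQ] := exists_density rq q0 (coupling_density_mass uq).
  rewrite piS -(transport_cost_density hQ xq); apply: ereal_inf_lbound.
  by exists Q => //; apply/(density_couplings hQ).
have KLfin : (KL pi PP < +oo)%E.
  have := leS _ coupling_density1; rewrite /transport_cost cost_ct.
  case: (KL pi PP) => //=; first by move=> r; rewrite ltry.
  by rewrite gt0_muley ?lte_fin// addey//.
have pidom : pi `<< PP.
  by move: KLfin; rewrite /KL; case: asboolP.
have [p hp] := dominates_density pidom; have [rp p0 pA] := hp.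
have xp := density_KL_fin hp KLfin.
exists p => //; split; first by split=> //; exact/(density_couplings hp).
by move=> q /leS; rewrite (transport_cost_density hp xp) lee_fin.
Qed.

End interface.

(** * First-order optimality of the minimizing density *)

Section xlnx_calculus.
Context (R : realType).
Implicit Types u z h s : R.

Lemma xlnx0 : xlnx (0 : R) = 0. Proof. by rewrite /xlnx mul0r. Qed.

Lemma ln_le_sub1 u : 0 < u -> ln u <= u - 1.
Proof.
move=> u0; rewrite -[X in ln X](subrK 1) addrC le_ln1Dx//.
by rewrite ltrBrDr addNr.
Qed.

Lemma xlnx_tangent u z : 0 <= u -> 0 < z ->
  xlnx z + (ln z + 1) * (u - z) <= xlnx u.
Proof.
rewrite le_eqVlt => /predU1P[<-|u0] z0.
  by rewrite xlnx0 /xlnx; lra.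
have : ln (z / u) <= z / u - 1 by rewrite ln_le_sub1// divr_gt0.
rewrite ln_div ?posrE// => /(ler_wpM2l (ltW u0)).
rewrite mulrBr [u * (z / u - 1)]mulrBr mulrCA mulfV ?gt_eqF// /xlnx; nra.
Qed.

Lemma xlnx_quad u h : 0 < u -> 0 <= u + h ->
  xlnx (u + h) <= xlnx u + h * ln u + h + h ^+ 2 / u.
Proof.
move=> u0; have uN0 : u != 0 by rewrite gt_eqF.
rewrite le_eqVlt => /predU1P[E|uh0].
  have -> : h = - u by lra.
  by rewrite subrr xlnx0 /xlnx sqrrN expr2 mulfK//; lra.
have : ln ((u + h) / u) <= (u + h) / u - 1 by rewrite ln_le_sub1// divr_gt0.
rewrite ln_div ?posrE// => /(ler_wpM2l (ltW uh0)).
have -> : (u + h) * ((u + h) / u - 1) = h + h ^+ 2 / u by field.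
rewrite /xlnx; lra.
Qed.

(** Mixing with the constant density 1: to first order in [s] the entropy decreases
    by [s * |ln s|] on the set where the density vanishes, which beats any linear
    cost. *)
Lemma xlnx_mix u s : 0 <= u -> 0 < s < 1 ->
  xlnx ((1 - s) * u + s) <= xlnx u + s * ((1 - u) + (u == 0)%:R * ln s).
Proof.
move=> u0 /andP[s0 s1].
pose z := (1 - s) * u + s.
have z0 : 0 < z by rewrite /z; nra.
have := xlnx_tangent u0 z0; rewrite -/z.
have -> : u - z = - (s * (1 - u)) by rewrite /z; ring.
suff : (1 - u) * ln z <= (u == 0)%:R * ln s.
  by move=> /(ler_wpM2l (ltW s0)); lra.
have [u00|uN0] := eqVneq u 0; first by rewrite /z u00 mulr0 add0r subr0 !mul1r.
rewrite mul0r; have [u1|u1] := leP u 1.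
  by apply: mulr_ge0_le0; [rewrite subr_ge0|apply: ln_le0; rewrite /z; nra].
by apply: mulr_le0_ge0; [rewrite subr_le0 ltW|apply: ln_ge0; rewrite /z; nra].
Qed.

End xlnx_calculus.

Section optimality.
Context (dT : measure_display) (T : measurableType dT) (R : realType).
Context (m : nat) (mu : 'I_m -> probability T R).
Local Notation U := (m.-tuple T).
Local Notation PP := (tuple_prod mu).
Variables (eps M : R) (k p : U -> R).
Hypotheses (m0 : (0 < m)%N) (eps0 : 0 < eps) (bk : bounded_mfun k) (kM : forall x, `|k x| <= M).
Hypothesis pmin : energy_minimizer mu eps k p.

Let rp : Rintegrable PP p. Proof. by case: pmin => -[]. Qed.
Let mp : measurable_fun setT p. Proof. by case: rp. Qed.
Let p0 x : 0 <= p x. Proof. by case: pmin => -[]. Qed.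
Let up : unit_marginals mu p. Proof. by case: pmin => -[]. Qed.
Let xp : Rintegrable PP (fun x => xlnx (p x)). Proof. by case: pmin => -[]. Qed.
Let p1 : \int[PP]_x p x = 1. Proof. exact: coupling_density_mass up. Qed.

Lemma mul_tnth_rint (q : U -> R) j (A : set T) : Rintegrable PP q -> measurable A ->
  Rintegrable PP (fun x => q x * \1_A (tnth x j)).
Proof. by move=> rq mA; apply: rintM => //; exact: (bmf_tnth j (bmf_indic _ mA)). Qed.

Lemma unit_marginalsD (q v : U -> R) : unit_marginals mu q -> Rintegrable PP q -> Rintegrable PP v ->
  (forall j A, measurable A -> \int[PP]_x (v x * \1_A (tnth x j)) = 0) ->
  unit_marginals mu (fun x => q x + v x).
Proof.
move=> uq rq rv v0 j A mA; rewrite -uq// -[RHS]addr0 -(v0 j A mA).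
rewrite -RintD; [|exact: mul_tnth_rint..].
by apply: eq_Rintegral => x _; rewrite mulrDl.
Qed.

(** If the minimizing density vanished on a set of positive mass [al], then mixing
    it with the constant density 1 at rate [s] would gain [al * s * |ln s|] in entropy
    for a cost of order [s]. *)
Lemma minimizer_pos : {ae PP, forall x, 0 < p x}.
Proof.
have mZ : measurable [set x | p x <= 0].
  rewrite -[X in measurable X]setTI.
  by apply: measurable_fun_le => //; exact: measurable_cst.
pose Z : set U := [set x | p x <= 0].
pose al := \int[PP]_x \1_Z x.
have key s : 0 < s < 1 -> 0 <= M + M + eps * (al * ln s).
  move=> /[dup] s01 /andP[s0 s1].
  pose v x := s * (1 - p x).
  have rv : Rintegrable PP v by apply/rintZ/rintB => //; exact/bmf_rint/bmf_cst.
  pose q x := p x + v x.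
  have qE x : q x = (1 - s) * p x + s by rewrite /q /v; ring.
  have rq : Rintegrable PP q by exact: rintD.
  have q0 x : 0 <= q x by rewrite qE; have := p0 x; nra.
  have bZ : bounded_mfun (\1_Z : U -> R) by exact: bmf_indic.
  pose ub x := xlnx (p x) + s * ((1 - p x) + \1_Z x * ln s).
  have rub : Rintegrable PP ub.
    apply: rintD => //; apply/rintZ/rintD; first by apply: rintB => //; exact/bmf_rint/bmf_cst.
    by apply/bmf_rint/bmfM => //; exact: bmf_cst.
  have qub x : xlnx (q x) <= ub x.
    have -> : ub x = xlnx (p x) + s * ((1 - p x) + (p x == 0)%:R * ln s).
      rewrite /ub indicE (_ : (x \in Z) = (p x == 0))//.
      apply/idP/eqP; rewrite inE /Z/=; last by move=> ->.
      by move=> px; apply/eqP; rewrite eq_le px p0.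
    by rewrite qE; exact: xlnx_mix.
  have xq : Rintegrable PP (fun x => xlnx (q x)).
    apply: (@rint_le _ _ _ _ _ (fun x => 1 + `|ub x|)).
    - by apply: measurable_xlnx; case: rq.
    - by apply: rintD; [exact/bmf_rint/bmf_cst|exact: rint_norm].
    - move=> x; have := xlnx_ge (q0 x); have := q0 x; have := qub x; have := ler_norm (ub x).
      by move=> h1 h2 h3 h4; rewrite ler_norml; apply/andP; split; have := normr_ge0 (ub x); lra.
  have uq : unit_marginals mu q.
    apply: unit_marginalsD => // j A mA; rewrite /v.
    transitivity (\int[PP]_x (s * (1 * \1_A (tnth x j) - p x * \1_A (tnth x j)))).
      by apply: eq_Rintegral => x _; ring.
    have rA : Rintegrable PP (fun x => 1 * \1_A (tnth x j)).
      by apply: mul_tnth_rint => //; exact/bmf_rint/bmf_cst.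
    have rA' := mul_tnth_rint j rp mA.
    rewrite RintZ; last exact: rintB.
    rewrite RintB// (up j mA) -(@Rint_tnth _ _ _ _ mu j); last exact/bmf_rint/bmf_indic.
    by under eq_Rintegral do rewrite mul1r; rewrite subrr mulr0.
  have := pmin.2 q (And4 rq q0 uq xq); rewrite /energy.
  have rk : Rintegrable PP k by exact: bmf_rint.
  have rpk : Rintegrable PP (fun x => p x * k x) by exact: rintM.
  have Iq : \int[PP]_x (q x * k x) = \int[PP]_x (p x * k x) + s * (\int[PP]_x k x - \int[PP]_x (p x * k x)).
    rewrite -RintB// -RintZ; last exact: rintB.
    rewrite -RintD//; last by apply/rintZ/rintB.
    by apply: eq_Rintegral => x _; rewrite /q /v; ring.
  have Iub : \int[PP]_x ub x = \int[PP]_x xlnx (p x) + s * (al * ln s).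
    rewrite RintD//; last first.
      apply/rintZ/rintD; first by apply: rintB => //; exact/bmf_rint/bmf_cst.
      by apply/bmf_rint/bmfM => //; exact: bmf_cst.
    have r1p : Rintegrable PP (fun x => 1 - p x) by apply: rintB => //; exact/bmf_rint/bmf_cst.
    have rZ : Rintegrable PP (fun x => \1_Z x * ln s) by apply/bmf_rint/bmfM => //; exact: bmf_cst.
    congr (_ + _); rewrite RintZ; last exact: rintD.
    rewrite RintD// RintB//; last exact/bmf_rint/bmf_cst.
    rewrite Rint_cst p1 subrr add0r; congr (_ * _).
    by rewrite mulrC -RintZ; [apply: eq_Rintegral => x _; rewrite mulrC|exact: bmf_rint].
  have := le_Rint xq rub qub; rewrite Iub Iq => h1 h2.
  have h3 : `|\int[PP]_x k x| <= M by exact: Rint_bound.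
  have h4 : `|\int[PP]_x (p x * k x)| <= M.
    rewrite (le_trans (Rint_norm_le rpk))// -[leRHS]mul1r -p1 mulrC -RintZ//.
    apply: le_Rint; [exact: rint_norm|exact: rintZ|].
    by move=> x; rewrite normrM (ger0_norm (p0 x)) mulrC ler_wpM2r.
  have h5 : 0 <= s * ((\int[PP]_x k x - \int[PP]_x (p x * k x)) + eps * (al * ln s)).
    have := ler_wpM2l (ltW eps0) h1; rewrite mulrDr; lra.
  move: h5; rewrite pmulr_rge0// => /le_trans; apply; rewrite lerD2r.
  by move: h3 h4; rewrite !ler_norml => /andP[? ?] /andP[? ?]; lra.
have M0 : 0 <= M by rewrite (le_trans (normr_ge0 _) (Rint_bound PP bk kM)).
have al0 : 0 <= al by apply: Rint_ge0 => x; rewrite indicE.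
have alE : al = 0.
  apply/eqP; rewrite eq_le al0 andbT leNgt; apply/negP => alp.
  have ea : 0 < eps * al by rewrite mulr_gt0.
  have := key (expR (- ((M + M + 1) / (eps * al)))).
  rewrite expR_gt0 expRK expR_lt1 oppr_lt0 divr_gt0//=; last lra.
  move=> /(_ isT); have -> : eps * (al * - ((M + M + 1) / (eps * al))) = - (M + M + 1).
    by field; rewrite !gt_eqF.
  lra.
exists Z; split => //.
  by rewrite Rint_indic// -/al alE.
by move=> x /= /negP; rewrite -leNgt.
Qed.

(** Where [p] is bounded above and below, both [p + s v] and [p - s v] are
    competitors for small [s], and the energy of [p + s v] is affine in [s] up to
    an error of order [s ^+ 2]. *)
Lemma first_order_condition (v : U -> R) (lo hi : R) : bounded_mfun v -> 0 < lo ->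
  (forall x, v x != 0 -> lo <= p x <= hi) ->
  (forall j A, measurable A -> \int[PP]_x (v x * \1_A (tnth x j)) = 0) ->
  bounded_mfun (fun x => v x * (k x + eps * ln (p x))) /\
  \int[PP]_x (v x * (k x + eps * ln (p x))) = 0.
Proof.
move=> bv lo0 vp v0.
have v0T : \int[PP]_x v x = 0.
  rewrite -(v0 (Ordinal m0) setT)//; apply: eq_Rintegral => x _.
  by rewrite indicT mulr1.
have bvl : bounded_mfun (fun x => v x * ln (p x)).
  split.
    by apply: measurable_funM; [case: bv|exact: measurableT_comp (@measurable_ln R) mp].
  have [_ [V vV]] := bv; exists (V * (`|ln lo| + `|ln hi|)) => x; rewrite normrM.
  have V0 : 0 <= V by exact: le_trans (normr_ge0 _) (vV x).
  have [->|vx] := eqVneq (v x) 0; first by rewrite normr0 mul0r mulr_ge0// addr_ge0.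
  apply: ler_pM => //; have /andP[lop phi] := vp x vx.
  have px0 : 0 < p x by exact: lt_le_trans lop.
  have l1 : ln lo <= ln (p x) by rewrite ler_ln ?posrE.
  have l2 : ln (p x) <= ln hi by rewrite ler_ln ?posrE//; exact: lt_le_trans phi.
  rewrite ler_norml; apply/andP; split.
    by have := ler_norm (- ln lo); rewrite normrN; have := normr_ge0 (ln hi); lra.
  by have := ler_norm (ln hi); have := normr_ge0 (ln lo); lra.
have bg : bounded_mfun (fun x => v x * (k x + eps * ln (p x))).
  rewrite (_ : (fun x => _) = fun x => v x * k x + eps * (v x * ln (p x))).
    by apply: bmfD; [exact: bmfM|exact: bmfZ].
  by apply/funext => x; ring.
split => //; set I := \int[PP]_x _.
have [V V0 vV] : exists2 V, 0 < V & forall x, `|v x| <= V.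
  have [_ [V vV]] := bv; exists (`|V| + 1); first by have := normr_ge0 V; lra.
  by move=> x; have := vV x; have := ler_norm V; lra.
have key s : `|s| * V <= lo -> 0 <= s * I + eps * (s ^+ 2 * V ^+ 2 / lo).
  move=> sV.
  pose q x := p x + s * v x.
  have bsv : bounded_mfun (fun x => s * v x) by exact: bmfZ.
  have rsv := bmf_rint PP bsv.
  have rq : Rintegrable PP q by exact: rintD.
  have svV x : `|s * v x| <= lo.
    by rewrite normrM (le_trans _ sV)// ler_wpM2l.
  have q0 x : 0 <= q x.
    rewrite /q; have [->|vx] := eqVneq (v x) 0; first by rewrite mulr0 addr0.
    have /andP[lop _] := vp x vx; have := svV x; rewrite ler_norml => /andP[? ?]; lra.
  pose ub x := xlnx (p x) + (s * (v x * ln (p x)) + s * v x + s ^+ 2 * V ^+ 2 / lo).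
  have brest : bounded_mfun (fun x => s * (v x * ln (p x)) + s * v x + s ^+ 2 * V ^+ 2 / lo).
    apply: bmfD; last exact: bmf_cst.
    by apply: bmfD bsv; exact: bmfZ.
  have rub : Rintegrable PP ub by apply: rintD => //; exact: bmf_rint.
  have c0 : 0 <= s ^+ 2 * V ^+ 2 / lo.
    by apply: divr_ge0 (ltW lo0); exact: mulr_ge0 (sqr_ge0 _) (sqr_ge0 _).
  have qub x : xlnx (q x) <= ub x.
    rewrite /q /ub; have [->|vx] := eqVneq (v x) 0.
      by rewrite !mul0r mulr0 !addr0 add0r lerDl.
    have /andP[lop _] := vp x vx; have px0 : 0 < p x by exact: lt_le_trans lop.
    apply: (le_trans (xlnx_quad px0 (q0 x))).
    have : (s * v x) ^+ 2 / p x <= s ^+ 2 * V ^+ 2 / lo.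
      apply: ler_pM; [exact: sqr_ge0|by rewrite invr_ge0 ltW| |by rewrite lef_pV2 ?posrE].
      rewrite exprMn; apply: ler_wpM2l; first exact: sqr_ge0.
      by rewrite -(real_normK (num_real (v x))) ler_sqr ?nnegrE// ltW.
    lra.
  have xq : Rintegrable PP (fun x => xlnx (q x)).
    apply: (@rint_le _ _ _ _ _ (fun x => 1 + `|ub x|)).
    - by apply: measurable_xlnx; case: rq.
    - by apply: rintD; [exact/bmf_rint/bmf_cst|exact: rint_norm].
    - move=> x; have := xlnx_ge (q0 x); have := q0 x; have := qub x; have := ler_norm (ub x).
      by move=> h1 h2 h3 h4; rewrite ler_norml; apply/andP; split; have := normr_ge0 (ub x); lra.
  have uq : unit_marginals mu q.
    apply: unit_marginalsD => // j A mA.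
    under eq_Rintegral do rewrite -mulrA.
    rewrite RintZ ?v0 ?mulr0//; apply: mul_tnth_rint => //; exact: bmf_rint.
  have := pmin.2 q (And4 rq q0 uq xq); rewrite /energy.
  have rpk : Rintegrable PP (fun x => p x * k x) by exact: rintM.
  have bvk : bounded_mfun (fun x => v x * k x) by exact: bmfM.
  have -> : \int[PP]_x (q x * k x) = \int[PP]_x (p x * k x) + s * \int[PP]_x (v x * k x).
    rewrite -RintZ; last exact: bmf_rint.
    rewrite -RintD//; last exact/bmf_rint/bmfZ.
    by apply: eq_Rintegral => x _; rewrite /q; ring.
  have Iub : \int[PP]_x ub x = \int[PP]_x xlnx (p x) +
      (s * \int[PP]_x (v x * ln (p x)) + s ^+ 2 * V ^+ 2 / lo).
    rewrite RintD//; last exact: bmf_rint.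
    congr (_ + _); rewrite RintD; [|exact/bmf_rint/bmfD/bsv/bmfZ|exact/bmf_rint/bmf_cst].
    rewrite Rint_cst RintD//; last exact/bmf_rint/bmfZ.
    rewrite !RintZ; [|exact: bmf_rint..].
    by rewrite v0T mulr0 addr0.
  have IE : I = \int[PP]_x (v x * k x) + eps * \int[PP]_x (v x * ln (p x)).
    rewrite -RintZ; last exact: bmf_rint.
    rewrite -RintD; [|exact: bmf_rint|exact/bmf_rint/bmfZ].
    by apply: eq_Rintegral => x _; ring.
  have := le_Rint xq rub qub; rewrite Iub IE => h1 h2.
  have := ler_wpM2l (ltW eps0) h1; rewrite !mulrDr; lra.
have C0 : 0 < eps * (V ^+ 2 / lo) by rewrite mulr_gt0// divr_gt0// exprn_gt0.
set C := eps * (V ^+ 2 / lo) in C0.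
have keyC s : `|s| * V <= lo -> 0 <= s * I + s ^+ 2 * C.
  by move=> /key; rewrite /C; congr (0 <= _ + _); ring.
(* A nonzero linear coefficient would dominate the quadratic term at [s0], for one
   of the signs of [s0]. *)
pose s0 := Num.min (lo / V) (`|I| / (2 * C)).
have loV : 0 < lo / V by rewrite divr_gt0.
have s0_ge0 : 0 <= s0 by rewrite /s0 le_min (ltW loV)/= divr_ge0// mulr_ge0// (ltW C0).
have s0V : `|s0| * V <= lo by rewrite ger0_norm// -ler_pdivlMr// /s0 ge_min lexx.
have s0C : s0 * C <= `|I| / 2.
  have : s0 <= `|I| / (2 * C) by rewrite /s0 ge_min lexx orbT.
  move=> /(ler_wpM2r (ltW C0)) /le_trans; apply.
  by rewrite (_ : `|I| / (2 * C) * C = `|I| / 2)//; field; rewrite gt_eqF.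
apply/eqP; rewrite -normr_le0 leNgt; apply/negP => I0.
have s0p : 0 < s0 by rewrite /s0 lt_min loV/= divr_gt0// mulr_gt0.
have k1 := keyC s0 s0V.
have k2 := keyC (- s0); rewrite normrN sqrrN in k2; have {}k2 := k2 s0V.
have h : s0 * `|I| <= s0 ^+ 2 * C.
  by have [h|h] := ger0P I; rewrite ?mulNr in k2 *; lra.
have : s0 * `|I| <= s0 * (`|I| / 2).
  by rewrite (le_trans h)// expr2 -mulrA ler_wpM2l.
by rewrite ler_pM2l// => ?; lra.
Qed.

End optimality.

(** * Two-sided bounds on the minimizing density *)

Section population.
Context (dT : measure_display) (T : measurableType dT) (R : realType).
Context (m : nat) (mu : 'I_m -> probability T R).
Local Notation U := (m.-tuple T).
Local Notation PP := (tuple_prod mu).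
Local Notation PP2 := (PP \x PP)%E.
Variables (eps M : R) (k p : U -> R).
Hypotheses (m0 : (0 < m)%N) (eps0 : 0 < eps) (bk : bounded_mfun k) (kM : forall x, `|k x| <= M).
Hypothesis pmin : energy_minimizer mu eps k p.

Let rp : Rintegrable PP p. Proof. by case: pmin => -[]. Qed.
Let mp : measurable_fun setT p. Proof. by case: rp. Qed.
Let p0 x : 0 <= p x. Proof. by case: pmin => -[]. Qed.
Let up : unit_marginals mu p. Proof. by case: pmin => -[]. Qed.
Let p1 : \int[PP]_x p x = 1. Proof. exact: coupling_density_mass up. Qed.

Lemma Rint_swap_coord j (F : U * U -> R) : bounded_mfun F ->
  \int[PP2]_z F (swap_coord j z) = \int[PP2]_z F z.
Proof. by move=> bF; rewrite -(law_Rint (law_swap_coord mu j) (bmf_rint _ bF)). Qed.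

Lemma law_exchange : law PP2 (fun z => (z.2, z.1)) PP2.
Proof.
split; first exact: measurable_swap.
move=> A mA; rewrite [LHS]Rint_indic// [RHS]Rint_indic; last first.
  by rewrite -[X in measurable X]setTI; apply: measurable_swap.
apply: (congr1 EFin); rewrite Rint_prod1; last exact: bmf_indic.
rewrite Rint_prod2; last first.
  by apply: bmf_indic; rewrite -[X in measurable X]setTI; apply: measurable_swap.
by [].
Qed.

Lemma Rint_exchange (F : U * U -> R) : bounded_mfun F ->
  \int[PP2]_z F (z.2, z.1) = \int[PP2]_z F z.
Proof. by move=> bF; rewrite -(law_Rint law_exchange (bmf_rint _ bF)). Qed.

Definition swap_gain j (psi : U -> R) (z : U * U) :=
  psi (swap_coord j z).1 + psi (swap_coord j z).2 - psi z.1 - psi z.2.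

(** The perturbation of density which, at rate [tau], removes the pairs (x, y) and
    inserts the swapped pairs; it collects the four contributions to the point [x]. *)
Definition swap_flow j (tau : U * U -> R) (x : U) : R :=
  \int[PP]_y (tau (swap_coord j (x, y)) + tau (swap_coord j (y, x)) - tau (x, y) - tau (y, x)).

Lemma bmf_swap_coord j (F : U * U -> R) : bounded_mfun F -> bounded_mfun (fun z => F (swap_coord j z)).
Proof. by apply: bmf_comp; exact: measurable_swap_coord. Qed.

Lemma bmf_exchange (F : U * U -> R) : bounded_mfun F -> bounded_mfun (fun z => F (z.2, z.1)).
Proof. by apply: (@bmf_comp _ _ _ _ _ (fun z : U * U => (z.2, z.1))); exact: measurable_swap. Qed.

Lemma bmf_fst (F : U -> R) : bounded_mfun F -> bounded_mfun (fun z : U * U => F z.1).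
Proof. by apply: (@bmf_comp _ _ _ _ _ (@fst U U)); exact: measurable_fst. Qed.

Lemma bmf_snd (F : U -> R) : bounded_mfun F -> bounded_mfun (fun z : U * U => F z.2).
Proof. by apply: (@bmf_comp _ _ _ _ _ (@snd U U)); exact: measurable_snd. Qed.

Lemma bmf_flow_integrand j (tau : U * U -> R) : bounded_mfun tau -> bounded_mfun (fun z : U * U =>
   tau (swap_coord j z) + tau (swap_coord j (z.2, z.1)) - tau z - tau (z.2, z.1)).
Proof.
move=> bt; apply: bmfB; last exact: bmf_exchange.
apply: bmfB => //; apply: bmfD; first exact: bmf_swap_coord.
exact: (bmf_exchange (bmf_swap_coord j bt)).
Qed.

Lemma bmf_swap_flow j tau : bounded_mfun tau -> bounded_mfun (swap_flow j tau).
Proof.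
move=> /(bmf_flow_integrand j) bt.
exact: (bmf_fubini1 PP PP bt).
Qed.

Lemma bmf_swap_gain j psi : bounded_mfun psi -> bounded_mfun (swap_gain j psi).
Proof.
move=> bpsi; apply: bmfB; last exact: bmf_snd.
apply: bmfB; last exact: bmf_fst.
by apply: bmfD; [exact: (bmf_swap_coord j (bmf_fst bpsi))|exact: (bmf_swap_coord j (bmf_snd bpsi))].
Qed.

(** Duality between [swap_flow] and [swap_gain]: invariance of the product measure
    under the swap and under the exchange of the two points moves both from [tau]
    to [psi]. *)
Lemma Rint_swap_flow j tau psi : bounded_mfun tau -> bounded_mfun psi ->
  \int[PP]_x (swap_flow j tau x * psi x) = \int[PP2]_z (tau z * swap_gain j psi z).
Proof.
move=> bt bpsi.
pose A z := psi z.1 * tau (swap_coord j z).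
pose B (z : U * U) := psi z.1 * tau (swap_coord j (z.2, z.1)).
pose C (z : U * U) := psi z.1 * tau z.
pose E (z : U * U) := psi z.1 * tau (z.2, z.1).
have bf := bmf_fst bpsi.
have bA : bounded_mfun A by apply: bmfM => //; exact: bmf_swap_coord.
have bB : bounded_mfun B by apply: bmfM => //; exact: (bmf_exchange (bmf_swap_coord j bt)).
have bC : bounded_mfun C by exact: bmfM.
have bE : bounded_mfun E by apply: bmfM => //; exact: bmf_exchange.
transitivity (\int[PP2]_z (A z + B z - C z - E z)).
  rewrite Rint_prod1; last by do 2 apply: bmfB => //; exact: bmfD.
  apply: eq_Rintegral => x _; rewrite mulrC -RintZ.
    by apply: eq_Rintegral => y _; rewrite /A /B /C /E/=; ring.
  exact/bmf_rint/(bmf_pair1 x (bmf_flow_integrand j bt)).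
have IA : \int[PP2]_z A z = \int[PP2]_z (psi (swap_coord j z).1 * tau z).
  rewrite -(Rint_swap_coord j bA); apply: eq_Rintegral => z _.
  by rewrite /A swap_coordK.
have IB : \int[PP2]_z B z = \int[PP2]_z (psi (swap_coord j z).2 * tau z).
  rewrite -(Rint_exchange bB) /B/=.
  have b' : bounded_mfun (fun z : U * U => psi z.2 * tau (swap_coord j z)).
    by apply: bmfM; [exact: bmf_snd|exact: bmf_swap_coord].
  rewrite (_ : (fun z : U * U => _) = fun z => psi z.2 * tau (swap_coord j z)); last first.
    by apply/funext => -[x y].
  by rewrite -(Rint_swap_coord j b'); apply: eq_Rintegral => z _; rewrite swap_coordK.
have IE : \int[PP2]_z E z = \int[PP2]_z (psi z.2 * tau z).
  by rewrite -(Rint_exchange bE) /E/=; apply: eq_Rintegral => -[x y] _.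
have b1 : bounded_mfun (fun z => psi (swap_coord j z).1 * tau z).
  by apply: bmfM => //; exact: (bmf_swap_coord j (bmf_fst bpsi)).
have b2 : bounded_mfun (fun z => psi (swap_coord j z).2 * tau z).
  by apply: bmfM => //; exact: (bmf_swap_coord j (bmf_snd bpsi)).
have b4 : bounded_mfun (fun z : U * U => psi z.2 * tau z).
  by apply: bmfM => //; exact: bmf_snd.
rewrite RintB; [|exact/bmf_rint/bmfB/bC/bmfD|exact: bmf_rint].
rewrite RintB; [|exact/bmf_rint/bmfD|exact: bmf_rint].
rewrite RintD; [|exact: bmf_rint..].
rewrite IA IB IE -RintD; [|exact: bmf_rint..].
rewrite -RintB; [|exact/bmf_rint/bmfD|exact: bmf_rint].
rewrite -RintB; [|exact/bmf_rint/bmfB/bC/bmfD|exact: bmf_rint].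
by apply: eq_Rintegral => z _; rewrite /C /swap_gain; ring.
Qed.

(** Functions of one coordinate do not see the swap; hence swap flows have zero
    marginals. *)
Lemma swap_gain_marginal j i (f : T -> R) z : swap_gain j (fun x => f (tnth x i)) z = 0.
Proof.
rewrite /swap_gain/= !tnth_upd; case: eqP => [->|_]; ring.
Qed.

Let K := expR (4 * M / eps).

Lemma ae_PP2 (S : U -> Prop) j : {ae PP, forall x, S x} ->
  {ae PP2, forall z, [/\ S z.1, S z.2, S (swap_coord j z).1 & S (swap_coord j z).2]}.
Proof.
move=> aS.
have a1 := law_ae (law_fst PP PP) aS.
have a2 := law_ae (law_snd PP PP) aS.
have a3 := law_ae (law_swap_coord mu j) a1.
have a4 := law_ae (law_swap_coord mu j) a2.
by apply: filterS2 (filterI a1 a2) (filterI a3 a4) => z [? ?] [? ?]; split.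
Qed.

(** Take for [tau] the positive part of the gain, cut off outside the pairs whose
    four points have density in [[d, d^-1]]. The flow is then an admissible
    perturbation, and [first_order_condition] says that the integral of the square
    of this positive part is zero. *)
Lemma swap_inequality_trunc j (d : R) : 0 < d ->
  let S := fun x => d <= p x <= d^-1 in
  {ae PP2, forall z, [/\ S z.1, S z.2, S (swap_coord j z).1 & S (swap_coord j z).2] ->
   swap_gain j (fun x => k x + eps * ln (p x)) z <= 0}.
Proof.
move=> d0 S.
have mS : measurable [set x | S x].
  rewrite (_ : [set x | S x] = [set x | d <= p x] `&` [set x | p x <= d^-1]); last first.
    by apply/seteqP; split=> x; [move=> /andP[]|move=> [? ?]; apply/andP].
  apply: measurableI; rewrite -[X in measurable X]setTI;
    by apply: measurable_fun_le => //; exact: measurable_cst.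
pose SS := [set x | S x].
pose w x := \1_SS x * (k x + eps * ln (p x)).
have bw : bounded_mfun w.
  have [mk [Mk kMk]] := bk; split.
    apply: measurable_funM; first exact: measurable_indic.
    apply: measurable_funD => //; apply: measurable_funM => //.
    exact: measurableT_comp (@measurable_ln R) mp.
  exists (Mk + eps * (`|ln d| + `|ln d^-1|)) => x; rewrite /w indicE normrM.
  have Mk0 : 0 <= Mk by exact: le_trans (normr_ge0 _) (kMk x).
  case: (boolP (x \in SS)); last first.
    move=> _; rewrite normr0 mul0r addr_ge0// mulr_ge0 ?addr_ge0//; exact: ltW.
  rewrite inE /SS/= => /andP[dp pd]; rewrite normr1 mul1r (le_trans (ler_normD _ _))//.
  apply: lerD => //; rewrite normrM gtr0_norm// ler_pM2l//.
  have px0 : 0 < p x by exact: lt_le_trans dp.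
  have l1 : ln d <= ln (p x) by rewrite ler_ln ?posrE.
  have l2 : ln (p x) <= ln d^-1 by rewrite ler_ln ?posrE// invr_gt0.
  rewrite ler_norml; apply/andP; split.
    by have := ler_norm (- ln d); rewrite normrN; have := normr_ge0 (ln d^-1); lra.
  by have := ler_norm (ln d^-1); have := normr_ge0 (ln d); lra.
have wE x : S x -> w x = k x + eps * ln (p x).
  by move=> Sx; rewrite /w indicE mem_set// mul1r.
pose I1 : U -> R := \1_SS.
have bI : bounded_mfun I1 by exact: bmf_indic.
pose G (z : U * U) := I1 z.1 * I1 z.2 * (I1 (swap_coord j z).1 * I1 (swap_coord j z).2).
have bG : bounded_mfun G.
  apply: bmfM; first by apply: bmfM; [exact: bmf_fst|exact: bmf_snd].
  by apply: bmfM; [exact: (bmf_swap_coord j (bmf_fst bI))|exact: (bmf_swap_coord j (bmf_snd bI))].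
have bW := bmf_swap_gain j bw.
pose pos (u : R) := Num.max u 0.
have bpos (F : U * U -> R) : bounded_mfun F -> bounded_mfun (fun z => pos (F z)).
  move=> [mF [N FN]]; split; first by apply: measurable_maxr => //; exact: measurable_cst.
  exists N => z; rewrite /pos; case: (leP (F z) 0) => [Fz|Fz]; last by [].
  by rewrite normr0 (le_trans _ (FN z)).
pose tau z := G z * pos (swap_gain j w z).
have bt : bounded_mfun tau by apply: bmfM => //; exact: bpos.
have flow0 x : swap_flow j tau x != 0 -> S x.
  apply: contra_neqP => nS.
  have I0 : I1 x = 0 by rewrite /I1 indicE memNset.
  rewrite -[RHS](Rint_cst PP 0); apply: eq_Rintegral => y _.
  rewrite /tau /G !swap_coordK/= I0.
  by rewrite !(mul0r, mulr0) !subr0 addr0.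
have [bF F0] : bounded_mfun (fun x => swap_flow j tau x * (k x + eps * ln (p x))) /\
    \int[PP]_x (swap_flow j tau x * (k x + eps * ln (p x))) = 0.
  apply: (first_order_condition m0 eps0 bk pmin (bmf_swap_flow j bt) d0 flow0).
  move=> i A mA; rewrite Rint_swap_flow//; last exact: (bmf_tnth i (bmf_indic _ mA)).
  rewrite -[RHS](Rint_cst PP2 0); apply: eq_Rintegral => z _.
  by rewrite swap_gain_marginal mulr0.
have J0 : \int[PP2]_z (tau z * swap_gain j w z) = 0.
  rewrite -Rint_swap_flow// -F0; apply: eq_Rintegral => x _.
  have [->|/flow0 Sx] := eqVneq (swap_flow j tau x) 0; first by rewrite !mul0r.
  by rewrite wE.
have G0 z : 0 <= G z by rewrite /G /I1 !indicE !mulr_ge0.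
have := @Rint0_ae _ _ _ _ _ (bmf_rint PP2 (bmfM bt bW)) _ J0.
move=> /(_ _)/wrap[].
  move=> z; rewrite /tau -mulrA mulr_ge0// /pos.
  by case: (leP (swap_gain j w z) 0) => [|/ltW] ?; rewrite ?mul0r// mulr_ge0.
apply: filterS => z; rewrite /tau => H [S1 S2 S3 S4].
have GE : G z = 1 by rewrite /G /I1 !indicE !mem_set// !mulr1.
move: H; rewrite GE mul1r /pos => H.
have <- : swap_gain j w z = swap_gain j (fun x => k x + eps * ln (p x)) z.
  by rewrite /swap_gain !wE.
rewrite leNgt; apply/negP => pz; move: H.
have -> : Num.max (swap_gain j w z) 0 = swap_gain j w z by apply/max_idPl; exact: ltW.
by move=> /eqP; rewrite mulf_eq0 orbb gt_eqF.
Qed.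

Lemma archimedean_window (u : R) : 0 < u -> exists n0 : nat, forall n, (n0 <= n)%N ->
  n.+1%:R^-1 <= u <= n.+1%:R^-1^-1.
Proof.
move=> u0; exists (maxn (Num.bound u) (Num.bound u^-1)) => n.
rewrite geq_max => /andP[n1 n2]; rewrite invrK.
have b1 : u < n.+1%:R.
  by rewrite (lt_le_trans (archi_boundP (ltW u0)))// ler_nat ltnW.
have b2 : u^-1 < n.+1%:R.
  have ui : 0 <= u^-1 by rewrite invr_ge0 ltW.
  by rewrite (lt_le_trans (archi_boundP ui))// ler_nat ltnW.
by rewrite (ltW b1) andbT -[leRHS]invrK lef_pV2 ?posrE ?invr_gt0// ltW.
Qed.

(** By positivity almost every pair falls into the windows of
    [swap_inequality_trunc] for [d] small enough; exponentiating costs the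
    oscillation of [k] at four points. *)
Lemma swap_inequality j : {ae PP2, forall z,
  p (swap_coord j z).1 * p (swap_coord j z).2 <= K * (p z.1 * p z.2)}.
Proof.
have aepos := ae_PP2 j (minimizer_pos m0 eps0 bk kM pmin).
have aen : {ae PP2, forall z, forall n : nat,
   let S := fun x => n.+1%:R^-1 <= p x <= n.+1%:R^-1^-1 in
   [/\ S z.1, S z.2, S (swap_coord j z).1 & S (swap_coord j z).2] ->
   swap_gain j (fun x => k x + eps * ln (p x)) z <= 0}.
  by apply/ae_foralln => n; apply: swap_inequality_trunc; rewrite invr_gt0.
apply: filterS2 aepos aen => z [P1 P2 P3 P4] H.
have [n1 H1] := archimedean_window P1; have [n2 H2] := archimedean_window P2.
have [n3 H3] := archimedean_window P3; have [n4 H4] := archimedean_window P4.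
pose n := (n1 + n2 + n3 + n4)%N.
have : swap_gain j (fun x => k x + eps * ln (p x)) z <= 0.
  apply: (H n); split; [apply: H1|apply: H2|apply: H3|apply: H4]; rewrite /n; lia.
rewrite /swap_gain => gain.
have k1 := kM z.1; have k2 := kM z.2; have k3 := kM (swap_coord j z).1; have k4 := kM (swap_coord j z).2.
move: k1 k2 k3 k4; rewrite !ler_norml => /andP[? ?] /andP[? ?] /andP[? ?] /andP[? ?].
rewrite -(lnK P1) -(lnK P2) -(lnK P3) -(lnK P4) /K -!expRD ler_expR.
rewrite -lerBlDr ler_pdivlMr//; lra.
Qed.

Local Open Scope ereal_scope.

Definition eresample j (f : U -> \bar R) (x : U) := \int[mu j]_a f (upd j x a).

Lemma measurable_updz j (f : U -> \bar R) : measurable_fun setT f ->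
  measurable_fun setT (fun z : U * T => f (upd j z.1 z.2)).
Proof. by move=> mf; apply: (measurableT_comp mf); exact: measurable_upd. Qed.

Lemma measurable_eresample j f : measurable_fun setT f -> (forall x, 0 <= f x) ->
  measurable_fun setT (eresample j f).
Proof.
move=> mf f0.
exact: (@measurable_fun_fubini_tonelli_F _ _ _ _ _ (mu j) _ (measurable_updz j mf) (fun z => f0 _)).
Qed.

Lemma eresample_ge0 j f : (forall x, 0 <= f x) -> forall x, 0 <= eresample j f x.
Proof. by move=> f0 x; apply: integral_ge0. Qed.

Lemma integral_eresample j f : measurable_fun setT f -> (forall x, 0 <= f x) ->
  \int[PP]_x f x = \int[PP]_x eresample j f x.
Proof.
move=> mf f0; rewrite (law_ge0_integral (law_upd mu j) mf f0).
by rewrite (fubini_tonelli1 _ (measurable_updz j mf))//.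
Qed.

Lemma integral_eresample2 j f : measurable_fun setT f -> (forall x, 0 <= f x) ->
  \int[PP]_x f x = \int[mu j]_a \int[PP]_x f (upd j x a).
Proof.
move=> mf f0; rewrite (law_ge0_integral (law_upd mu j) mf f0).
by rewrite (fubini_tonelli2 _ (measurable_updz j mf))//.
Qed.

Definition edensity x := (p x)%:E.

Lemma measurable_edensity : measurable_fun setT edensity. Proof. exact/measurable_EFinP. Qed.

Lemma edensity_ge0 x : 0 <= edensity x. Proof. by rewrite lee_fin. Qed.

(** The extended-real form of the marginal constraint, for a density that need not
    be bounded yet. *)
Lemma marginal_density_one j : {ae mu j, forall a, \int[PP]_x edensity (upd j x a) = 1}.
Proof.
have mc : measurable_fun setT (fun a => \int[PP]_x edensity (upd j x a)).
  exact: (@measurable_fun_fubini_tonelli_G _ _ _ _ _ PP _ (measurable_updz j measurable_edensity) (fun z => edensity_ge0 _)).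
suff : ae_eq (mu j) setT (cst 1) (fun a => \int[PP]_x edensity (upd j x a)).
  by apply: filterS => a /= /(_ I).
apply: integral_ae_eq => //.
  by have [] := bmf_rint (mu j) (bmf_cst T (1 : R)).
move=> E _ mE; rewrite integral_cst// mul1e.
rewrite [RHS]integral_mkcond.
transitivity (\int[PP]_x (p x * \1_E (tnth x j))%:E).
  rewrite -EFin_Rint; last by apply: mul_tnth_rint.
  by rewrite up// -Rint_indic.
have mi : measurable_fun setT (fun x : U => (p x * \1_E (tnth x j))%:E).
  by apply/measurable_EFinP; have [] := mul_tnth_rint j rp mE.
rewrite (@integral_eresample2 j _ mi); last first.
  by move=> x; rewrite lee_fin mulr_ge0// indicE.
apply: eq_integral => a _; rewrite patchE.
under eq_integral do rewrite tnth_updE indicE.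
case: ifPn => aE.
  by apply: eq_integral => x _; rewrite mulr1.
by under eq_integral do rewrite mulr0; rewrite integral0.
Qed.

Lemma integral_swap_pair j x :
  \int[PP]_y (p (upd j x (tnth y j)) * p (upd j y (tnth x j)))%:E =
  eresample j edensity x * \int[PP]_y edensity (upd j y (tnth x j)).
Proof.
have mF : measurable_fun setT (fun y => (p (upd j x (tnth y j)) * p (upd j y (tnth x j)))%:E).
  apply/measurable_EFinP; apply: measurable_funM; apply: measurableT_comp => //.
    exact: measurable_fun_upd_tnth.
  exact: measurable_upd.
rewrite (integral_eresample2 j mF); last by move=> y; rewrite lee_fin mulr_ge0.
have mu1 : measurable_fun setT (fun y => edensity (upd j y (tnth x j))).
  by apply: (measurableT_comp measurable_edensity); exact: measurable_upd.
have mu2 : measurable_fun setT (fun a => edensity (upd j x a)).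
  by apply: (measurableT_comp measurable_edensity); exact: measurable_upd.
transitivity (\int[mu j]_a (edensity (upd j x a) * \int[PP]_y edensity (upd j y (tnth x j)))).
  apply: eq_integral => a _; under eq_integral do rewrite tnth_updE upd_upd EFinM.
  by rewrite ge0_integralZl_EFin//; move=> y _; exact: edensity_ge0.
rewrite ge0_integralZr//; first by move=> a _; exact: edensity_ge0.
by apply: integral_ge0 => y _; exact: edensity_ge0.
Qed.

Lemma ae_eresample j (S : U -> Prop) : {ae PP, forall x, S x} ->
  {ae PP, forall x, {ae mu j, forall a, S (upd j x a)}}.
Proof. by move=> aS; apply: (ae_prod1 (law_ae (law_upd mu j) aS)). Qed.

(** Integrate [swap_inequality] in the second point: since the marginal densities of
    [p] are 1, the product [p (x') * p (y')] integrates to the average of [p] over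
    the [j]-th coordinate. *)
Lemma density_resample_bounds j :
  {ae PP, forall x, eresample j edensity x <= K%:E * edensity x /\ edensity x <= K%:E * eresample j edensity x}.
Proof.
have K0 : (0 <= K)%R by exact: expR_ge0.
have a1 := ae_prod1 (swap_inequality j).
have a2 : {ae PP, forall x, {ae PP, forall y, (p x * p y <= K * (p (upd j x (tnth y j)) * p (upd j y (tnth x j))))%R}}.
  apply: (ae_prod1 (S := fun z => (p z.1 * p z.2 <= K * (p (swap_coord j z).1 * p (swap_coord j z).2))%R)).
  have := law_ae (law_swap_coord mu j) (swap_inequality j).
  by apply: filterS => z; rewrite swap_coordK.
have a3 := law_ae (law_tnth mu j) (marginal_density_one j).
have mF x : measurable_fun setT (fun y => (p (upd j x (tnth y j)) * p (upd j y (tnth x j)))%:E).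
  apply/measurable_EFinP; apply: measurable_funM; apply: measurableT_comp => //.
    exact: measurable_fun_upd_tnth.
  exact: measurable_upd.
have Ipp c x : (0 <= c)%R -> \int[PP]_y (c * (p x * p y))%:E = c%:E * edensity x.
  move=> c0; under eq_integral do rewrite mulrA EFinM.
  rewrite ge0_integralZl//; [|exact: measurable_edensity|by move=> y _; exact: edensity_ge0|by rewrite lee_fin mulr_ge0].
  by rewrite -EFin_Rint// p1 mule1 EFinM.
apply: filterS2 (filterI a1 a2) a3 => x [H1 H2] H3.
have := integral_swap_pair j x; rewrite H3 mule1 => E; split.
  rewrite -E -Ipp//; apply: ae_ge0_le_integral => //.
  - by move=> y _; rewrite lee_fin mulr_ge0.
  - by move=> y _; rewrite lee_fin !mulr_ge0.
  - by apply/measurable_EFinP; do 2 apply: measurable_funM => //.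
  - by apply: filterS H1 => y /= h _; rewrite lee_fin.
rewrite -[leLHS]mul1e -Ipp// -E -ge0_integralZl//; last by move=> y _; rewrite lee_fin mulr_ge0.
apply: ae_ge0_le_integral => //.
- by move=> y _; rewrite lee_fin !mulr_ge0.
- by apply/measurable_EFinP; do 2 apply: measurable_funM => //.
- by move=> y _; rewrite mule_ge0// lee_fin// mulr_ge0.
- by apply: emeasurable_funM.
- by apply: filterS H2 => y /= h _; rewrite -EFinM lee_fin mul1r.
Qed.

(** Successive averages of [p] over the coordinates listed in [s]; over all
    coordinates this is the total mass 1. *)
Fixpoint eresamples (s : seq 'I_m) : U -> \bar R :=
  if s is j :: s' then eresample j (eresamples s') else edensity.

Lemma measurable_eresamples s :
  measurable_fun setT (eresamples s) /\ forall x, 0 <= eresamples s x.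
Proof.
elim: s => [|j s [IH1 IH2]] /=; first by split; [exact: measurable_edensity|exact: edensity_ge0].
by split; [exact: measurable_eresample|exact: eresample_ge0].
Qed.

(** Each average costs one factor [K], by [density_resample_bounds]. *)
Lemma eresamples_bounds s : {ae PP, forall x,
  eresamples s x <= (K ^+ size s)%:E * edensity x /\ edensity x <= (K ^+ size s)%:E * eresamples s x}.
Proof.
have K0 : (0 <= K)%R by exact: expR_ge0.
elim: s => [|j s IH] /=; first by apply: nearW => x; rewrite expr0 mul1e.
have [ms s0] := measurable_eresamples s.
have KS0 : (0 <= K ^+ size s)%R by rewrite exprn_ge0.
apply: filterS2 (density_resample_bounds j) (ae_eresample j IH) => x [B1 B2] H.
have mp2 : measurable_fun setT (fun a => edensity (upd j x a)).
  by apply: (measurableT_comp measurable_edensity); exact: measurable_upd.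
have ms2 : measurable_fun setT (fun a => eresamples s (upd j x a)).
  by apply: (measurableT_comp ms); exact: measurable_upd.
have I1 : eresample j (eresamples s) x <= (K ^+ size s)%:E * eresample j edensity x.
  rewrite -ge0_integralZl//; last by move=> a _; exact: edensity_ge0.
  apply: ae_ge0_le_integral => //.
  - by move=> a _; rewrite mule_ge0 ?edensity_ge0// lee_fin.
  - by apply: emeasurable_funM.
  - by apply: filterS H => a [].
have I2 : eresample j edensity x <= (K ^+ size s)%:E * eresample j (eresamples s) x.
  rewrite -ge0_integralZl//.
  apply: ae_ge0_le_integral => //.
  - by move=> a _; exact: edensity_ge0.
  - by move=> a _; rewrite mule_ge0// lee_fin.
  - by apply: emeasurable_funM.
  - by apply: filterS H => a [].
split.
  rewrite (le_trans I1)// exprSr EFinM -muleA lee_wpmul2l// lee_fin//.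
by rewrite (le_trans B2)// exprS EFinM -muleA lee_wpmul2l// lee_fin.
Qed.

Lemma eresamples_upd s j x a : j \in s -> eresamples s (upd j x a) = eresamples s x.
Proof.
elim: s x => [//|i s IH] x; rewrite inE /= /eresample.
have [->|ij] := eqVneq j i => /=.
  by move=> _; apply: eq_integral => b _; rewrite upd_upd.
by move=> js; apply: eq_integral => b _; rewrite updC ?IH// eq_sym.
Qed.

(** Averaging over a coordinate makes a function independent of it, so the result is
    constant, and averaging preserves the integral. *)
Lemma eresamples_all x : eresamples (enum 'I_m) x = 1.
Proof.
pose s := enum 'I_m.
(* Changing the coordinates of [y] into those of [z] one after the other does not
   change the value. *)
have cst_s y z : eresamples s y = eresamples s z.
  pose h (r : seq 'I_m) := foldr (fun j t => upd j t (tnth z j)) y r.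
  have hs r : eresamples s (h r) = eresamples s y.
    by elim: r => [//|j r IH] /=; rewrite eresamples_upd ?mem_enum.
  rewrite -(hs s); congr (eresamples s _); apply: eq_from_tnth => i.
  have hi r : i \in r -> tnth (h r) i = tnth z i.
    elim: r => [//|j r IH]; rewrite inE /= tnth_upd.
    by case: eqVneq => [->|].
  by apply: hi; rewrite mem_enum.
have [ms s0] := measurable_eresamples s.
have I r : \int[PP]_x eresamples r x = 1.
  elim: r => [|j r IH] /=; first by rewrite -EFin_Rint// p1.
  by have [mr r0] := measurable_eresamples r; rewrite -integral_eresample.
rewrite -(I s); under eq_integral do rewrite (cst_s _ x).
by rewrite integral_cst//= [X in _ * X]probability_setT mule1.
Qed.

Lemma minimizer_bounds : {ae PP, forall x, (K ^- m <= p x <= K ^+ m)%R}.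
Proof.
have K0 : (0 < K)%R by exact: expR_gt0.
apply: filterS (eresamples_bounds (enum 'I_m)) => x.
rewrite eresamples_all size_enum_ord mule1 -EFinM !lee_fin => -[h1 h2].
by rewrite h2 andbT -[X in (X <= _)%R]mulr1 mulrC ler_pdivrMr ?exprn_gt0// mulrC.
Qed.

End population.

(** * Schrödinger potentials *)

Section anova.
Context (dT : measure_display) (T : measurableType dT) (R : realType).
Context (m : nat) (mu : 'I_m -> probability T R).
Local Notation U := (m.-tuple T).
Local Notation PP := (tuple_prod mu).
Hypothesis m0 : (0 < m)%N.

(** The constant is spread evenly over the coordinates, so that the main effects sum
    up to the additive part without a separate constant term. *)
Definition main_effect (w : U -> R) j (a : T) : R :=
  cond_exp mu j w a - m.-1%:R / m%:R * \int[PP]_x w x.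

(** The L^2-best approximation of [w] by a sum of functions of one coordinate. *)
Definition additive_part (w : U -> R) (x : U) : R :=
  \sum_(j < m) main_effect w j (tnth x j).

Variable w : U -> R.
Hypothesis bw : bounded_mfun w.

Lemma bmf_main_effect j : bounded_mfun (main_effect w j).
Proof. by apply: bmfB; [exact: bmf_cond|exact: bmf_cst]. Qed.

Lemma bmf_additive_part : bounded_mfun (additive_part w).
Proof.
by apply: bmf_sum => j; exact: (bmf_tnth j (bmf_main_effect j)).
Qed.

Lemma cond_remainder i a : cond_exp mu i (fun x => w x - additive_part w x) a = 0.
Proof.
have be j := bmf_main_effect j.
have bte j := bmf_tnth j (be j).
rewrite /cond_exp RintB; [|exact/bmf_rint/(bmf_upd2 _ _ bw)|
  exact/bmf_rint/(bmf_upd2 _ _ bmf_additive_part)].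
rewrite -/(cond_exp mu i w a) Rint_sum; last by move=> j; exact: (bmf_upd2 _ _ (bte j)).
rewrite (bigD1 i)//=.
rewrite (_ : \int[PP]_x _ = main_effect w i a); last first.
  by under eq_Rintegral do rewrite tnth_updE; rewrite Rint_cst.
have E j : j != i -> \int[PP]_x main_effect w j (tnth (upd i x a) j) = m%:R^-1 * \int[PP]_x w x.
  move=> ji; under eq_Rintegral do rewrite tnth_upd (negbTE ji).
  rewrite (@Rint_tnth _ _ _ _ mu j _ (bmf_rint _ (be j))) /main_effect.
  rewrite RintB; [|exact/bmf_rint/bmf_cond|exact/bmf_rint/bmf_cst].
  rewrite Rint_cst -(Rint_cond mu j bw).
  rewrite -[X in X - _]mul1r -mulrBl; congr (_ * _).
  rewrite -[X in X - _](@mulfV _ m%:R) ?pnatr_eq0 -?lt0n// -mulrBl -[X in (X%:R - _) / _](prednK m0).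
  by rewrite -natrB// subSnn mul1r.
rewrite (eq_bigr _ E) sumr_const cardC1 card_ord /main_effect.
by rewrite -[(_ * _) *+ _]mulr_natl mulrA addrNK subrr.
Qed.

End anova.

Section population_structure.
Context (dT : measure_display) (T : measurableType dT) (R : realType).
Context (m : nat) (mu : 'I_m -> probability T R).
Local Notation U := (m.-tuple T).
Local Notation PP := (tuple_prod mu).
Variables (eps M : R) (k p : U -> R).
Hypotheses (m0 : (0 < m)%N) (eps0 : 0 < eps) (bk : bounded_mfun k) (kM : forall x, `|k x| <= M).
Hypothesis pmin : energy_minimizer mu eps k p.

Let mp : measurable_fun setT p. Proof. by case: pmin => -[[]]. Qed.

(** Twice a bound on ln p + k / eps: the first part comes from [minimizer_bounds],
    the second one from [k]. *)
Definition potential_bound (n : nat) (e L : R) : R := 2 * (4 * n%:R + 1) * (L / e).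

(** The function ln p + k / eps minus its additive part has zero marginals, so
    [first_order_condition] makes it orthogonal to ln p + k / eps. It is also
    orthogonal to the additive part, hence to itself. The potentials are the main
    effects, which are defined and bounded everywhere. *)
Theorem schrodinger_potentials : exists f : 'I_m -> T -> R,
  [/\ forall j, bounded_mfun (f j), forall j a, `|f j a| <= potential_bound m eps M &
      {ae PP, forall x, p x = expR (\sum_(j < m) f j (tnth x j) - k x / eps)}].
Proof.
have M0 : 0 <= M by rewrite (le_trans (normr_ge0 _) (Rint_bound PP bk kM)).
have Me0 : 0 <= M / eps by rewrite divr_ge0// ltW.
pose B := m%:R * (4 * M / eps).
have B0 : 0 <= B by rewrite /B -mulrA mulr_ge0// mulr_ge0.
have KmE : expR (4 * M / eps) ^+ m = expR B by rewrite -expRM_natl.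
have bnd := minimizer_bounds m0 eps0 bk kM pmin.
rewrite KmE in bnd.
pose ell x := Num.max (- B) (Num.min (ln (p x)) B).
have ellB x : `|ell x| <= B.
  rewrite /ell ler_norml; apply/andP; split; first by rewrite le_max lexx.
  by rewrite ge_max ge_min lexx orbT andbT; lra.
have mln : measurable_fun setT (fun x => ln (p x)) by exact: measurableT_comp (@measurable_ln R) mp.
have bell : bounded_mfun ell.
  split; last by exists B.
  apply: measurable_maxr; first exact: measurable_cst.
  by apply: measurable_minr => //; exact: measurable_cst.
(* Only the points of [S] have the expected bounds; cutting off to this set of full
   measure makes the perturbation admissible everywhere. *)
pose S := [set x | (expR B)^-1 <= p x <= expR B].
have mS : measurable S.
  rewrite (_ : S = [set x | (expR B)^-1 <= p x] `&` [set x | p x <= expR B]); last first.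
    by apply/seteqP; split=> x; [move=> /andP[]|move=> [? ?]; apply/andP].
  apply: measurableI; rewrite -[X in measurable X]setTI;
    by apply: measurable_fun_le => //; exact: measurable_cst.
have ellE x : S x -> ln (p x) = ell x /\ p x = expR (ell x).
  move=> /andP[Bp pB].
  have px0 : 0 < p x by rewrite (lt_le_trans _ Bp)// invr_gt0 expR_gt0.
  have l1 : - B <= ln (p x) by rewrite -[- B]expRK ler_ln ?posrE ?expR_gt0// expRN.
  have l2 : ln (p x) <= B by rewrite -[B]expRK ler_ln ?posrE ?expR_gt0.
  have -> : ell x = ln (p x) by rewrite /ell min_l// max_r.
  by rewrite lnK ?posrE.
pose w x := ell x + k x / eps.
have bw : bounded_mfun w.
  by apply: bmfD => //; apply: bmfM => //; exact: bmf_cst.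
have wB x : `|w x| <= B + M / eps.
  rewrite (le_trans (ler_normD _ _))// lerD// normrM normfV (gtr0_norm eps0).
  by rewrite ler_wpM2r// invr_ge0 ltW.
have bf j := bmf_main_effect mu bw j.
have bA := bmf_additive_part mu bw.
have brem : bounded_mfun (fun x => w x - additive_part mu w x) by exact: bmfB.
have rem0 j (h : T -> R) : bounded_mfun h ->
    \int[PP]_x ((w x - additive_part mu w x) * h (tnth x j)) = 0.
  move=> bh; rewrite (cond_tnth mu j brem bh).
  under eq_Rintegral do rewrite (cond_remainder mu m0 bw) mul0r.
  exact: Rint_cst.
have bI : bounded_mfun (\1_S : U -> R) by exact: bmf_indic.
pose v x := \1_S x * (w x - additive_part mu w x).
have bv : bounded_mfun v by exact: bmfM.
have aeS : {ae PP, forall x, \1_S x = 1 :> R}.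
  by apply: filterS bnd => x Sx; rewrite indicE mem_set.
have vS x : v x != 0 -> (expR B)^-1 <= p x <= expR B.
  move=> vx; suff : S x by [].
  apply: contrapT => nS; move: vx; rewrite /v indicE memNset// mul0r eqxx//.
have v0 j A : measurable A -> \int[PP]_x (v x * \1_A (tnth x j)) = 0.
  move=> mA; have bIA := bmf_indic R mA.
  rewrite -(rem0 j _ bIA); apply: Rint_ae.
  - by case: (bmfM bv (bmf_tnth j bIA)).
  - by case: (bmfM brem (bmf_tnth j bIA)).
  - by apply: filterS aeS => x E; rewrite /v E mul1r.
have [bg g0] := first_order_condition m0 eps0 bk pmin bv
  (eq_ind_r (fun z => 0 < z) (expR_gt0 (- B)) (esym (expRN B))) vS v0.
have vw0 : \int[PP]_x (v x * w x) = 0.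
  have : eps * \int[PP]_x (v x * w x) = 0.
    rewrite -RintZ; last exact/bmf_rint/bmfM.
    rewrite -g0; apply: eq_Rintegral => x _.
    have [->|/vS Sx] := eqVneq (v x) 0; first by rewrite !mul0r mulr0.
    rewrite /w; have [-> _] := ellE x Sx; field; rewrite gt_eqF//.
  by move=> /eqP; rewrite mulf_eq0 gt_eqF//= => /eqP.
have rw0 : \int[PP]_x ((w x - additive_part mu w x) * w x) = 0.
  rewrite -vw0; apply: Rint_ae.
  - by case: (bmfM brem bw).
  - by case: (bmfM bv bw).
  - by apply: filterS aeS => x E; rewrite /v E mul1r.
have rA0 : \int[PP]_x ((w x - additive_part mu w x) * additive_part mu w x) = 0.
  under eq_Rintegral do rewrite mulr_sumr.
  rewrite Rint_sum; last by move=> j; apply: bmfM => //; exact: (bmf_tnth j (bf j)).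
  by apply: big1 => j _; exact: rem0.
have sq0 : \int[PP]_x ((w x - additive_part mu w x) ^+ 2) = 0.
  transitivity (\int[PP]_x ((w x - additive_part mu w x) * w x -
      (w x - additive_part mu w x) * additive_part mu w x)).
    by apply: eq_Rintegral => x _; ring.
  by rewrite RintB ?rw0 ?rA0 ?subrr//; exact/bmf_rint/bmfM.
have ae0 := Rint0_ae (bmf_rint PP (bmf_exp 2 brem)) (fun x => sqr_ge0 _) sq0.
exists (main_effect mu w); split => //.
- move=> j a; rewrite /main_effect.
  have E1 : `|cond_exp mu j w a| <= B + M / eps by apply: Rint_bound => //; exact: bmf_upd2.
  have E2 : `|\int[PP]_x w x| <= B + M / eps by exact: Rint_bound.
  have r1 : `|m.-1%:R / m%:R : R| <= 1.
    by rewrite ger0_norm ?divr_ge0// ler_pdivrMr ?ltr0n// mul1r ler_nat leq_pred.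
  have -> : potential_bound m eps M = (B + M / eps) + 1 * (B + M / eps).
    by rewrite /potential_bound /B; ring.
  by rewrite (le_trans (ler_normB _ _))// lerD// normrM ler_pM.
- apply: filterS2 ae0 bnd => x /eqP; rewrite expf_eq0 /= subr_eq0 => /eqP wA Sx.
  have [_ ->] := ellE x Sx; congr expR.
  by rewrite -[X in X - _]wA /w addrK.
Qed.

End population_structure.

(** * Relative entropy with respect to a Gibbs density *)

Section kl_pointwise.
Context (R : realType).
Implicit Types u v h : R.

Definition kl_integrand u v := xlnx u - u * ln v - u + v.

Lemma kl_upper u v : 0 <= u -> 0 < v -> kl_integrand u v <= (u - v) ^+ 2 / v.
Proof.
move=> u0 v0; have vN0 : v != 0 by rewrite gt_eqF.
have := @xlnx_quad R v (u - v) v0; rewrite addrCA subrr addr0 => /(_ u0).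
by rewrite /kl_integrand /xlnx; lra.
Qed.

(** Bound the integrand below by the square of [sqrt u - sqrt v] (Hellinger), factor
    [u - v] accordingly and apply the arithmetic-geometric inequality with weight
    [h]. *)
Lemma kl_lower u v h : 0 <= u -> 0 < v -> 0 < h ->
  `|u - v| <= kl_integrand u v / (2 * h) + h * (u + v).
Proof.
move=> u0 v0 h0.
pose s := Num.sqrt u; pose t := Num.sqrt v.
have s0 : 0 <= s by exact: sqrtr_ge0.
have t0 : 0 < t by rewrite sqrtr_gt0.
have uE : u = s ^+ 2 by rewrite sqr_sqrtr.
have vE : v = t ^+ 2 by rewrite sqr_sqrtr// ltW.
have hellinger : (s - t) ^+ 2 <= kl_integrand u v.
  rewrite /kl_integrand /xlnx; move: s0; rewrite le_eqVlt => /predU1P[s0|s0].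
    by rewrite uE -s0 vE; lra.
  have : ln (t / s) <= t / s - 1 by rewrite ln_le_sub1// divr_gt0.
  rewrite ln_div ?posrE// => H.
  have lu : ln u = ln s + ln s by rewrite uE lnXn// mulr2n.
  have lv : ln v = ln t + ln t by rewrite vE lnXn// mulr2n.
  have s2 : 0 <= s ^+ 2 by exact: sqr_ge0.
  have := ler_wpM2l s2 H.
  have -> : s ^+ 2 * (t / s - 1) = s * t - s ^+ 2 by field; rewrite gt_eqF.
  by rewrite lu lv uE vE; nra.
have suv : `|u - v| = `|s - t| * (s + t).
  by rewrite uE vE subr_sqr normrM [X in _ * X]ger0_norm// addr_ge0// ltW.
rewrite suv; apply: (@le_trans _ _ ((s - t) ^+ 2 / (2 * h) + h / 2 * (s + t) ^+ 2)).
  have n2 : `|s - t| ^+ 2 = (s - t) ^+ 2 by rewrite real_normK// num_real.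
  rewrite -n2; set x := `|s - t|; set y := s + t.
  have -> : x ^+ 2 / (2 * h) = (x / h) ^+ 2 * (h / 2) by field; rewrite gt_eqF.
  have xE : x = (x / h) * h by field; rewrite gt_eqF.
  rewrite [X in X * y <= _]xE; set z := x / h.
  rewrite -subr_ge0 (_ : _ - _ = (h / 2) * (z - y) ^+ 2); last by field.
  by rewrite mulr_ge0 ?sqr_ge0// divr_ge0// ltW.
apply: lerD; first by rewrite ler_wpM2r// invr_ge0 mulr_ge0// ltW.
rewrite -mulrA ler_wpM2l ?(ltW h0)// uE vE -subr_ge0.
rewrite (_ : _ - _ = 2^-1 * (s - t) ^+ 2); last by field.
by rewrite mulr_ge0 ?sqr_ge0// invr_ge0.
Qed.

End kl_pointwise.

Section finite_sums.
Context (R : realType).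

Lemma one_sub_prod_le (I : Type) (s : seq I) (g : I -> R) :
  (forall i, 0 <= g i <= 1) ->
  1 - \prod_(i <- s) g i <= \sum_(i <- s) (1 - g i).
Proof.
move=> g01; elim: s => [|i s IH]; first by rewrite !big_nil subrr.
rewrite !big_cons.
have P01 : 0 <= \prod_(j <- s) g j <= 1.
  rewrite prodr_ge0/=; last by move=> j _; case/andP: (g01 j).
  by apply: Num.Theory.prodr_ile1 => j _.
by case/andP: (g01 i) => ? ?; case/andP: P01 => ? ?; nra.
Qed.

Lemma sqr_sum_le n (d : 'I_n -> R) :
  (\sum_(j < n) d j) ^+ 2 <= n%:R * \sum_(j < n) d j ^+ 2.
Proof.
rewrite expr2 mulr_suml.
apply: (@le_trans _ _ (\sum_(i < n) \sum_(j < n) (d i ^+ 2 / 2 + d j ^+ 2 / 2))).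
  apply: ler_sum => i _; rewrite mulr_sumr; apply: ler_sum => j _.
  by rewrite -subr_ge0 (_ : _ - _ = (d i - d j) ^+ 2 / 2) ?divr_ge0 ?sqr_ge0//; field.
under eq_bigr do rewrite big_split/= sumr_const card_ord -mulr_suml.
rewrite big_split/= sumr_const card_ord; set S := \sum_(j < n) _ ^+ 2.
have -> : \sum_(i < n) (d i ^+ 2 / 2) *+ n = (S / 2) *+ n by rewrite sumrMnl -mulr_suml.
rewrite -mulrnDl -[leLHS]mulr_natl (_ : S / 2 + S / 2 = S)//.
by field.
Qed.

End finite_sums.

Lemma sqr_Rint_le d (U : measurableType d) (R : realType) (P : probability U R) (f : U -> R) :
  bounded_mfun f -> (\int[P]_x f x) ^+ 2 <= \int[P]_x (f x ^+ 2).
Proof.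
move=> bf; set c := \int[P]_x f x.
have := @Rint_ge0 _ _ _ P (fun x => (f x - c) ^+ 2) (fun x => sqr_ge0 _).
have -> : \int[P]_x ((f x - c) ^+ 2) = \int[P]_x (f x ^+ 2 - ((2 * c) * f x - c ^+ 2)).
  by apply: eq_Rintegral => x _; ring.
have b2 : bounded_mfun (fun x => f x ^+ 2) by exact: bmf_exp.
have bc : bounded_mfun (fun x => (2 * c) * f x) by exact: bmfZ.
have bcc : bounded_mfun (fun _ : U => c ^+ 2) by exact: bmf_cst.
rewrite RintB; [|exact: bmf_rint|exact/bmf_rint/bmfB].
rewrite RintB; [|exact: bmf_rint..].
rewrite Rint_cst RintZ; last exact: bmf_rint.
rewrite -/c; lra.
Qed.

Section coupling_stability.
Context (dT : measure_display) (T : measurableType dT) (R : realType).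
Context (m : nat) (mu : 'I_m -> probability T R).
Local Notation U := (m.-tuple T).
Local Notation PP := (tuple_prod mu).
Variables (eps b : R) (k : U -> R) (f : 'I_m -> T -> R).
Hypotheses (m0 : (0 < m)%N) (eps0 : 0 < eps) (bk : bounded_mfun k) (bf : forall j, bounded_mfun (f j)).

(** The density with potentials [f], at every point of the product space and not
    only almost everywhere. *)
Definition gibbs (x : U) : R := expR (\sum_(j < m) f j (tnth x j) - k x / eps).

Hypotheses (b1 : 1 <= b) (gb : forall x, b^-1 <= gibbs x <= b).

Let b0 : 0 < b. Proof. exact: lt_le_trans b1. Qed.
Let g0 x : 0 < gibbs x. Proof. exact: expR_gt0. Qed.

Lemma bmf_ln_gibbs : bounded_mfun (fun x => \sum_(j < m) f j (tnth x j) - k x / eps).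
Proof.
apply: bmfB; first by apply: bmf_sum => j; exact: bmf_tnth.
by apply: bmfM => //; exact: bmf_cst.
Qed.

Lemma bmf_gibbs : bounded_mfun gibbs.
Proof. exact: bmf_expR bmf_ln_gibbs. Qed.

(** Relative entropy of [q] with respect to [gibbs], with the linear terms that make
    the integrand nonnegative when [gibbs] does not have mass 1. *)
Definition kl_gibbs q := \int[PP]_x kl_integrand (q x) (gibbs x).

Lemma coupling_Rint_tnth q j (h : T -> R) : coupling_density mu q -> bounded_mfun h ->
  \int[PP]_x (q x * h (tnth x j)) = \int[mu j]_a h a.
Proof.
move=> [rq q0 uq xq] bh.
have [Q hQ] := exists_density rq q0 (coupling_density_mass m0 uq).
have /(density_couplings hQ) cQ := uq.
have lQ : law Q (fun x : U => tnth x j) (mu j).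
  by split; [exact: measurable_tnth|move=> A mA; rewrite -cQ].
rewrite (law_Rint lQ (bmf_rint _ bh)).
have E : (fun x : U => h (tnth x j) * q x) = (fun x => q x * h (tnth x j)).
  by apply/funext => x; rewrite mulrC.
rewrite (density_Rint hQ) ?E//; first by case: (bmf_tnth j bh).
by apply: rintM => //; exact: bmf_tnth.
Qed.

Lemma rint_kl_gibbs q : coupling_density mu q -> Rintegrable PP (fun x => kl_integrand (q x) (gibbs x)).
Proof.
move=> [rq q0 uq xq].
apply: rintD; last exact: bmf_rint bmf_gibbs.
apply: rintB => //; apply: rintB => //; apply: rintM => //.
rewrite (_ : (fun x => ln (gibbs x)) = (fun x => \sum_(j < m) f j (tnth x j) - k x / eps)).
  exact: bmf_ln_gibbs.
by apply/funext => x; rewrite /gibbs expRK.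
Qed.

(** The potentials contribute the sum of their integrals against the marginals,
    which is the same for all couplings. *)
Lemma energy_kl q : coupling_density mu q -> energy mu eps k q =
  eps * (kl_gibbs q + (\sum_(j < m) \int[mu j]_a f j a + 1 - \int[PP]_x gibbs x)).
Proof.
move=> cq; have [rq q0 uq xq] := cq.
have rqf j : Rintegrable PP (fun x => q x * f j (tnth x j)) by apply: rintM => //; exact: bmf_tnth.
have rqk : Rintegrable PP (fun x => q x * k x) by exact: rintM.
have rqs : Rintegrable PP (fun x => q x * \sum_(j < m) f j (tnth x j)).
  by apply: rintM => //; apply: bmf_sum => j; exact: bmf_tnth.
have Ls : \int[PP]_x (q x * \sum_(j < m) f j (tnth x j)) = \sum_(j < m) \int[mu j]_a f j a.
  have bs : bounded_mfun (fun x : U => \sum_(j < m) f j (tnth x j)).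
    by apply: bmf_sum => j; exact: bmf_tnth.
  have [Q hQ] := exists_density rq q0 (coupling_density_mass m0 uq).
  have EQ (h : U -> R) : bounded_mfun h -> \int[PP]_x (q x * h x) = \int[Q]_x h x.
    move=> bh; have E : (fun x : U => h x * q x) = (fun x => q x * h x).
      by apply/funext => x; rewrite mulrC.
    by rewrite (density_Rint hQ) ?E//; [case: bh|apply: rintM].
  rewrite EQ// Rint_sum; last by move=> j; exact: bmf_tnth.
  apply: eq_bigr => j _; rewrite -EQ; last exact: bmf_tnth.
  exact: coupling_Rint_tnth.
have -> : kl_gibbs q = \int[PP]_x (xlnx (q x) + (eps^-1 * (q x * k x) -
    (q x * \sum_(j < m) f j (tnth x j) + (q x - gibbs x)))).
  apply: eq_Rintegral => x _; rewrite /kl_integrand /gibbs expRK; field.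
  by rewrite gt_eqF.
have rqg : Rintegrable PP (fun x => q x - gibbs x) by apply: rintB => //; exact: bmf_rint bmf_gibbs.
rewrite RintD//; last by apply: rintB; [exact: rintZ|exact: rintD].
rewrite RintB; [|exact: rintZ|exact: rintD].
rewrite RintZ// RintD// RintB//; last exact: bmf_rint bmf_gibbs.
rewrite Ls (coupling_density_mass m0 uq) /energy; field.
by rewrite gt_eqF.
Qed.

Lemma minimizer_kl ph q : energy_minimizer mu eps k ph -> coupling_density mu q -> kl_gibbs ph <= kl_gibbs q.
Proof.
move=> [cp pmin] cq; have := pmin q cq; rewrite !energy_kl//.
by rewrite ler_pM2l// lerD2r.
Qed.

(** Any coupling [q] witnesses how close the minimizer is to the Gibbs density: its
    own entropy is at most the chi-square distance, by [kl_upper]. The parameter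
    [r] is to be chosen of the order of the distance of [q]. *)
Lemma minimizer_close ph q r : energy_minimizer mu eps k ph -> coupling_density mu q -> bounded_mfun q ->
  0 < r ->
  \int[PP]_x `|ph x - gibbs x| <=
    b * (\int[PP]_x ((q x - gibbs x) ^+ 2)) / (2 * r) + r * (1 + b).
Proof.
move=> pm cq bq r0; have [[rph ph0 uph xph] _] := pm.
have bg := bmf_gibbs.
have rk : Rintegrable PP (fun x => kl_integrand (ph x) (gibbs x)) by apply: rint_kl_gibbs; case: pm.
have rs : Rintegrable PP (fun x => ph x + gibbs x) by apply: rintD => //; exact: bmf_rint.
apply: (@le_trans _ _ (kl_gibbs ph / (2 * r) + r * \int[PP]_x (ph x + gibbs x))).
  rewrite -RintZ// mulrC -RintZ// -RintD; [|exact: rintZ|exact: rintZ].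
  apply: le_Rint.
  - by apply/rint_norm/rintB => //; exact: bmf_rint.
  - by apply: rintD; exact: rintZ.
  - by move=> x; rewrite [_^-1 * _]mulrC; exact: kl_lower.
apply: lerD.
  rewrite ler_wpM2r//; first by rewrite invr_ge0 mulr_ge0// ltW.
  rewrite (le_trans (minimizer_kl pm cq))//.
  have bd : bounded_mfun (fun x => (q x - gibbs x) ^+ 2) by apply: bmf_exp; exact: bmfB.
  rewrite -RintZ; last exact: bmf_rint.
  apply: le_Rint; [exact: rint_kl_gibbs|exact/bmf_rint/bmfZ|move=> x].
  have [_ q0 _ _] := cq.
  rewrite (le_trans (kl_upper (q0 x) (g0 x)))// mulrC ler_wpM2r ?sqr_ge0//.
  by have /andP[h _] := gb x; rewrite -[leRHS]invrK lef_pV2 ?posrE ?invr_gt0.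
rewrite ler_wpM2l ?(ltW r0)// RintD//; last exact: bmf_rint.
rewrite (coupling_density_mass m0 uph) lerD2l -[leRHS](Rint_cst PP).
apply: le_Rint; [exact: bmf_rint|exact/bmf_rint/bmf_cst|by move=> x; case/andP: (gb x)].
Qed.

End coupling_stability.

(** * Stability under a perturbation of the marginals *)

Section repair.
Context (dT : measure_display) (T : measurableType dT) (R : realType).
Context (m : nat) (mu : 'I_m -> probability T R).
Local Notation U := (m.-tuple T).
Local Notation PP := (tuple_prod mu).
Variables (g : U -> R) (b : R).
Hypotheses (m0 : (0 < m)%N) (bg : bounded_mfun g) (b1 : 1 <= b) (gb : forall x, b^-1 <= g x <= b).

Let b0 : 0 < b. Proof. exact: lt_le_trans b1. Qed.
Let g0 x : 0 < g x.
Proof. by case/andP: (gb x) => h _; rewrite (lt_le_trans _ h)// invr_gt0. Qed.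

Local Notation h := (fun j => cond_exp mu j g).
Let bh j : bounded_mfun (h j). Proof. exact: bmf_cond. Qed.

Lemma cond_between j a : b^-1 <= h j a <= b.
Proof.
have bu := bmf_upd2 j a bg.
rewrite -[X in X <= _ <= _](Rint_cst PP) -[X in _ <= _ <= X](Rint_cst PP).
by apply/andP; split; apply: le_Rint => [||x]; (try exact/bmf_rint/bmf_cst);
  (try exact: bmf_rint); case/andP: (gb (upd j x a)).
Qed.

Definition excess j a : R := `|h j a - 1|.
(** Dividing by the marginal density only where it exceeds 1 makes all marginals at
    most 1, and keeps [g] bounded away from zero. *)
Definition shrink j a : R := (Num.max 1 (h j a))^-1.

Lemma bmf_excess j : bounded_mfun (excess j).
Proof. by apply: bmf_norm; apply: bmfB => //; exact: bmf_cst. Qed.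

Lemma shrink_bounds j a : [/\ b^-1 <= shrink j a, shrink j a <= 1,
  shrink j a * h j a <= 1 & 1 - shrink j a <= excess j a].
Proof.
have /andP[ha hb] := cond_between j a.
have h0 : 0 < h j a by rewrite (lt_le_trans _ ha)// invr_gt0.
have M1 : 1 <= Num.max 1 (h j a) by rewrite le_max lexx.
have M0 : 0 < Num.max 1 (h j a) by exact: lt_le_trans M1.
rewrite /shrink /excess; split.
- by rewrite lef_pV2 ?posrE// ge_max b1.
- by rewrite invf_le1.
- by rewrite mulrC ler_pdivrMr// mul1r le_max lexx orbT.
- case: (leP 1 (h j a)) => [h1|h1]; last by rewrite invr1 subrr.
  rewrite ger0_norm ?subr_ge0// -subr_ge0.
  rewrite (_ : _ - _ = (h j a - 1) ^+ 2 / h j a); last by field; rewrite gt_eqF.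
  by rewrite divr_ge0 ?sqr_ge0// ltW.
Qed.

Lemma bmf_shrink j : bounded_mfun (shrink j).
Proof.
split; last first.
  exists 1 => a; have [s1 s2 _ _] := shrink_bounds j a.
  by rewrite ger0_norm// (le_trans _ s1)// invr_ge0 ltW.
rewrite (_ : shrink j = fun a => (Num.max 1 (h j a)) `^ (-1)).
  apply: (measurableT_comp (@measurable_powR R _)); apply: measurable_maxr; first exact: measurable_cst.
  by case: (bh j).
apply/funext => a; rewrite powR_inv1// le_max ler01//.
Qed.

Definition shrunk (x : U) : R := g x * \prod_(j < m) shrink j (tnth x j).
Definition deficit j a : R := 1 - cond_exp mu j shrunk a.
Definition mass_deficit : R := 1 - \int[PP]_x shrunk x.
(** The missing marginal mass is added back by the additive terms; the constant
    corrects for the mass that each of them adds to the other marginals. The result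
    may be negative only through this constant. *)
Definition repaired (x : U) : R :=
  shrunk x + (\sum_(j < m) deficit j (tnth x j) - m.-1%:R * mass_deficit).

Lemma bmf_shrunk : bounded_mfun shrunk.
Proof. by apply: bmfM => //; apply: bmf_prod => j; exact: (bmf_tnth j (bmf_shrink j)). Qed.

Lemma bmf_deficit j : bounded_mfun (deficit j).
Proof. by apply: bmfB; [exact: bmf_cst|exact: bmf_cond bmf_shrunk]. Qed.

Lemma bmf_repaired : bounded_mfun repaired.
Proof.
apply: bmfD; first exact: bmf_shrunk.
apply: bmfB; last exact: bmf_cst.
by apply: bmf_sum => j; exact: (bmf_tnth j (bmf_deficit j)).
Qed.

Let sh01 j a : 0 <= shrink j a <= 1.
Proof.
have [s1 s2 _ _] := shrink_bounds j a; rewrite s2 andbT (le_trans _ s1)//.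
by rewrite invr_ge0 ltW.
Qed.

Lemma prod_shrink_le (x : U) j : \prod_(i < m) shrink i (tnth x i) <= shrink j (tnth x j).
Proof.
rewrite (bigD1 j)//= ler_piMr//; first by case/andP: (sh01 j (tnth x j)).
by apply: Num.Theory.prodr_ile1.
Qed.

Lemma shrunk_ge x : b ^- m.+1 <= shrunk x.
Proof.
rewrite /shrunk -exprVn exprS ler_pM//; first by rewrite invr_ge0 ltW.
- by rewrite exprn_ge0// invr_ge0 ltW.
- by case/andP: (gb x).
rewrite -[X in _ ^+ X](card_ord m) -prodr_const; apply: ler_prod => j _.
by have [s1 _ _ _] := shrink_bounds j (tnth x j); rewrite s1 andbT invr_ge0 ltW.
Qed.

(** The other factors of the product are at most 1, and the [j]-th one brings the
    [j]-th marginal down to at most 1. *)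
Lemma deficit_ge0 j a : 0 <= deficit j a.
Proof.
have [_ _ s3 _] := shrink_bounds j a.
rewrite /deficit subr_ge0 (le_trans _ s3)//.
rewrite -RintZ; last exact/bmf_rint/(bmf_upd2 j a bg).
apply: le_Rint; [exact/bmf_rint/(bmf_upd2 j a bmf_shrunk)|exact/bmf_rint/bmfZ/(bmf_upd2 j a bg)|].
move=> x; rewrite /shrunk mulrC ler_wpM2r ?(ltW (g0 _))//.
by have := prod_shrink_le (upd j x a) j; rewrite tnth_updE.
Qed.

Lemma Rint_deficit j : \int[mu j]_a deficit j a = mass_deficit.
Proof.
rewrite RintB; [|exact/bmf_rint/bmf_cst|exact/bmf_rint/bmf_cond/bmf_shrunk].
by rewrite Rint_cst -(Rint_cond mu j bmf_shrunk).
Qed.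

Lemma mass_deficit_ge0 : 0 <= mass_deficit.
Proof. by rewrite -(Rint_deficit (Ordinal m0)); apply: Rint_ge0 => a; exact: deficit_ge0. Qed.

Lemma repaired_marginals : unit_marginals mu repaired.
Proof.
move=> i A mA; have bA := bmf_indic R mA.
rewrite (cond_tnth mu i bmf_repaired bA); apply: eq_Rintegral => a _.
suff -> : cond_exp mu i repaired a = 1 by rewrite mul1r.
have bd j : bounded_mfun (fun x : U => deficit j (tnth x j)) by exact: (bmf_tnth j (bmf_deficit j)).
have bds : bounded_mfun (fun x : U => \sum_(j < m) deficit j (tnth x j)) by exact: bmf_sum.
have bc : bounded_mfun (fun _ : U => m.-1%:R * mass_deficit) by exact: bmf_cst.
rewrite /cond_exp RintD; [|exact/bmf_rint/(bmf_upd2 i a bmf_shrunk)|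
  exact/bmf_rint/(bmf_upd2 i a (bmfB bds bc))].
rewrite RintB; [|exact/bmf_rint/(bmf_upd2 i a bds)|exact/bmf_rint/bmf_cst].
rewrite Rint_cst Rint_sum; last by move=> j; exact: (bmf_upd2 i a (bd j)).
rewrite (bigD1 i)//=.
rewrite (_ : \int[PP]_x deficit i (tnth (upd i x a) i) = deficit i a); last first.
  by under eq_Rintegral do rewrite tnth_updE; rewrite Rint_cst.
have E j : j != i -> \int[PP]_x deficit j (tnth (upd i x a) j) = mass_deficit.
  move=> ji; under eq_Rintegral do rewrite tnth_upd (negbTE ji).
  by rewrite (@Rint_tnth _ _ _ _ mu j _ (bmf_rint _ (bmf_deficit j))) Rint_deficit.
rewrite (eq_bigr _ E) sumr_const cardC1 card_ord.
by rewrite -/(cond_exp mu i shrunk a) /deficit -[mass_deficit *+ _]mulr_natl; ring.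
Qed.

Variable r : R.
Hypotheses (r0 : 0 < r) (hr : forall j, \int[mu j]_a ((h j a - 1) ^+ 2) <= r ^+ 2).

Let bex j := bmf_excess j.

Lemma excess_ge0 j a : 0 <= excess j a. Proof. exact: normr_ge0. Qed.

Lemma Rint_excess2 j : \int[mu j]_a (excess j a ^+ 2) <= r ^+ 2.
Proof.
apply: le_trans (hr j); rewrite le_eqVlt; apply/orP; left; apply/eqP.
by apply: eq_Rintegral => a _; rewrite /excess real_normK// num_real.
Qed.

Lemma Rint_excess j : 0 <= \int[mu j]_a excess j a <= r.
Proof.
have e0 : 0 <= \int[mu j]_a excess j a by apply: Rint_ge0 => a; exact: excess_ge0.
rewrite e0/= -ler_sqr ?nnegrE// ?(ltW r0)//.
exact: le_trans (sqr_Rint_le _ (bex j)) (Rint_excess2 j).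
Qed.

Definition total_excess : R := \sum_(j < m) \int[mu j]_a excess j a.
Local Notation Delta := total_excess.

Lemma total_excess_bounds : 0 <= Delta <= m%:R * r.
Proof.
rewrite /total_excess sumr_ge0/=; last by move=> j _; case/andP: (Rint_excess j).
rewrite mulr_natl -[X in _ *+ X](card_ord m) -sumr_const; apply: ler_sum => j _.
by case/andP: (Rint_excess j).
Qed.

Lemma shrunk_close x : 0 <= g x - shrunk x <= b * \sum_(j < m) excess j (tnth x j).
Proof.
have E : g x - shrunk x = g x * (1 - \prod_(j < m) shrink j (tnth x j)).
  by rewrite /shrunk; ring.
have p1 : 0 <= 1 - \prod_(j < m) shrink j (tnth x j).
  by rewrite subr_ge0; exact: Num.Theory.prodr_ile1.
rewrite E mulr_ge0 ?(ltW (g0 x))//=; apply: ler_pM => //; [exact: ltW|by case/andP: (gb x)|].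
apply: (le_trans (one_sub_prod_le _ (fun j => sh01 j (tnth x j)))).
by apply: ler_sum => j _; have [_ _ _ ->] := shrink_bounds j (tnth x j).
Qed.

Lemma deficit_le j a : deficit j a <= (1 + b) * (excess j a + Delta).
Proof.
have bsum : bounded_mfun (fun x : U => b * \sum_(i < m) excess i (tnth x i)).
  by apply: bmfZ; apply: bmf_sum => i; exact: (bmf_tnth i (bex i)).
have c1 : cond_exp mu j (fun x => g x - shrunk x) a <= b * (excess j a + Delta).
  apply: (@le_trans _ _ (\int[PP]_x (b * \sum_(i < m) excess i (tnth (upd j x a) i)))).
    apply: le_Rint; [exact/bmf_rint/(bmf_upd2 j a (bmfB bg bmf_shrunk))|
      exact/bmf_rint/(bmf_upd2 j a bsum)|].
    by move=> x; case/andP: (shrunk_close (upd j x a)).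
  have be i : bounded_mfun (fun x => excess i (tnth (upd j x a) i)).
    exact: (bmf_upd2 j a (bmf_tnth i (bex i))).
  rewrite RintZ; last by apply: bmf_rint; apply: bmf_sum => i; exact: be.
  rewrite ler_wpM2l ?(ltW b0)// Rint_sum// (bigD1 j)//= lerD//.
    by under eq_Rintegral do rewrite tnth_updE; rewrite Rint_cst.
  rewrite /total_excess [leRHS](bigD1 j)//= -[leLHS]add0r lerD//.
    by case/andP: (Rint_excess j).
  apply: ler_sum => i ij.
  rewrite (_ : \int[PP]_x _ = \int[PP]_x excess i (tnth x i)); last first.
    by apply: eq_Rintegral => x _; rewrite tnth_upd (negbTE ij).
  by rewrite (@Rint_tnth _ _ _ _ mu i _ (bmf_rint _ (bex i))).
have c2 : cond_exp mu j (fun x => g x - shrunk x) a = h j a - cond_exp mu j shrunk a.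
  by rewrite /cond_exp RintB; [|exact/bmf_rint/(bmf_upd2 j a bg)|exact/bmf_rint/(bmf_upd2 j a bmf_shrunk)].
have c3 : 1 - h j a <= excess j a by rewrite /excess distrC; exact: ler_norm.
have /andP[D0 _] := total_excess_bounds.
move: c1; rewrite c2 /deficit; lra.
Qed.

Lemma mass_deficit_le : mass_deficit <= (1 + b) * (2 * Delta).
Proof.
pose j := Ordinal m0.
have bcst : bounded_mfun (fun _ : T => Delta) by exact: bmf_cst.
rewrite -(Rint_deficit j).
apply: (@le_trans _ _ (\int[mu j]_a ((1 + b) * (excess j a + Delta)))).
  apply: le_Rint; [exact/bmf_rint/bmf_deficit|exact/bmf_rint/bmfZ/bmfD|].
  by move=> a; exact: deficit_le.
rewrite RintZ; last exact/bmf_rint/bmfD.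
rewrite RintD ?Rint_cst; [|exact: bmf_rint..].
have : \int[mu j]_a excess j a <= Delta.
  rewrite /total_excess (bigD1 j)//= lerDl; apply: sumr_ge0 => i _.
  by case/andP: (Rint_excess i).
move=> h; apply: ler_wpM2l; first by rewrite addr_ge0 ?(ltW b0).
by rewrite (_ : 2 * Delta = Delta + Delta) ?lerD2r//; ring.
Qed.

Let B : R := 3 * m%:R * (1 + b).

(** Every term of the correction is bounded by the marginal excesses at the point
    and their mean: shrinking by [shrunk_close], adding back by [deficit_le], and
    the constant by [mass_deficit_le]. *)
Lemma repaired_close x : `|repaired x - g x| <= B * (\sum_(j < m) excess j (tnth x j) + Delta).
Proof.
have /andP[D0 _] := total_excess_bounds.
set S := \sum_(j < m) _.
have S0 : 0 <= S by apply: sumr_ge0 => j _; exact: excess_ge0.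
have /andP[s1 s2] := shrunk_close x.
have d1 : 0 <= \sum_(j < m) deficit j (tnth x j) by apply: sumr_ge0 => j _; exact: deficit_ge0.
have d2 : \sum_(j < m) deficit j (tnth x j) <= (1 + b) * (S + m%:R * Delta).
  apply: (@le_trans _ _ (\sum_(j < m) (1 + b) * (excess j (tnth x j) + Delta))).
    by apply: ler_sum => j _; exact: deficit_le.
  by rewrite -mulr_sumr big_split/= sumr_const card_ord mulr_natl.
have e0 := mass_deficit_ge0; have e1 := mass_deficit_le.
have mE : m.-1%:R = m%:R - 1 :> R by rewrite -[in RHS](prednK m0) -natr1 addrK.
have m1 : 1 <= m%:R :> R by rewrite ler1n.
have e2 : 0 <= (m%:R - 1) * mass_deficit by rewrite mulr_ge0// subr_ge0.
have e3 : (m%:R - 1) * mass_deficit <= (m%:R - 1) * ((1 + b) * (2 * Delta)).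
  by rewrite ler_wpM2l// subr_ge0.
have bD : 0 <= b * Delta by rewrite mulr_ge0// ltW.
have bS : 0 <= b * S by rewrite mulr_ge0// ltW.
have q1 : 0 <= (m%:R - 1) * S by rewrite mulr_ge0// subr_ge0.
have q2 : 0 <= (m%:R - 1) * Delta by rewrite mulr_ge0// subr_ge0.
have q3 : 0 <= (m%:R - 1) * (b * S) by rewrite mulr_ge0// subr_ge0.
have q4 : 0 <= (m%:R - 1) * (b * Delta) by rewrite mulr_ge0// subr_ge0.
rewrite -/S in s2; rewrite /repaired mE /B.
move: D0 d1 d2 e0 e1 e2 e3 bD q2 q4 s1 s2; clear -S0 m1 bS q1 q3; clearbody S.
move: Delta mass_deficit (shrunk x) (\sum_(j < m) deficit j (tnth x j)) => D dl sh ds.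
by move=> *; rewrite ler_norml; apply/andP; split; lra.
Qed.

Lemma Rint_repaired_close :
  \int[PP]_x ((repaired x - g x) ^+ 2) <= B ^+ 2 * (4 * m%:R ^+ 2 * r ^+ 2).
Proof.
have /andP[D0 D1] := total_excess_bounds.
have B0 : 0 <= B by rewrite /B mulr_ge0 ?mulr_ge0// addr_ge0// ltW.
have be j : bounded_mfun (fun x : U => excess j (tnth x j) ^+ 2).
  by apply: bmf_exp; exact: (bmf_tnth j (bex j)).
pose F (x : U) := 2 * (m%:R * \sum_(j < m) excess j (tnth x j) ^+ 2) + 2 * Delta ^+ 2.
have bs : bounded_mfun (fun x : U => \sum_(j < m) excess j (tnth x j) ^+ 2) by exact: bmf_sum.
have bms : bounded_mfun (fun x : U => 2 * (m%:R * \sum_(j < m) excess j (tnth x j) ^+ 2)) by do 2 apply: bmfZ.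
have bF : bounded_mfun F by apply: bmfD => //; exact: bmf_cst.
apply: (@le_trans _ _ (\int[PP]_x (B ^+ 2 * F x))).
  apply: le_Rint; [|exact/bmf_rint/bmfZ|].
    by apply/bmf_rint/bmf_exp/bmfB => //; exact: bmf_repaired.
  move=> x; rewrite -(real_normK (num_real (repaired x - g x))).
  apply: (@le_trans _ _ ((B * (\sum_(j < m) excess j (tnth x j) + Delta)) ^+ 2)).
    rewrite ler_sqr ?nnegrE//; first exact: repaired_close.
    by rewrite mulr_ge0// addr_ge0// sumr_ge0// => j _; exact: excess_ge0.
  rewrite exprMn ler_wpM2l ?sqr_ge0// /F.
  have := @sqr_sum_le R m (fun j => excess j (tnth x j)).
  set S := \sum_(j < m) excess _ _; have := sqr_ge0 (S - Delta); nra.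
rewrite RintZ; last exact: bmf_rint.
rewrite ler_wpM2l ?sqr_ge0// /F RintD; [|exact: bmf_rint|exact/bmf_rint/bmf_cst].
rewrite Rint_cst RintZ; last exact/bmf_rint/bmfZ.
rewrite RintZ; last exact: bmf_rint.
rewrite Rint_sum//.
have h1 : \sum_(j < m) \int[PP]_x (excess j (tnth x j) ^+ 2) <= m%:R * r ^+ 2.
  rewrite mulr_natl -[X in _ *+ X](card_ord m) -sumr_const; apply: ler_sum => j _.
  rewrite (@Rint_tnth _ _ _ _ mu j (fun a => excess j a ^+ 2)); last exact/bmf_rint/bmf_exp.
  exact: Rint_excess2.
have h2 : Delta ^+ 2 <= (m%:R * r) ^+ 2.
  by rewrite ler_sqr ?nnegrE// mulr_ge0// ltW.
have m00 : 0 <= m%:R :> R by [].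
have := ler_wpM2l m00 h1; rewrite exprMn in h2 => h3.
have -> : 4 * m%:R ^+ 2 * r ^+ 2 = 2 * (m%:R * (m%:R * r ^+ 2)) + 2 * (m%:R ^+ 2 * r ^+ 2) by ring.
lra.
Qed.

(** The smallness condition keeps the constant correction below the lower bound
    [shrunk_ge] of the shrunk density. *)
Lemma repaired_coupling : m%:R * mass_deficit <= b ^- m.+1 -> coupling_density mu repaired.
Proof.
move=> small.
have q0 x : 0 <= repaired x.
  have := shrunk_ge x; have : 0 <= \sum_(j < m) deficit j (tnth x j).
    by apply: sumr_ge0 => j _; exact: deficit_ge0.
  have mE : m.-1%:R = m%:R - 1 :> R by rewrite -[in RHS](prednK m0) -natr1 addrK.
  by have := mass_deficit_ge0; rewrite /repaired mE; lra.
have bq := bmf_repaired.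
split => //; [exact: bmf_rint|exact: repaired_marginals|].
apply: bmf_rint; split; first by apply: measurable_xlnx; case: bq.
have [_ [M qM]] := bq; exists (1 + M ^+ 2) => x.
have := qM x; rewrite ger0_norm// => qMx.
have h1 := xlnx_ge (q0 x).
have h2 : xlnx (repaired x) <= repaired x ^+ 2.
  have := q0 x; rewrite le_eqVlt => /predU1P[<-|qp]; first by rewrite xlnx0 expr0n.
  rewrite /xlnx expr2 ler_wpM2l// (le_trans (ln_le_sub1 qp))//; lra.
have h3 : repaired x ^+ 2 <= M ^+ 2 by rewrite ler_sqr ?nnegrE// (le_trans (q0 x) qMx).
have := q0 x; have := sqr_ge0 M; rewrite ler_norml => ? ?; apply/andP; split; lra.
Qed.

End repair.

Section stability_theorem.
Context (dT : measure_display) (T : measurableType dT) (R : realType).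
Context (m : nat) (mu : 'I_m -> probability T R).
Local Notation U := (m.-tuple T).
Local Notation PP := (tuple_prod mu).
Variables (eps b : R) (k : U -> R) (f : 'I_m -> T -> R).
Hypotheses (m0 : (0 < m)%N) (eps0 : 0 < eps) (bk : bounded_mfun k) (bf : forall j, bounded_mfun (f j)).
Hypotheses (b1 : 1 <= b) (gb : forall x, b^-1 <= gibbs eps k f x <= b).

(** The first term serves when the repaired density may be negative, the second one
    when it is a coupling. *)
Definition stability_const (n : nat) (c : R) : R :=
  2 * n%:R ^+ 2 * (1 + c) ^+ 2 * c ^+ n.+1 +
  (c * ((3 * n%:R * (1 + c)) ^+ 2 * (4 * n%:R ^+ 2)) / 2 + (1 + c)).

(** If the mass deficit is small, the repaired density is a coupling at chi-square
    distance O([r ^+ 2]) and [minimizer_close] applies. Otherwise [r] is bounded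
    below, and the trivial bound [1 + b] is already of order [r]. *)
Theorem coupling_stability ph r : energy_minimizer mu eps k ph -> 0 < r ->
  (forall j, \int[mu j]_a ((cond_exp mu j (gibbs eps k f) a - 1) ^+ 2) <= r ^+ 2) ->
  \int[PP]_x `|ph x - gibbs eps k f x| <= stability_const m b * r.
Proof.
move=> pm r0 hr; have b0 : 0 < b by exact: lt_le_trans b1.
have bg : bounded_mfun (gibbs eps k f) by exact: bmf_gibbs.
have [[rph ph0 uph xph] _] := pm.
have t1 : 0 <= 2 * m%:R ^+ 2 * (1 + b) ^+ 2 * b ^+ m.+1.
  by rewrite mulr_ge0 ?exprn_ge0 ?(ltW b0)// mulr_ge0 ?sqr_ge0// mulr_ge0 ?sqr_ge0.
have t2 : 0 <= b * ((3 * m%:R * (1 + b)) ^+ 2 * (4 * m%:R ^+ 2)) / 2.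
  by rewrite divr_ge0// mulr_ge0 ?(ltW b0)// mulr_ge0 ?sqr_ge0// mulr_ge0 ?sqr_ge0.
have [small|large] := leP (m%:R * mass_deficit mu (gibbs eps k f)) (b ^- m.+1).
  have cq := repaired_coupling m0 bg b1 gb small.
  apply: (le_trans (minimizer_close m0 eps0 bk bf b1 gb pm cq (bmf_repaired mu bg b1 gb) r0)).
  have := Rint_repaired_close m0 bg b1 gb r0 hr; set I := \int[PP]_x _ => HI.
  have -> : stability_const m b * r = 2 * m%:R ^+ 2 * (1 + b) ^+ 2 * b ^+ m.+1 * r +
     (b * ((3 * m%:R * (1 + b)) ^+ 2 * (4 * m%:R ^+ 2 * r ^+ 2)) / (2 * r) + r * (1 + b)).
    by rewrite /stability_const; field; rewrite gt_eqF.
  rewrite -[leLHS]add0r lerD//; first by rewrite mulr_ge0// ltW.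
  rewrite lerD2r ler_wpM2r//; first by rewrite invr_ge0 mulr_ge0// ltW.
  by rewrite ler_wpM2l// ltW.
have triv : \int[PP]_x `|ph x - gibbs eps k f x| <= 1 + b.
  rewrite -(coupling_density_mass m0 uph) -[b in leRHS](Rint_cst PP).
  have rb : Rintegrable PP (fun=> b) by exact/bmf_rint/bmf_cst.
  rewrite -RintD//; apply: le_Rint; [|exact: rintD|].
    by apply/rint_norm/rintB => //; exact: bmf_rint.
  move=> x; rewrite (le_trans (ler_normB _ _))// ger0_norm// lerD2l.
  by case/andP: (gb x) => _ gxb; rewrite ger0_norm// expR_ge0.
apply: (le_trans triv).
have := mass_deficit_le m0 bg b1 gb r0 hr.
have /andP[_ D1] := total_excess_bounds bg r0 hr.
move: D1; set Dl := total_excess _ _ => D1 md.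
have bm0 : 0 < b ^+ m.+1 by rewrite exprn_gt0.
have c1 : b ^- m.+1 <= 2 * m%:R ^+ 2 * (1 + b) * r.
  rewrite (le_trans (ltW large))//.
  have -> : 2 * m%:R ^+ 2 * (1 + b) * r = m%:R * ((1 + b) * (2 * (m%:R * r))) by ring.
  by rewrite ler_wpM2l// (le_trans md)// ler_wpM2l ?addr_ge0 ?(ltW b0)// ler_wpM2l.
have c2 : 1 + b <= 2 * m%:R ^+ 2 * (1 + b) ^+ 2 * b ^+ m.+1 * r.
  have h : 0 <= (1 + b) * b ^+ m.+1 by rewrite mulr_ge0 ?addr_ge0 ?(ltW b0)// ltW.
  have := ler_wpM2l h c1.
  have -> : (1 + b) * b ^+ m.+1 * b ^- m.+1 = 1 + b by rewrite mulfK// gt_eqF.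
  move=> /le_trans; apply; rewrite le_eqVlt; apply/orP; left; apply/eqP; ring.
rewrite (le_trans c2)// ler_wpM2r ?(ltW r0)// /stability_const lerDl.
by apply: addr_ge0 => //; rewrite addr_ge0// (ltW b0).
Qed.

End stability_theorem.

(** * Exponential moments and power moments *)

Section mgf.
Context (R : realType).

(** The linear term disappears on integrating a centered variable, which yields
    [hoeffding_mgf] without any convexity. *)
Lemma expR_le_sub_gaussian (x : R) : expR x <= x + expR (2 * x ^+ 2).
Proof.
have [x1|x1] := leP x 1; last first.
  rewrite -[leLHS]add0r lerD//; first by rewrite (le_trans ler01)// ltW.
  rewrite ler_expR expr2; nra.
apply: (@le_trans _ _ (x + (1 + 2 * x ^+ 2))); last by rewrite lerD2l expR_ge1Dx.
(* Squaring [1 - x / 2 <= expR (- (x / 2))] bounds [expR x] above, with enough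
   room for the quadratic term [2 * x ^+ 2] as long as [x <= 1]. *)
have h : (1 - x / 2) ^+ 2 <= expR (- x).
  rewrite (_ : - x = - (x / 2) + - (x / 2)); last by field.
  rewrite expRD -expr2 ler_sqr ?nnegrE ?expR_ge0//; last by lra.
  exact: expR_ge1Dx.
have h0 : 0 <= x + (1 + 2 * x ^+ 2) by nra.
have := ler_wpM2l h0 h => h1.
have h2 : 1 <= (x + (1 + 2 * x ^+ 2)) * (1 - x / 2) ^+ 2.
  rewrite -subr_ge0.
  have -> : (x + (1 + 2 * x ^+ 2)) * (1 - x / 2) ^+ 2 - 1 =
    x ^+ 2 * ((1 - x) * (5 / 2 - x) / 2) by field.
  by rewrite mulr_ge0 ?sqr_ge0// divr_ge0// mulr_ge0//; lra.
have := le_trans h2 h1; rewrite expRN ler_pdivlMr ?expR_gt0// mul1r.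
by [].
Qed.

Lemma hoeffding_mgf d (U : measurableType d) (P : probability U R) (X : U -> R) (c : R) :
  bounded_mfun X -> (forall x, `|X x| <= c) -> \int[P]_x X x = 0 ->
  \int[P]_x expR (X x) <= expR (2 * c ^+ 2).
Proof.
move=> bX Xc X0.
have b2 : bounded_mfun (fun x => expR (2 * X x ^+ 2)) by apply/bmf_expR/bmfZ/bmf_exp.
apply: (@le_trans _ _ (\int[P]_x (X x + expR (2 * X x ^+ 2)))).
  apply: le_Rint; [exact/bmf_rint/bmf_expR|exact/bmf_rint/bmfD|].
  by move=> x; exact: expR_le_sub_gaussian.
rewrite RintD; [|exact: bmf_rint..].
rewrite X0 add0r -[leRHS](Rint_cst P); apply: le_Rint; [exact: bmf_rint|exact/bmf_rint/bmf_cst|].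
move=> x; rewrite ler_expR ler_wpM2l// -(real_normK (num_real (X x))).
by rewrite ler_sqr ?nnegrE// (le_trans _ (Xc x)).
Qed.

End mgf.

Section mcdiarmid.
Context (dT : measure_display) (T : measurableType dT) (R : realType).

Lemma law_cons n (mu : 'I_n.+1 -> probability T R) :
  law (mu ord0 \x tuple_prod (mu \o lift ord0))%E (@pair_cons _ T n) (tuple_prod mu).
Proof. by split => //; exact: measurable_pair_cons. Qed.

Lemma upd_cons_lift n (j : 'I_n) (a b : T) (s : n.-tuple T) :
  upd (lift ord0 j) (pair_cons (a, s)) b = pair_cons (a, upd j s b).
Proof.
apply: eq_from_tnth => i; rewrite tnth_upd /pair_cons.
case: (unliftP ord0 i) => [i' ->|->//].
by rewrite !tnthS tnth_upd (inj_eq lift_inj).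
Qed.

Lemma upd_cons0 n (a b : T) (s : n.-tuple T) :
  upd ord0 (pair_cons (a, s)) b = pair_cons (b, s).
Proof.
apply: eq_from_tnth => i; rewrite tnth_upd /pair_cons.
case: (unliftP ord0 i) => [i' ->|->//].
by rewrite !tnthS.
Qed.

(** Condition on the first coordinate: given it, the fluctuation is controlled by
    induction, and the conditional mean is itself a function of one variable of
    oscillation at most [c ord0]. *)
Theorem mcdiarmid_mgf n (mu : 'I_n -> probability T R) (F : n.-tuple T -> R) (c : 'I_n -> R) :
  bounded_mfun F -> (forall j x a, `|F (upd j x a) - F x| <= c j) ->
  \int[tuple_prod mu]_x expR (F x - \int[tuple_prod mu]_y F y) <=
  expR (2 * \sum_(j < n) c j ^+ 2).
Proof.
elim: n => [|n IH] in mu F c * => bF Fc.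
  have E x : F x = F [tuple] by rewrite (tuple0 x).
  under eq_Rintegral do rewrite E.
  rewrite Rint_cst big_ord0 mulr0.
  rewrite (_ : \int[_]_y F y = F [tuple]) ?subrr//.
  by under eq_Rintegral do rewrite E; rewrite Rint_cst.
set PP' := tuple_prod (mu \o lift ord0).
have bFp : bounded_mfun (fun z : T * n.-tuple T => F (pair_cons z)).
  by apply: bmf_comp bF; exact: measurable_pair_cons.
pose G a := \int[PP']_s F (pair_cons (a, s)).
have bG : bounded_mfun G by exact: (bmf_fubini1 (mu ord0) PP' bFp).
have IF : \int[tuple_prod mu]_y F y = \int[mu ord0]_a G a.
  by rewrite (law_Rint (law_cons mu) (bmf_rint _ bF)) Rint_prod1.
rewrite IF; set EG := \int[mu ord0]_a G a.
have bE : bounded_mfun (fun x => expR (F x - EG)) by apply/bmf_expR/bmfB => //; exact: bmf_cst.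
have bEp : bounded_mfun (fun z : T * n.-tuple T => expR (F (pair_cons z) - EG)).
  by apply/bmf_expR/bmfB => //; exact: bmf_cst.
rewrite (law_Rint (law_cons mu) (bmf_rint _ bE)) Rint_prod1//.
have bGE : bounded_mfun (fun a => G a - EG) by apply: bmfB => //; exact: bmf_cst.
set S := \sum_(j < n) c (lift ord0 j) ^+ 2.
apply: (@le_trans _ _ (\int[mu ord0]_a (expR (2 * S) * expR (G a - EG)))).
  apply: le_Rint.
  - exact: (bmf_rint _ (bmf_fubini1 (mu ord0) PP' bEp)).
  - exact/bmf_rint/bmfZ/bmf_expR.
  move=> a; have bs : bounded_mfun (fun s => F (pair_cons (a, s))) by exact: (bmf_pair1 a bFp).
  have bs' : bounded_mfun (fun s => expR (F (pair_cons (a, s)) - G a)).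
    by apply/bmf_expR/bmfB => //; exact: bmf_cst.
  have -> : \int[PP']_s expR (F (pair_cons (a, s)) - EG) =
      expR (G a - EG) * \int[PP']_s expR (F (pair_cons (a, s)) - G a).
    rewrite -RintZ; last exact: bmf_rint.
    by apply: eq_Rintegral => s _; rewrite -expRD; congr expR; ring.
  rewrite mulrC ler_wpM2r ?expR_ge0//.
  apply: (IH (mu \o lift ord0) (fun s => F (pair_cons (a, s))) (c \o lift ord0)) => //.
  by move=> j s b; rewrite -upd_cons_lift; exact: Fc.
rewrite RintZ; last exact/bmf_rint/bmf_expR.
rewrite big_ord_recl -/S mulrDr addrC expRD ler_wpM2l ?expR_ge0//.
apply: hoeffding_mgf => //.
- move=> a.
  have -> : G a - EG = \int[mu ord0]_a' (G a - G a').
    rewrite RintB; [|exact/bmf_rint/bmf_cst|exact: bmf_rint].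
    by rewrite Rint_cst.
  apply: Rint_bound; first by apply: bmfB => //; exact: bmf_cst.
  move=> a'; rewrite /G -RintB; [|exact: (bmf_rint _ (bmf_pair1 _ bFp))..].
  apply: Rint_bound; first by apply: bmfB; exact: (bmf_pair1 _ bFp).
  by move=> s; rewrite -(upd_cons0 a' a); exact: Fc.
- rewrite RintB; [|exact: bmf_rint|exact/bmf_rint/bmf_cst].
  by rewrite Rint_cst subrr.
Qed.

End mcdiarmid.

Section moments.
Context (R : realType).

Lemma expr_le_expR (y : R) n : (0 < n)%N -> 0 <= y -> y ^+ n <= n%:R ^+ n * expR y.
Proof.
move=> n0 y0; have nN : n%:R != 0 :> R by rewrite pnatr_eq0 -lt0n.
have -> : expR y = expR (y / n%:R) ^+ n by rewrite -expRM_natl mulrCA mulfV ?mulr1.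
rewrite -exprMn lerXn2r ?nnegrE ?mulr_ge0 ?expR_ge0//.
rewrite mulrC -ler_pdivrMr ?ltr0n// (le_trans _ (expR_ge1Dx _))//.
by rewrite lerDr.
Qed.

Lemma even_power_le_cosh (y : R) q : (0 < q)%N ->
  (y ^+ 2) ^+ q <= (q.*2)%:R ^+ q.*2 * (expR y + expR (- y)).
Proof.
move=> q0; have q20 : (0 < q.*2)%N by rewrite double_gt0.
rewrite -exprM mul2n.
have -> : y ^+ q.*2 = `|y| ^+ q.*2.
  by rewrite -mul2n !exprM real_normK// num_real.
rewrite (le_trans (expr_le_expR q20 (normr_ge0 y)))// ler_wpM2l ?exprn_ge0//.
by have [|] := ger0P y => _; rewrite ?lerDl ?lerDr expR_ge0.
Qed.

(** Sum the tangent inequality of the power function at the mean. *)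
Lemma power_mean (n q : nat) (u : 'I_n.+1 -> R) : (forall k, 0 <= u k) ->
  (n.+1%:R^-1 * \sum_k u k) ^+ q <= n.+1%:R^-1 * \sum_k u k ^+ q.
Proof.
move=> u0; set A := n.+1%:R^-1 * _.
have A0 : 0 <= A by rewrite mulr_ge0 ?invr_ge0// sumr_ge0.
(* The tangent inequality at the mean; the induction step leaves a multiple of the
   square of [x - A]. *)
have tangent (x : R) : 0 <= x -> A ^+ q + (q%:R * A ^+ q.-1) * (x - A) <= x ^+ q.
  move=> x0; elim: q => [|q IHq]; first by rewrite !expr0 mul0r mul0r addr0.
  have := ler_wpM2l x0 IHq; rewrite -exprS => /(le_trans _); apply.
  case: q {IHq} => [|q] /=; first by rewrite !expr0 expr1; lra.
  rewrite -subr_ge0.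
  have -> : x * (A ^+ q.+1 + q.+1%:R * A ^+ q * (x - A)) -
     (A ^+ q.+2 + q.+2%:R * A ^+ q.+1 * (x - A)) = q.+1%:R * A ^+ q * (x - A) ^+ 2.
    by rewrite !exprS -[q.+2%:R]natr1 ; ring.
  by rewrite mulr_ge0 ?sqr_ge0// mulr_ge0// exprn_ge0.
have N0 : n.+1%:R != 0 :> R by rewrite pnatr_eq0.
have -> : A ^+ q = n.+1%:R^-1 * \sum_(k < n.+1) (A ^+ q + (q%:R * A ^+ q.-1) * (u k - A)).
  rewrite big_split/= sumr_const card_ord -mulr_sumr sumrB sumr_const card_ord.
  have -> : \sum_k u k = A *+ n.+1 by rewrite /A -[RHS]mulr_natl mulrA mulfV// mul1r.
  by rewrite subrr mulr0 addr0 -[X in _ * X]mulr_natl mulrA mulVf// mul1r.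
rewrite ler_wpM2l ?invr_ge0//; apply: ler_sum => k _; exact: tangent.
Qed.

Variables (d : measure_display) (U : measurableType d) (P : probability U R).

(** The power is dominated by [expR (l * X) + expR (- l * X)]; the choice
    [l ^+ 2 = q / v] balances the two factors. *)
Lemma moment_bound (X : U -> R) (v : R) q : bounded_mfun X -> 0 < v -> (0 < q)%N ->
  (forall l, \int[P]_x expR (l * X x) <= expR (2 * (l ^+ 2 * v))) ->
  \int[P]_x ((X x ^+ 2) ^+ q) <= 2 * (4 * q%:R * v * expR 2) ^+ q.
Proof.
move=> bX v0 q0 mgf.
have qr0 : 0 < q%:R :> R by rewrite ltr0n.
pose l := Num.sqrt (q%:R / v).
have l0 : 0 < l by rewrite sqrtr_gt0 divr_gt0.
have l2 : l ^+ 2 = q%:R / v by rewrite sqr_sqrtr// divr_ge0// ltW.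
have blX : bounded_mfun (fun x => l * X x) by exact: bmfZ.
have b1 : bounded_mfun (fun x => expR (l * X x)) by exact: bmf_expR.
have b2 : bounded_mfun (fun x => expR (- l * X x)) by apply/bmf_expR/bmfZ.
have bq : bounded_mfun (fun x => (X x ^+ 2) ^+ q) by apply/bmf_exp/bmf_exp.
have s0 : 0 < (l ^+ 2) ^+ q by rewrite !exprn_gt0.
rewrite -(ler_pM2l s0) -RintZ; last exact: bmf_rint.
apply: (@le_trans _ _ (\int[P]_x ((q.*2)%:R ^+ q.*2 * (expR (l * X x) + expR (- l * X x))))).
  apply: le_Rint; [exact/bmf_rint/bmfZ|exact/bmf_rint/bmfZ/bmfD|].
  by move=> x; rewrite -exprMn -exprMn mulNr; exact: even_power_le_cosh.
rewrite RintZ; last exact/bmf_rint/bmfD.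
rewrite RintD; [|exact: bmf_rint..].
have m1 := mgf l; have := mgf (- l); rewrite sqrrN => m2.
apply: (@le_trans _ _ ((q.*2)%:R ^+ q.*2 * (2 * expR 2 ^+ q))).
  rewrite ler_wpM2l ?exprn_ge0//.
  have E : 2 * (l ^+ 2 * v) = q%:R * 2 by rewrite l2; field; rewrite gt_eqF.
  by move: m1 m2; rewrite E expRM_natl; lra.
rewrite le_eqVlt; apply/orP; left; apply/eqP.
rewrite mulrCA [RHS]mulrCA; congr (_ * _).
rewrite -mul2n exprM -!exprMn; congr (_ ^+ q).
by rewrite l2 natrM; field; rewrite gt_eqF.
Qed.

End moments.

(** * Statistics of the empirical product measure *)

Section empirical_integral.
Context (dT : measure_display) (T : measurableType dT) (R : realType).

Definition empirical_prob d (V : measurableType d) n (x : 'I_n.+1 -> V) : probability V R := empirical R x.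

Lemma Rint_empirical d (V : measurableType d) n (x : 'I_n.+1 -> V) (f : V -> R) : bounded_mfun f ->
  \int[empirical_prob x]_a f a = n.+1%:R^-1 * \sum_(k < n.+1) f (x k).
Proof.
have ge0 (h : V -> R) : bounded_mfun h -> (forall a, 0 <= h a) ->
    \int[empirical_prob x]_a h a = n.+1%:R^-1 * \sum_(k < n.+1) h (x k).
  move=> bh h0; apply: EFin_inj; rewrite (EFin_Rint (bmf_rint _ bh)).
  have mh : measurable_fun setT (fun a => (h a)%:E) by apply/measurable_EFinP; case: bh.
  pose dx (k : nat) : {measure set V -> \bar R} := \d_(x (inord k)).
  have r0 : 0 <= n.+1%:R^-1 :> R by rewrite invr_ge0.
  rewrite (eq_measure_integral (mscale (NngNum r0) (msum dx n.+1))); last first.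
    move=> A mA _; rewrite /= /empirical /mscale /msum/=; congr (_ * _)%E.
    by apply: eq_bigr => k _; rewrite /dx inord_val.
  rewrite ge0_integral_mscale//; last by move=> a _; rewrite lee_fin.
  rewrite ge0_integral_measure_sum//; last by move=> a _; rewrite lee_fin.
  rewrite EFinM; congr (_ * _)%E; rewrite -sumEFin; apply: eq_bigr => k _.
  by rewrite integral_dirac// diracT mul1e inord_val.
move=> bf; have [_ [M fM]] := bf.
have bM : bounded_mfun (fun _ : V => M) by exact: bmf_cst.
have := ge0 _ (bmfD bf bM).
rewrite RintD ?Rint_cst; [|exact: bmf_rint..].
rewrite big_split/= sumr_const card_ord mulrDr -[X in _ + _ * X]mulr_natl mulrA mulVf ?pnatr_eq0// mul1r.
move=> H; apply: (addIr M); apply: H => a.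
by have := fM a; rewrite ler_norml => /andP[h _]; lra.
Qed.

(** The integral of [H] against the product of the empirical measures
    ([Rint_empirical_prod]), as a statistic of the observations. *)
Definition vstat m n (H : m.-tuple T -> R) (x : 'I_m -> 'I_n.+1 -> T) : R :=
  n.+1%:R^-1 ^+ m * \sum_(kap : {ffun 'I_m -> 'I_n.+1}) H [tuple x j (kap j) | j < m].

Lemma indic_box m (A : 'I_m -> set T) (z : m.-tuple T) :
  \1_(box A) z = \prod_(j < m) \1_(A j) (tnth z j) :> R.
Proof.
rewrite indicE; have [zA|zA] := boolP (z \in box A).
  by rewrite big1// => j _; rewrite indicE mem_set//; move: zA; rewrite inE; apply.
suff [j nA] : exists j, ~ A j (tnth z j) by rewrite (bigD1 j)//= indicE memNset// mul0r.
by move: zA; rewrite notin_setE /box/= => /existsNP.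
Qed.

(** Both sides are probabilities, the right-hand one being the empirical measure of
    the N^m chosen tuples, and they agree on boxes by distributivity. *)
Lemma Rint_empirical_prod m n (x : 'I_m -> 'I_n.+1 -> T) (H : m.-tuple T -> R) : bounded_mfun H ->
  \int[tuple_prod (fun j => empirical_prob (x j))]_z H z = vstat H x.
Proof.
move=> bH.
have cardE : #|{: {ffun 'I_m -> 'I_n.+1}}| = (n.+1 ^ m)%N by rewrite card_ffun !card_ord.
(* The empirical measure is indexed by an ordinal of successor form. *)
pose p := (n.+1 ^ m).-1%N.
have pE : p.+1 = #|{: {ffun 'I_m -> 'I_n.+1}}| by rewrite cardE prednK// expn_gt0.
pose y (i : 'I_p.+1) := [tuple x j ((enum_val (cast_ord pE i) : {ffun 'I_m -> 'I_n.+1}) j) | j < m].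
have yE (h : m.-tuple T -> R) : p.+1%:R^-1 * \sum_i h (y i) = vstat h x.
  rewrite /vstat; congr (_ * _); first by rewrite pE cardE natrX exprVn.
  rewrite [RHS](reindex (fun i : 'I_p.+1 => enum_val (cast_ord pE i)))//=.
  apply: onW_bij; apply: bij_comp; first exact: enum_val_bij.
  by exists (cast_ord (esym pE)); [exact: cast_ordK|exact: cast_ordKV].
have Q B : measurable B ->
    tuple_prod (fun j => empirical_prob (x j)) B = empirical_prob y B.
  apply: tuple_measurable_unique => A mA.
  rewrite tuple_prod_box// (Rint_indic (empirical_prob y) (measurable_box mA)).
  rewrite Rint_empirical; last by apply: bmf_indic; exact: measurable_box.
  rewrite yE /vstat.
  rewrite (eq_bigr (fun j => (n.+1%:R^-1 * \sum_(k < n.+1) \1_(A j) (x j k))%:E)); last first.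
    move=> j _; rewrite [LHS](Rint_indic (empirical_prob (x j)) (mA j)).
    by rewrite Rint_empirical//; exact: bmf_indic.
  rewrite -(big_morph EFin EFinM erefl) big_split/= prodr_const card_ord.
  rewrite bigA_distr_bigA/=; congr (_ * _)%:E; apply: eq_bigr => kap _.
  by rewrite indic_box; apply: eq_bigr => j _; rewrite tnth_mktuple.
rewrite -yE -(Rint_empirical y bH) /Rintegral; congr fine.
by apply: eq_measure_integral => B mB _; exact: Q.
Qed.

End empirical_integral.

Section vstat.
Context (dT : measure_display) (T : measurableType dT) (R : realType).
Context (m n : nat) (nu : 'I_m -> probability T R).
Local Notation I := {: 'I_m * 'I_n.+1}.
Local Notation U := (m.-tuple T).
Local Notation S := (#|I|.-tuple T).
Local Notation PP := (tuple_prod nu).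

(** All observations are gathered in one tuple, indexed by the pairs (sample,
    observation), so that [mcdiarmid_mgf] applies to it. *)
Definition sample_law : 'I_#|I| -> probability T R := fun i => nu (enum_val i).1.
Local Notation SS := (tuple_prod sample_law).

Definition sample_at (s : S) (j : 'I_m) (k : 'I_n.+1) : T := tnth s (enum_rank (j, k)).
Definition sample_tuple (kap : {ffun 'I_m -> 'I_n.+1}) (s : S) : U := [tuple sample_at s j (kap j) | j < m].

Lemma measurable_sample_at j k : measurable_fun setT (fun s => sample_at s j k).
Proof. exact: measurable_tnth. Qed.

Lemma measurable_sample_tuple kap : measurable_fun setT (sample_tuple kap).
Proof.
apply/measurable_fun_tnthP => j.
rewrite (_ : _ \o _ = fun s => sample_at s j (kap j)); first exact: measurable_sample_at.
by apply/funext => s /=; rewrite tnth_mktuple.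
Qed.

(** The chosen observations come from distinct samples, hence are independent; this
    is why [vstat] is unbiased. *)
Lemma law_sample_tuple kap : law SS (sample_tuple kap) PP.
Proof.
apply: law_tuple_prod; first exact: measurable_sample_tuple.
move=> A mA.
pose B (i : 'I_#|I|) := if (enum_val i).2 == kap (enum_val i).1 then A (enum_val i).1 else setT.
have mB i : measurable (B i) by rewrite /B; case: ifP.
rewrite (_ : [set u | _] = box B); last first.
  apply/seteqP; split => s /=.
    move=> sA i; rewrite /B; case: eqP => // ik; have := sA (enum_val i).1.
    by rewrite tnth_mktuple /sample_at -ik -surjective_pairing enum_valK.
  move=> sB j; rewrite tnth_mktuple; have := sB (enum_rank (j, kap j)).
  by rewrite /B enum_rankK/= eqxx.
rewrite tuple_prod_box//.
rewrite (eq_bigr (fun i => (fun jk : I => if jk.2 == kap jk.1 then nu jk.1 (A jk.1) else 1%E) (enum_val i))); last first.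
  by move=> i _; rewrite /B /sample_law; case: ifP => // _; rewrite probability_setT.
rewrite -(big_enum_val (A := predT) (fun jk : I => if jk.2 == kap jk.1 then nu jk.1 (A jk.1) else 1%E)).
rewrite -(pair_bigA _ (fun j k => if k == kap j then nu j (A j) else 1%E))/=.
apply: eq_bigr => j _; rewrite (bigD1 (kap j))//= eqxx big1 ?mule1// => k kj.
by rewrite (negbTE kj).
Qed.

Section statistic.
Variables (H : U -> R) (B : R).
Hypotheses (bH : bounded_mfun H) (HB : forall z, `|H z| <= B).

Let V s := vstat H (sample_at s).

Lemma bmf_vstat : bounded_mfun V.
Proof.
apply: bmfZ; apply: bmf_sum => kap; exact: (bmf_comp (measurable_sample_tuple kap) bH).
Qed.

Lemma Rint_vstat : \int[SS]_s V s = \int[PP]_z H z.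
Proof.
have bk kap : bounded_mfun (fun s => H (sample_tuple kap s)) by exact: (bmf_comp (measurable_sample_tuple kap) bH).
rewrite /V /vstat RintZ; last by apply: bmf_rint; exact: bmf_sum.
rewrite Rint_sum//.
under eq_bigr do rewrite -(law_Rint (law_sample_tuple _) (bmf_rint _ bH)).
rewrite sumr_const card_ffun !card_ord -[X in _ * X]mulr_natl mulrA natrX -exprMn.
by rewrite mulVf ?pnatr_eq0// expr1n mul1r.
Qed.

Lemma sample_at_upd i s a j k : sample_at (upd i s a) j k =
  if (j, k) == enum_val i then a else sample_at s j k.
Proof. by rewrite /sample_at tnth_upd -(inj_eq enum_val_inj) enum_rankK. Qed.

(** A given observation is chosen in a proportion 1 / N of the N^m tuples. *)
Lemma vstat_upd_le i s a : `|V (upd i s a) - V s| <= 2 * B / n.+1%:R.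
Proof.
have N0 : n.+1%:R != 0 :> R by rewrite pnatr_eq0.
have B0 : 0 <= B by exact: le_trans (normr_ge0 _) (HB [tuple sample_at s j ord0 | j < m]).
case ik: (enum_val i) => [j0 k0].
have m0 : (0 < m)%N by exact: leq_ltn_trans (leq0n j0) (ltn_ord j0).
pose hit (kap : {ffun 'I_m -> 'I_n.+1}) : R := (kap j0 == k0)%:R.
have diff kap : `|H (sample_tuple kap (upd i s a)) - H (sample_tuple kap s)| <= hit kap * (2 * B).
  rewrite /hit; case: eqP => [_|kj]; last first.
    rewrite mul0r (_ : sample_tuple kap (upd i s a) = sample_tuple kap s) ?subrr ?normr0//.
    apply: eq_from_tnth => j; rewrite !tnth_mktuple sample_at_upd ik.
    by case: eqP => // -[jj kk]; case: kj; rewrite -jj.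
  by rewrite mul1r (le_trans (ler_normB _ _))// mulrDl !mul1r lerD.
have hits : \sum_(kap : {ffun 'I_m -> 'I_n.+1}) hit kap = n.+1%:R ^+ m.-1.
  transitivity (\prod_(j < m) \sum_(k < n.+1) (if j == j0 then (k == k0)%:R else 1 : R)).
    rewrite bigA_distr_bigA; apply: eq_bigr => kap _.
    rewrite (bigD1 j0)//= eqxx big1 ?mulr1// => j jj0.
    by rewrite (negbTE jj0).
  rewrite (bigD1 j0)//= eqxx (bigD1 k0)//= eqxx big1 ?addr0 ?mul1r; last first.
    by move=> k kk0; rewrite (negbTE kk0).
  rewrite (eq_bigr (fun=> n.+1%:R)); last first.
    by move=> j jj0; rewrite (negbTE jj0) sumr_const card_ord.
  by rewrite prodr_const cardC1 card_ord.
rewrite /V /vstat -mulrBr normrM ger0_norm ?exprn_ge0 ?invr_ge0// -sumrB.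
apply: (@le_trans _ _ (n.+1%:R^-1 ^+ m * \sum_(kap : {ffun 'I_m -> 'I_n.+1}) hit kap * (2 * B))).
  rewrite ler_wpM2l ?exprn_ge0 ?invr_ge0//.
  by rewrite (le_trans (ler_norm_sum _ _ _))//; apply: ler_sum => kap _; exact: diff.
rewrite -mulr_suml hits.
have -> : n.+1%:R^-1 ^+ m = n.+1%:R^-1 * (n.+1%:R ^+ m.-1)^-1 :> R.
  by rewrite -exprVn -exprS prednK.
rewrite -mulrA mulKf ?expf_neq0// mulrC.
by [].
Qed.

(** Used when the [j]-th argument is frozen at an observation of the [j]-th sample:
    conditioning on that observation does not affect the statistic. *)
Lemma vstat_upd_indep j k s a : (forall z c, H (upd j z c) = H z) ->
  V (upd (enum_rank (j, k)) s a) = V s.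
Proof.
move=> Hj; rewrite /V /vstat; congr (_ * _); apply: eq_bigr => kap _.
rewrite -(Hj _ a) -[RHS](Hj _ a); congr H; apply: eq_from_tnth => i.
rewrite !tnth_upd; case: eqVneq => // ij.
rewrite !tnth_mktuple sample_at_upd enum_rankK.
by case: eqP => // -[ij' _]; rewrite ij' eqxx in ij.
Qed.

(** The sum over the m N observations of the squared increments bounded in
    [vstat_upd_le]. *)
Definition variance_proxy : R := 4 * m%:R * B ^+ 2 / n.+1%:R.

Lemma vstat_mgf l : \int[SS]_s expR (l * (V s - \int[PP]_z H z)) <=
  expR (2 * (l ^+ 2 * variance_proxy)).
Proof.
have N0 : n.+1%:R != 0 :> R by rewrite pnatr_eq0.
have bV := bmf_vstat.
have := @mcdiarmid_mgf _ _ R _ sample_law (fun s => l * V s) (fun=> `|l| * (2 * B / n.+1%:R)) (bmfZ l bV).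
move=> /(_ _)/wrap[].
  by move=> i s a; rewrite -mulrBr normrM ler_wpM2l//; exact: vstat_upd_le.
rewrite RintZ; last exact: bmf_rint.
rewrite Rint_vstat; under eq_Rintegral do rewrite -mulrBr.
move=> /le_trans; apply; rewrite le_eqVlt; apply/orP; left; apply/eqP; congr expR.
rewrite sumr_const card_ord card_prod !card_ord exprMn real_normK ?num_real//.
rewrite -[X in 2 * X = _]mulr_natl natrM /variance_proxy; field.
by rewrite addrC natr1.
Qed.

Lemma vstat_moment q : 0 < variance_proxy -> (0 < q)%N ->
  \int[SS]_s ((V s - \int[PP]_z H z) ^+ 2) ^+ q <=
  2 * (4 * q%:R * variance_proxy * expR 2) ^+ q.
Proof.
move=> v0 q0; apply: moment_bound => //; last by move=> l; exact: vstat_mgf.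
by apply: bmfB; [exact: bmf_vstat|exact: bmf_cst].
Qed.

End statistic.

Lemma le_Rint_ae_cst d (V : measurableType d) (P : probability V R) (f : V -> R) (C : R) :
  bounded_mfun f -> {ae P, forall x, f x <= C} -> \int[P]_x f x <= C.
Proof.
move=> bf fC; have [mf [M fM]] := bf.
have bm : bounded_mfun (fun x => Num.min (f x) C).
  split; first by apply: measurable_minr => //; exact: measurable_cst.
  exists (M + `|C|) => x; rewrite /Num.min; case: ifP => _.
    by rewrite (le_trans (fM x))// lerDl.
  by rewrite lerDr (le_trans (normr_ge0 _) (fM x)).
rewrite (_ : \int[P]_x f x = \int[P]_x Num.min (f x) C).
  rewrite -[leRHS](Rint_cst P); apply: le_Rint; [exact: bmf_rint|exact/bmf_rint/bmf_cst|].
  by move=> x; rewrite ge_min lexx orbT.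
apply: Rint_ae => //; first by case: bm.
by apply: filterS fC => x h; rewrite min_l.
Qed.

Section marginal_deviation.
Variables (g : U -> R) (B : R) (q : nat).
Hypotheses (bg : bounded_mfun g) (gB : forall z, `|g z| <= B) (v0 : 0 < variance_proxy B) (q0 : (0 < q)%N).

Definition empirical_cond_exp j k (s : S) : R := vstat (fun z => g (upd j z (sample_at s j k))) (sample_at s).

(** The squared L^2 norm, for the [j]-th empirical measure, of the error in the
    [j]-th marginal of [g] ([deviationE]). *)
Definition deviation j (s : S) : R :=
  n.+1%:R^-1 * \sum_(k < n.+1) (empirical_cond_exp j k s - 1) ^+ 2.

Lemma deviationE j s :
  \int[empirical_prob R (sample_at s j)]_a ((cond_exp (fun i => empirical_prob R (sample_at s i)) j g a - 1) ^+ 2) = deviation j s.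
Proof.
rewrite Rint_empirical; last first.
  by apply: bmf_exp; apply: bmfB; [exact: bmf_cond|exact: bmf_cst].
rewrite /deviation; congr (_ * _); apply: eq_bigr => k _; congr ((_ - 1) ^+ 2).
by rewrite /cond_exp (Rint_empirical_prod _ (bmf_upd2 j (sample_at s j k) bg)).
Qed.

Lemma bmf_empirical_cond_exp j k : bounded_mfun (empirical_cond_exp j k).
Proof.
apply: bmfZ; apply: bmf_sum => kap.
apply: (bmf_comp (h := fun s => upd j (sample_tuple kap s) (sample_at s j k)) _ bg).
by apply: measurable_upd; [exact: measurable_sample_tuple|exact: measurable_sample_at].
Qed.

Lemma bmf_deviation j : bounded_mfun (deviation j).
Proof.
apply: bmfZ; apply: bmf_sum => k; apply: bmf_exp; apply: bmfB; last exact: bmf_cst.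
exact: bmf_empirical_cond_exp.
Qed.

Lemma deviation_ge0 j s : 0 <= deviation j s.
Proof. by rewrite mulr_ge0 ?invr_ge0// sumr_ge0// => k _; exact: sqr_ge0. Qed.

(** The norm itself does not have small increments, but for a frozen observation the
    error is a statistic of the other samples, which is centered because the
    population marginal of [g] is 1. The power mean inequality reduces the norm to
    these. *)
Lemma deviation_moment j : {ae nu j, forall a, cond_exp nu j g a = 1} ->
  \int[SS]_s (deviation j s ^+ q) <= 2 * (4 * q%:R * variance_proxy B * expR 2) ^+ q.
Proof.
move=> ae1; set C := 2 * _ ^+ q.
have bk k : bounded_mfun (fun s => ((empirical_cond_exp j k s - 1) ^+ 2) ^+ q).
  by do 2 apply: bmf_exp; apply: bmfB; [exact: bmf_empirical_cond_exp|exact: bmf_cst].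
have bsum : bounded_mfun (fun s => \sum_(k < n.+1) ((empirical_cond_exp j k s - 1) ^+ 2) ^+ q) by exact: bmf_sum.
apply: (@le_trans _ _ (\int[SS]_s (n.+1%:R^-1 * \sum_(k < n.+1) ((empirical_cond_exp j k s - 1) ^+ 2) ^+ q))).
  apply: le_Rint; [exact/bmf_rint/bmf_exp/bmf_deviation|exact/bmf_rint/bmfZ|].
  by move=> s; apply: power_mean => k; exact: sqr_ge0.
rewrite RintZ; last exact: bmf_rint.
rewrite Rint_sum// mulrC ler_pdivrMr ?ltr0n//.
rewrite mulr_natr -[X in _ *+ X](card_ord n.+1) -sumr_const; apply: ler_sum => k _.
rewrite (Rint_cond sample_law (enum_rank (j, k)) (bk k)).
apply: le_Rint_ae_cst; first exact: bmf_cond.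
rewrite {1}/sample_law enum_rankK/=; apply: filterS ae1 => a ga1.
pose Ha z := g (upd j z a).
have bHa : bounded_mfun Ha by exact: bmf_upd2.
have HaB z : `|Ha z| <= B by exact: gB.
have Haj z c : Ha (upd j z c) = Ha z by rewrite /Ha upd_upd.
have := vstat_moment bHa HaB v0 q0; rewrite -/C => /(le_trans _); apply.
rewrite le_eqVlt; apply/orP; left; apply/eqP; apply: eq_Rintegral => s _.
rewrite /empirical_cond_exp sample_at_upd enum_rankK eqxx; congr (((_ - _) ^+ 2) ^+ q).
  exact: (vstat_upd_indep k s a Haj).
by rewrite -ga1.
Qed.

End marginal_deviation.

End vstat.

(** * Test functions and the good event *)

Section test_functions.
Context (dT : measure_display) (T : measurableType dT) (R : realType).
Context (m : nat) (mu : 'I_m -> probability T R).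
Local Notation U := (m.-tuple T).
Local Notation PP := (tuple_prod mu).

Lemma Lfun_ae_bound (g : U -> R) : g \in Lfun PP +oo%E ->
  measurable_fun setT g /\ 0 <= fine ('N[PP]_+oo%E [EFin \o g])%E /\
  {ae PP, forall x, `|g x| <= fine ('N[PP]_+oo%E [EFin \o g])%E}.
Proof.
rewrite inE => /andP[]; rewrite !inE /= /finite_norm => mg fg.
have N0 := Lnorm_ge0 PP +oo%E (EFin \o g).
have fN : 'N[PP]_+oo%E [EFin \o g]%E \is a fin_num by rewrite ge0_fin_numE.
split => //; split; first exact: fine_ge0.
have E : 'N[PP]_+oo%E [EFin \o g]%E = ess_sup PP (abse \o (EFin \o g)).
  by rewrite unlock [X in (0 < X)%E]probability_setT lte_fin ltr01.
have := ess_sup_ge PP (abse \o (EFin \o g)); rewrite -E.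
by apply: filterS => x /=; rewrite -lee_fin fineK.
Qed.

Variables (D : set U) (g : U -> R) (G : R).
Hypotheses (mD : measurable D) (mg : measurable_fun setT g) (G0 : 0 <= G).

(** The points at which the test function obeys its essential bound; the sampled
    tuples belong to this set almost surely. *)
Definition tame_set : set U := D `&` [set x | `|g x| <= G].

Lemma measurable_tame : measurable tame_set.
Proof.
apply: measurableI => //; rewrite -[X in measurable X]setTI.
by apply: measurable_fun_le => //; exact: measurableT_comp.
Qed.

(** Dividing by the essential bound makes the event of [coupling_concentration]
    scale invariant; for [G = 0] the function is zero, as it should be. *)
Definition normalized (x : U) : R := (g \_ tame_set) x / G.

Lemma normalized_le1 x : `|normalized x| <= 1.
Proof.
rewrite /normalized patchE; case: ifPn => [xS|_]; last by rewrite mul0r normr0.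
have := set_mem xS => -[_ /= gG]; rewrite normrM normfV (ger0_norm G0).
have [->|Gp] := eqVneq G 0; first by rewrite invr0 mulr0.
by rewrite ler_pdivrMr ?mul1r// lt_neqAle eq_sym Gp.
Qed.

Lemma normalizedE x : G * normalized x = (g \_ tame_set) x.
Proof.
rewrite /normalized; have [G00|Gp] := eqVneq G 0; last by rewrite mulrC mulfVK.
rewrite G00 mul0r patchE; case: ifPn => // xS.
by have := set_mem xS => -[_ /=]; rewrite G00 normr_le0 => /eqP.
Qed.

Lemma bmf_normalized : bounded_mfun normalized.
Proof.
split; last by exists 1; exact: normalized_le1.
apply: measurable_funM; last exact: measurable_cst.
by apply/(measurable_restrictT _ measurable_tame); exact: measurable_funTS.
Qed.

Lemma density_Rint_tame (Q : probability U R) q : has_density PP Q q ->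
  {ae PP, forall x, tame_set x} ->
  \int[Q]_(x in D) g x = G * \int[PP]_x (q x * normalized x).
Proof.
move=> hq aeS; have [rq q0 _] := hq; have bn := bmf_normalized.
have mgS : measurable_fun setT (g \_ tame_set).
  by apply/(measurable_restrictT _ measurable_tame); exact: measurable_funTS.
have mgD : measurable_fun setT (g \_ D).
  by apply/(measurable_restrictT _ mD); exact: measurable_funTS.
rewrite Rintegral_mkcond (Rint_ae mgD mgS); last first.
  apply: filterS (density_ae hq aeS) => x Sx.
  by rewrite !patchE !mem_set//; case: Sx.
rewrite (_ : \int[Q]_x _ = \int[Q]_x (G * normalized x)); last first.
  by apply: eq_Rintegral => x _; rewrite normalizedE.
rewrite RintZ; last exact: bmf_rint.
rewrite (density_Rint hq); [|by case: bn|].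
  by congr (_ * _); apply: eq_Rintegral => x _; rewrite mulrC.
have := rintM rq bn; congr (Rintegrable PP _).
by apply/funext => x; rewrite mulrC.
Qed.

End test_functions.

Section marginals_of_minimizer.
Context (dT : measure_display) (T : measurableType dT) (R : realType).
Context (m : nat) (mu : 'I_m -> probability T R).
Local Notation U := (m.-tuple T).
Local Notation PP := (tuple_prod mu).

(** The marginal constraint tested against the marginal error itself. *)
Lemma cond_ae_one (g p : U -> R) j : (0 < m)%N -> coupling_density mu p -> bounded_mfun g ->
  {ae PP, forall x, p x = g x} -> {ae mu j, forall a, cond_exp mu j g a = 1}.
Proof.
move=> m0 cp bg pg; have bc := bmf_cond mu j bg.
pose u a := cond_exp mu j g a - 1.
have bu : bounded_mfun u by apply: bmfB => //; exact: bmf_cst.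
have Iu : \int[mu j]_a (cond_exp mu j g a * u a) = \int[mu j]_a u a.
  rewrite -(cond_tnth mu j bg bu) -(coupling_Rint_tnth m0 j cp bu).
  apply: Rint_ae.
  - by case: (bmfM bg (bmf_tnth j bu)).
  - by case: (rintM (let: And4 r _ _ _ := cp in r) (bmf_tnth j bu)).
  - by apply: filterS pg => x ->.
have I2 : \int[mu j]_a (u a ^+ 2) = 0.
  transitivity (\int[mu j]_a (cond_exp mu j g a * u a - u a)).
    by apply: eq_Rintegral => a _; rewrite /u; ring.
  rewrite RintB; [|exact/bmf_rint/bmfM|exact: bmf_rint].
  by rewrite Iu subrr.
have := Rint0_ae (bmf_rint _ (bmf_exp 2 bu)) (fun a => sqr_ge0 _) I2.
by apply: filterS => a /eqP; rewrite expf_eq0 /= subr_eq0 => /eqP.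
Qed.

End marginals_of_minimizer.

Section good_event.
Context (dT : measure_display) (T : measurableType dT) (R : realType).
Context (m n : nat) (nu : 'I_m -> probability T R).
Local Notation U := (m.-tuple T).
Local Notation I := {: 'I_m * 'I_n.+1}.
Local Notation S := (#|I|.-tuple T).
Local Notation PP := (tuple_prod nu).
Local Notation SS := (tuple_prod (@sample_law _ _ _ m n nu)).
Variables (g h : U -> R) (b : R) (q : nat) (A : set U).
Hypotheses (m0 : (0 < m)%N) (b0 : 0 < b) (q0 : (0 < q)%N).
Hypotheses (bg : bounded_mfun g) (gb : forall x, `|g x| <= b) (bh : bounded_mfun h) (hb : forall x, `|h x| <= b).
Hypothesis marg : forall j, {ae nu j, forall a, cond_exp nu j g a = 1}.
Hypotheses (mA : measurable A) (aeA : {ae PP, forall x, A x}).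

(** The exponent 3 exceeds by one that of the moment bounds, so that Markov's
    inequality gains the factor [expR (- q%:R)] ([moment_threshold]). *)
Definition threshold : R := 4 * q%:R * variance_proxy m n b * expR 3.

Definition good_event : set S := [set s | [/\ forall kap, A (sample_tuple kap s),
  forall j, deviation g j s <= threshold &
  (vstat h (sample_at s) - \int[PP]_z h z) ^+ 2 <= threshold]].

Lemma variance_proxy_gt0 : 0 < variance_proxy m n b.
Proof. by rewrite /variance_proxy divr_gt0// mulr_gt0 ?exprn_gt0// mulr_gt0// ltr0n. Qed.

Lemma threshold_gt0 : 0 < threshold.
Proof.
by rewrite /threshold !mulr_gt0 ?ltr0n// ?expR_gt0//; exact: variance_proxy_gt0.
Qed.

Lemma moment_threshold : 2 * (4 * q%:R * variance_proxy m n b * expR 2) ^+ q =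
  threshold ^+ q * (2 * expR (- q%:R)).
Proof.
have -> : expR (- q%:R) = expR (-1) ^+ q :> R by rewrite -expRM_natl mulrN1.
rewrite [RHS]mulrCA -exprMn /threshold; congr (_ * _ ^+ q).
by rewrite -[RHS]mulrA -expRD; congr (_ * expR _); lra.
Qed.

Let L (s : S) := (vstat h (sample_at s) - \int[PP]_z h z) ^+ 2.

Let bL : bounded_mfun L.
Proof. by apply: bmf_exp; apply: bmfB; [exact: bmf_vstat|exact: bmf_cst]. Qed.

Lemma measurable_le_threshold (f : S -> R) : bounded_mfun f -> measurable [set s | f s <= threshold].
Proof.
move=> [mf _]; rewrite -[X in measurable X]setTI.
by apply: measurable_fun_le => //; exact: measurable_cst.
Qed.

Let E2 : set S := [set s | (forall j, deviation g j s <= threshold) /\ L s <= threshold].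

Let mE2 : measurable E2.
Proof.
rewrite (_ : E2 = (\bigcap_(j in [set: 'I_m]) [set s | deviation g j s <= threshold]) `&`
    [set s | L s <= threshold]).
  apply: measurableI; last exact: measurable_le_threshold.
  apply: fin_bigcap_measurable => // j _.
  by apply: measurable_le_threshold; exact: bmf_deviation.
by apply/seteqP; split=> s [H1 H2]; split=> // j; [move=> _|]; exact: H1.
Qed.

Lemma measurable_sample_tuples : measurable [set s : S | forall kap, A (sample_tuple kap s)].
Proof.
rewrite (_ : [set s | _] = \bigcap_(kap in [set: {ffun 'I_m -> 'I_n.+1}]) (sample_tuple kap @^-1` A)).
  apply: fin_bigcap_measurable => // kap _; rewrite -[X in measurable X]setTI.
  exact: measurable_sample_tuple.
by apply/seteqP; split=> s H => [kap _|kap]; exact: H.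
Qed.

Lemma good_eventE : good_event = [set s : S | forall kap, A (sample_tuple kap s)] `&` E2.
Proof. by apply/seteqP; split=> s; [move=> [? ? ?]; split|move=> [? [? ?]]; split]. Qed.

Lemma measurable_good_event : measurable good_event.
Proof. by rewrite good_eventE; apply: measurableI => //; exact: measurable_sample_tuples. Qed.

Lemma ae_sample_tuples : {ae SS, forall s, forall kap, A (sample_tuple kap s)}.
Proof. by apply: ae_forall_fin => kap; exact: (law_ae (law_sample_tuple nu kap) aeA). Qed.

(** Markov's inequality for the [q]-th powers, summed over the m marginal errors and
    the test statistic; the condition on the sampled tuples holds almost surely. *)
Lemma good_event_probability :
  \int[SS]_s \1_(~` good_event) s <= m.+1%:R * (2 * expR (- q%:R)).
Proof.
have th0 := threshold_gt0; have thq0 : 0 < threshold ^+ q by rewrite exprn_gt0.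
have mG := measurable_good_event.
have bdev j : bounded_mfun (fun s : S => deviation g j s ^+ q) by apply: bmf_exp; exact: bmf_deviation.
have bLq : bounded_mfun (fun s => L s ^+ q) by exact: bmf_exp.
pose F s := (threshold ^+ q)^-1 * (\sum_(j < m) deviation g j s ^+ q + L s ^+ q).
have bF : bounded_mfun F by apply: bmfZ; apply: bmfD => //; exact: bmf_sum.
have E : \int[SS]_s \1_(~` good_event) s = \int[SS]_s \1_(~` E2) s.
  apply: Rint_ae.
  - by case: (bmf_indic R (measurableC mG)).
  - by case: (bmf_indic R (measurableC mE2)).
  - apply: filterS ae_sample_tuples => s As; rewrite !indicE; congr (_ %:R).
    congr nat_of_bool; rewrite good_eventE setCI in_setU.
    rewrite (_ : (s \in ~` _) = false)//; apply/negbTE; rewrite notin_setE/=.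
    by move=> nA; exact: nA.
have pw (x : R) : threshold < x -> 1 <= (threshold ^+ q)^-1 * x ^+ q.
  move=> tx; rewrite mulrC ler_pdivlMr// mul1r lerXn2r ?nnegrE ?(ltW th0)//; last exact: ltW.
  by rewrite (le_trans (ltW th0))// ltW.
have sum0 s : 0 <= \sum_(j < m) deviation g j s ^+ q.
  by apply: sumr_ge0 => j _; rewrite exprn_ge0//; exact: deviation_ge0.
have L0 s : 0 <= L s ^+ q by rewrite exprn_ge0// sqr_ge0.
rewrite E; apply: (@le_trans _ _ (\int[SS]_s F s)).
  apply: le_Rint; [exact/bmf_rint/bmf_indic/measurableC|exact: bmf_rint|move=> s].
  have F0 : 0 <= F s by rewrite mulr_ge0 ?invr_ge0 ?(ltW thq0)// addr_ge0.
  rewrite indicE; case: (boolP (s \in ~` E2)) => //; rewrite inE /E2/= => /not_andP nE.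
  have [[j /negP]|/negP] : (exists j, ~ deviation g j s <= threshold) \/ ~ L s <= threshold.
    by case: nE => [/existsNP|]; [left|right].
  - rewrite -ltNge => /pw /le_trans; apply; rewrite ler_wpM2l ?invr_ge0 ?(ltW thq0)//.
    rewrite (bigD1 j)//= -addrA lerDl addr_ge0//.
    by apply: sumr_ge0 => i _; rewrite exprn_ge0//; exact: deviation_ge0.
  - rewrite -ltNge => /pw /le_trans; apply; rewrite ler_wpM2l ?invr_ge0 ?(ltW thq0)//.
    by rewrite lerDr.
rewrite RintZ; last by apply/bmf_rint/bmfD => //; exact: bmf_sum.
rewrite RintD; [|exact/bmf_rint/bmf_sum|exact: bmf_rint].
rewrite Rint_sum// mulrC ler_pdivrMr//.
have v0 := variance_proxy_gt0.
rewrite -natr1 mulrDl mul1r mulrDl; apply: lerD.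
  rewrite -[leRHS]mulrA [leRHS]mulr_natl -[X in _ <= _ *+ X](card_ord m) -[leRHS]sumr_const.
  apply: ler_sum => j _.
  by rewrite mulrC -moment_threshold; exact: deviation_moment.
by rewrite mulrC -moment_threshold; exact: vstat_moment.
Qed.

End good_event.

(** * Concentration of the empirical coupling *)

Section constants.
Context (R : realType).

Definition density_bound (m : nat) (eps L : R) : R :=
  expR (m%:R * potential_bound m eps L + L / eps).

Definition concentration_const (m : nat) (eps L : R) : R :=
  let b := density_bound m eps L in
  (1 + stability_const m b) * Num.sqrt (32 * expR 3 * m%:R * b ^+ 2).

Lemma density_bound_ge1 m (eps L : R) : 0 < eps -> 0 <= L -> 1 <= density_bound m eps L.
Proof.
move=> e0 L0; have Le : 0 <= L / eps by rewrite divr_ge0// ltW.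
rewrite /density_bound -[leLHS]expR0 ler_expR addr_ge0// mulr_ge0//.
by rewrite /potential_bound mulr_ge0// mulr_ge0// addr_ge0// mulr_ge0.
Qed.

Lemma stability_const_ge0 m (b : R) : 0 <= b -> 0 <= stability_const m b.
Proof.
move=> b0; rewrite /stability_const addr_ge0//.
  by rewrite mulr_ge0 ?exprn_ge0// mulr_ge0 ?sqr_ge0// mulr_ge0 ?sqr_ge0.
apply: addr_ge0; last by rewrite addr_ge0.
by rewrite divr_ge0// mulr_ge0// mulr_ge0 ?sqr_ge0// mulr_ge0 ?sqr_ge0.
Qed.

Lemma concentration_const_gt0 m (eps L : R) : (0 < m)%N -> 0 < eps -> 0 <= L ->
  0 < concentration_const m eps L.
Proof.
move=> m0 e0 L0; have b1 := density_bound_ge1 m e0 L0.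
have b0 : 0 < density_bound m eps L by exact: lt_le_trans b1.
rewrite /concentration_const mulr_gt0//.
  by rewrite (lt_le_trans ltr01)// lerDl stability_const_ge0// ltW.
by rewrite sqrtr_gt0 mulr_gt0 ?exprn_gt0// mulr_gt0 ?ltr0n// mulr_gt0// expR_gt0.
Qed.

(** The exponent [q] is at most [2 * t], which turns the threshold into a multiple
    of [t / N]. *)
Lemma threshold_le m n (b t : R) q : q%:R <= 2 * t ->
  Num.sqrt (@threshold R m n b q) <=
  Num.sqrt (32 * expR 3 * m%:R * b ^+ 2) * Num.sqrt (t / n.+1%:R).
Proof.
move=> qt; rewrite -sqrtrM; last first.
  by rewrite mulr_ge0 ?sqr_ge0// mulr_ge0// mulr_ge0// expR_ge0.
rewrite ler_wsqrtr// /threshold /variance_proxy.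
have -> : 32 * expR 3 * m%:R * b ^+ 2 * (t / n.+1%:R) =
    4 * (2 * t) * (4 * m%:R * b ^+ 2 / n.+1%:R) * expR 3.
  by field; rewrite addrC natr1 pnatr_eq0.
rewrite ler_wpM2r ?expR_ge0// ler_wpM2r//; last by rewrite ler_wpM2l.
by rewrite divr_ge0// mulr_ge0 ?sqr_ge0// mulr_ge0.
Qed.

End constants.

Section concentration.
Context (dT : measure_display) (T : measurableType dT) (R : realType).
Context (m : nat) (nu : 'I_m -> probability T R).
Local Notation U := (m.-tuple T).
Local Notation PP := (tuple_prod nu).
Variables (eps : R) (D : set U) (c : U -> R) (M : R).
Hypotheses (m2 : (2 <= m)%N) (eps0 : 0 < eps) (mD : measurable D) (mc : measurable_fun D c).
Hypotheses (M0 : 0 <= M) (cM : forall x, D x -> `|c x| <= M) (aeD : {ae PP, forall x, D x}).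

Let m0 : (0 < m)%N. Proof. exact: leq_trans m2. Qed.
Let k := c \_ D.
Let bk : bounded_mfun k. Proof. exact: (bmf_ct mD mc cM). Qed.
Let kM x : `|k x| <= M.
Proof.
rewrite /k patchE; case: ifPn => [xD|_]; last by rewrite normr0.
exact/cM/set_mem.
Qed.

Lemma gibbs_between (f : 'I_m -> T -> R) :
  (forall j a, `|f j a| <= potential_bound m eps M) ->
  let b := density_bound m eps M in forall x, b^-1 <= gibbs eps k f x <= b.
Proof.
move=> fB b x; rewrite /b /density_bound /gibbs -expRN !ler_expR -ler_norml.
rewrite (le_trans (ler_normB _ _))// lerD//.
  rewrite (le_trans (ler_norm_sum _ _ _))// mulr_natl -[X in _ <= _ *+ X](card_ord m) -sumr_const.
  by apply: ler_sum => j _; exact: fB.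
by rewrite normrM normfV (gtr0_norm eps0) ler_wpM2r// invr_ge0 ltW.
Qed.

Context (n : nat) (dO : measure_display) (Omega : measurableType dO).
Variables (P : probability Omega R) (xi : 'I_m -> 'I_n.+1 -> {RV P >-> T}).
Hypothesis indep : independent_samples nu xi.
Local Notation I := {: 'I_m * 'I_n.+1}.

Definition sample (w : Omega) : #|I|.-tuple T :=
  [tuple xi (enum_val i).1 (enum_val i).2 w | i < #|I|].

Lemma sample_at_sample w j i : sample_at (sample w) j i = xi j i w.
Proof. by rewrite /sample_at tnth_mktuple enum_rankK. Qed.

(** Mutual independence over all observations, tested on boxes. *)
Lemma law_sample : law P sample (tuple_prod (@sample_law _ _ _ m n nu)).
Proof.
apply: law_tuple_prod.
  apply/measurable_fun_tnthP => i.
  rewrite (_ : _ \o _ = xi (enum_val i).1 (enum_val i).2) //.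
  by apply/funext => w /=; rewrite tnth_mktuple.
move=> A mA; have [same ind] := indep.
pose A' (jk : I) := A (enum_rank jk).
have := ind [set: I]%SET A' (fun i => mA _).
rewrite (_ : \bigcap_(i in _) _ = [set u | forall j, A j (tnth (sample u) j)]); last first.
  apply/seteqP; split=> w /= H i.
    by have := H (enum_val i); rewrite /A' enum_valK tnth_mktuple; apply; rewrite /= inE.
  by move=> _; have := H (enum_rank i); rewrite tnth_mktuple enum_rankK.
move=> ->; rewrite (eq_bigr (fun jk : I => nu jk.1 (A' jk))); last first.
  by move=> jk _; exact: (same jk.1 jk.2 (A' jk) (mA _)).
rewrite (eq_bigl (fun i : I => i \in I)); last by move=> i; rewrite !inE.
rewrite (big_enum_val (A := I)); apply: eq_bigr => i _.
by rewrite /A' /sample_law enum_valK.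
Qed.

(** For [t < 1] the claimed probability is at most zero and the empty event will do.
    Otherwise take [q] between [t] and [2 * t]; on the good event
    [coupling_stability] bounds the L^1 distance between the empirical density and
    the Gibbs density, and the test statistic accounts for replacing the population
    product by the empirical one. *)
Theorem coupling_concentration (pistar : probability U R) (pihat : Omega -> probability U R) :
  schrodinger_coupling eps D c nu pistar ->
  (forall w, schrodinger_coupling eps D c (fun j => empirical R (fun i => xi j i w)) (pihat w)) ->
  forall (g : U -> R) (G : R), measurable_fun setT g -> 0 <= G ->
  {ae PP, forall x, `|g x| <= G} ->
  forall t : R, 0 < t ->
  exists E : set Omega,
  [/\ measurable E,
      ((1 - (2 * m%:R ^+ 2 - 2 * m%:R + 2) * expR (- t))%:E <= P E)%E &
      forall w, E w ->
        `|\int[pistar]_(x in D) g x - \int[pihat w]_(x in D) g x| <=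
        concentration_const m eps M * G * Num.sqrt (t / n.+1%:R)].
Proof.
move=> spi shat g G mg G0 gG t t0.
have mr2 : 2 <= m%:R :> R by rewrite ler_nat.
have [t1|t1] := ltP t 1.
  exists set0; split => //; rewrite measure0 lee_fin subr_le0.
  (* As [2 * m ^+ 2 - 2 * m + 2] is at least 6, any lower bound above 1 / 6 would do. *)
  have e4 : 4^-1 <= expR (- t).
    have h : (1 - 1 / 2) ^+ 2 <= expR (- (1 : R)).
      rewrite (_ : - 1 = - (1 / 2) + - (1 / 2)); last by field.
      rewrite expRD -expr2 ler_sqr ?nnegrE ?expR_ge0//; last by lra.
      exact: expR_ge1Dx.
    apply: (@le_trans _ _ (expR (- 1))); last by rewrite ler_expR lerN2 ltW.
    by apply: le_trans h; rewrite (_ : (1 - 1 / 2) ^+ 2 = 4^-1)//; field.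
  have m6 : 6 <= 2 * m%:R ^+ 2 - 2 * m%:R + 2 :> R.
    have : 0 <= m%:R * (m%:R - 2) :> R by rewrite mulr_ge0// subr_ge0.
    by lra.
  by apply: le_trans (ler_pM _ _ m6 e4) => //; lra.
pose q := (Num.truncn t).+1.
have qt : t <= q%:R <= 2 * t.
  have /andP[h1 h2] := truncn_itv (ltW t0).
  by rewrite (ltW h2) /q -natr1/=; lra.
have /andP[tq q2t] := qt.
pose b := density_bound m eps M.
have b1 : 1 <= b by exact: density_bound_ge1.
have b0 : 0 < b by exact: lt_le_trans b1.
have [p hp pmin] := schrodinger_density eps0 mD mc cM m0 spi.
have [f [bf fB pE]] := schrodinger_potentials m0 eps0 bk kM pmin.
have gb := gibbs_between fB.
pose rho := gibbs eps k f.
have brho : bounded_mfun rho by exact: bmf_gibbs.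
have rhob x : `|rho x| <= b.
  by rewrite ger0_norm ?expR_ge0//; have /andP[] := gb x.
have marg j := cond_ae_one j m0 pmin.1 brho pE.
pose A := tame_set D g G.
have mA : measurable A by exact: measurable_tame.
have aeA : {ae PP, forall x, A x} by apply: filterS2 aeD gG => x; split.
pose gn := normalized D g G.
have bn : bounded_mfun gn by exact: bmf_normalized.
have n1 x : `|gn x| <= 1 by exact: normalized_le1.
pose h x := gn x * rho x.
have bh : bounded_mfun h by exact: bmfM.
have hb x : `|h x| <= b by rewrite normrM -[b]mul1r ler_pM.
pose th := @threshold R m n b q.
have th0 : 0 < th by exact: threshold_gt0.
pose E1 := @good_event _ T R m n nu rho h b q A.
have mE1 : measurable E1 by exact: measurable_good_event.
exists (sample @^-1` E1); split.
- by rewrite -[X in measurable X]setTI; exact: law_sample.1.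
- rewrite -(law_sample.2 _ mE1) -[E1]setCK probability_setC; last exact: measurableC.
  rewrite (Rint_indic _ (measurableC mE1)) -EFinB lee_fin lerD2l lerN2.
  have := good_event_probability n m0 b0 (isT : (0 < q)%N) brho rhob bh hb marg mA aeA.
  move=> /le_trans; apply.
  apply: (@le_trans _ _ (m.+1%:R * (2 * expR (- t)))).
    by rewrite ler_wpM2l// ler_wpM2l// ler_expR lerN2.
  rewrite mulrA ler_wpM2r ?expR_ge0// -natr1.
  have : 0 <= m%:R * (m%:R - 2) :> R by rewrite mulr_ge0// subr_ge0.
  by lra.
move=> w [picks dev Vdev].
pose muh j := empirical_prob R (sample_at (sample w) j).
have hatw : schrodinger_coupling eps D c muh (pihat w).
  have := shat w; congr (schrodinger_coupling _ _ _ _ _).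
  by apply/funext => j; rewrite /muh /empirical_prob; congr (empirical R _); apply/funext => i; rewrite sample_at_sample.
have [ph hph phmin] := schrodinger_density eps0 mD mc cM m0 hatw.
have r0 : 0 < Num.sqrt th by rewrite sqrtr_gt0.
have stab := coupling_stability m0 eps0 bk bf b1 gb phmin r0.
have {}stab : \int[tuple_prod muh]_x `|ph x - rho x| <= stability_const m b * Num.sqrt th.
  by apply: stab => j; rewrite sqr_sqrtr ?(ltW th0)// deviationE//; exact: dev.
have aeAh : {ae tuple_prod muh, forall x, A x}.
  exists (~` A); split => //; first exact: measurableC.
  have bC := bmf_indic R (measurableC mA).
  rewrite Rint_indic; last exact: measurableC.
  rewrite (Rint_empirical_prod _ bC) /vstat big1 ?mulr0// => kap _.
  by rewrite indicE memNset//; apply; exact: picks.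
rewrite (density_Rint_tame mD mg G0 hp aeA) (density_Rint_tame mD mg G0 hph aeAh).
rewrite -mulrBr normrM (ger0_norm G0) mulrAC mulrC ler_wpM2r//.
have Ip : \int[PP]_x (p x * normalized D g G x) = \int[PP]_x h x.
  apply: Rint_ae.
  - by case: (rintM (let: And4 r _ _ _ := pmin.1 in r) bn).
  - by case: bh.
  - by apply: filterS pE => x ->; rewrite mulrC.
have [rph _ _ _] := phmin.1.
have Vh : \int[tuple_prod muh]_x h x = vstat h (sample_at (sample w)) by exact: Rint_empirical_prod.
have rh := bmf_rint (tuple_prod muh) bh.
have rphn : Rintegrable (tuple_prod muh) (fun x => ph x * gn x) by exact: rintM.
have rd : Rintegrable (tuple_prod muh) (fun x => ph x - rho x).
  by apply: rintB => //; exact: bmf_rint.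
have d1 : `|\int[PP]_x h x - vstat h (sample_at (sample w))| <= Num.sqrt th.
  by rewrite distrC -sqrtr_sqr ler_wsqrtr.
have d2 : `|\int[tuple_prod muh]_x h x - \int[tuple_prod muh]_x (ph x * gn x)| <=
    stability_const m b * Num.sqrt th.
  rewrite (le_trans _ stab)// -RintB// (le_trans (Rint_norm_le (rintB rh rphn)))//.
  apply: le_Rint; [exact/rint_norm/rintB|exact: rint_norm|move=> x].
  rewrite /h [ph x * _]mulrC -mulrBr normrM distrC -[leRHS]mul1r ler_wpM2r//.
rewrite Ip.
rewrite (_ : _ - _ = (\int[PP]_x h x - vstat h (sample_at (sample w))) +
  (\int[tuple_prod muh]_x h x - \int[tuple_prod muh]_x (ph x * gn x))); last first.
  by rewrite Vh addrA subrK.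
rewrite (le_trans (ler_normD _ _))// (le_trans (lerD d1 d2))//.
rewrite -[X in X + _]mul1r -mulrDl /concentration_const/= -/b -[leRHS]mulrA ler_wpM2l//.
  by rewrite addr_ge0// stability_const_ge0// ltW.
exact: threshold_le.
Qed.

End concentration.

Lemma measurable_compact (R : realType) d (K : set (borel_rV R d)) :
  compact (K : set 'rV[R]_d) -> measurable K.
Proof.
move=> cK; rewrite -[K]setCK; apply: measurableC; apply: sub_sigma_algebra.
by apply: closed_openC; apply: compact_closed => //; exact: norm_hausdorff.
Qed.

Theorem theorem4p3 (R : realType) :
  exists C : nat -> R -> R -> R,
  forall (m d : nat) (eps : R), (2 <= m)%N -> (1 <= d)%N -> 0 < eps ->
  forall Xs : 'I_m -> set 'rV[R]_d,
  (forall j, compact (Xs j)) ->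
  (forall j, interior (Xs j) !=set0) ->
  (forall j x, Xs j x -> forall i, -1 <= x ord0 i <= 1) ->
  forall nu : 'I_m -> probability (borel_rV R d) R,
  (forall j, nu j (Xs j) = 1%E) ->
  let X := [set x : m.-tuple (borel_rV R d) | forall j, Xs j (tnth x j)] in
  forall c : m.-tuple (borel_rV R d) -> R,
  measurable_fun X c ->
  (exists M : R, forall x, X x -> `|c x| <= M) ->
  0 < C m eps (sup_norm X c) /\
  forall (n : nat) (dO : measure_display) (Omega : measurableType dO)
    (P : probability Omega R)
    (xi : 'I_m -> 'I_n.+1 -> {RV P >-> borel_rV R d}),
  independent_samples nu xi ->
  forall (pistar : probability (m.-tuple (borel_rV R d)) R)
    (pihat : Omega -> probability (m.-tuple (borel_rV R d)) R),
  schrodinger_coupling eps X c nu pistar ->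
  (forall w, schrodinger_coupling eps X c
     (fun j => empirical R (fun k => xi j k w)) (pihat w)) ->
  forall g : m.-tuple (borel_rV R d) -> R,
  g \in Lfun (tuple_prod nu) +oo%E ->
  forall t : R, 0 < t ->
  exists E : set Omega,
  [/\ measurable E,
      ((1 - (2 * m%:R ^+ 2 - 2 * m%:R + 2) * expR (- t))%:E <= P E)%E &
      forall w, E w ->
        `|\int[pistar]_(x in X) g x - \int[pihat w]_(x in X) g x| <=
        C m eps (sup_norm X c) *
        fine ('N[tuple_prod nu]_+oo%E [EFin \o g])%E *
        Num.sqrt (t / n.+1%:R)].
Proof.
exists (@concentration_const R) => m d eps m2 d1 eps0 Xs cXs iXs bXs nu nuX X c mc [M cM].
have mXs j : measurable (Xs j : set (borel_rV R d)) by exact: measurable_compact.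
have mX : measurable X by exact: measurable_box.
have X0 : X !=set0.
  pose pt j := sval (cid (iXs j)).
  exists [tuple pt j | j < m] => j; rewrite tnth_mktuple.
  by apply: interior_subset; exact: (svalP (cid (iXs j))).
have cS x : X x -> `|c x| <= sup_norm X c.
  move=> Xx; apply: sup_upper_bound; last by exists x.
  split; first by have [y Xy] := X0; exists `|c y|; exists y.
  by exists M => _ [y Xy <-]; exact: cM.
have S0 : 0 <= sup_norm X c.
  by have [y Xy] := X0; exact: le_trans (normr_ge0 _) (cS y Xy).
have aeX : {ae tuple_prod nu, forall x, X x}.
  exists (~` X); split => //; first exact: measurableC.
  rewrite probability_setC// (tuple_prod_box nu mXs).
  by rewrite big1 ?subee.
split; first by apply: concentration_const_gt0 => //; exact: leq_trans m2.
move=> n dO Omega P xi indep pistar pihat spi shat g gL t t0.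
have [mg [G0 gG]] := Lfun_ae_bound gL.
exact: (coupling_concentration m2 eps0 mX mc S0 cS aeX indep spi shat mg G0 gG t0).
Qed.
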